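(* The notions of a (finite dimensional) Manin $L_\infty$-triple and an $L_\infty$-bialgebra are equivalent.
   Context: The ground field $\mathbb K$ is $\mathbb R$ or $\mathbb C$. The Koszul sign convention is used throughout: in a graded algebra, whenever two symbols change places there is a corresponding sign. $V=\bigoplus_a V^a$ is a finite dimensional graded vector space; $V^*$ carries the grading of opposite sign (the dual of $V^a$ has degree $-a$). The degree of a homogeneous element $x$ is denoted $\widetilde x$. For a graded space $X$, $X[n]_i=X_{i+n}$. Total degree. For homogeneous $x_i^*\in V^*$, $y^j\in V$, the element $x_1^*\cdots x_p^*\,y^1\cdots y^q\in\bigwedge^pV^*\otimes\bigwedge^qV$ has total degree $\sum\widetilde{x_i^*}+\sum\widetilde{y^j}+(p+q-2)$. A map $\bigwedge^pV\to\bigwedge^qV$ sending $v^1\cdots v^p$ to $u^1\cdots u^q$ has total degree $\sum\widetilde{u^i}-\sum\widetilde{v^j}+(p+q-2)$. Big bracket. Let $B=\bigoplus_{j\ge-2}B^j$ with $B^j=\bigoplus_{p+q=j;\ p,q\ge-1}\bigwedge^{p+1}V^*\otimes\bigwedge^{q+1}V$, so $B^{-2}=\mathbb K$ and $B^{-1}=V\oplus V^*$. The big bracket is the graded Lie bracket $[\cdot,\cdot]$ on $B$ such that $[u,v]=\langle u,v\rangle$ for $u,v\in V\oplus V^*$, where $\langle x+v,y+w\rangle=\langle x,w\rangle+\langle v,y\rangle$ for $x,y\in V$, $v,w\in V^*$ is given by the natural pairing; $[u,v]=0$ if $u$ or $v$ is in $\mathbb K$; and it is extended by linearity and the graded Leibniz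 rule $[u,v\wedge w]=[u,v]\wedge w+(-1)^{kl}v\wedge[u,w]$ for $u\in B^k$, $v\in B^l$ (with the Koszul signs coming from the grading of $V$ when $V$ is graded). It satisfies $[u,v]=-(-1)^{kl}[v,u]$ with the same convention. $L_\infty$-bialgebra. An $L_\infty$-bialgebra structure on $V$ is a set of maps $\tau_{kl}:\bigwedge^kV\to\bigwedge^lV[3-(k+l)]$, $k,l\ge1$, of total degree $1$, given by $\tau_{kl}(v_1\wedge\cdots\wedge v_k)=[[\cdots[[t_{kl},v_1],v_2]\cdots],v_k]$ with $t_{kl}\in\bigwedge^kV^*\otimes\bigwedge^lV$, such that the element $T=\sum_{k\ge1,\,l\ge1}t_{kl}$, of total degree $1$, satisfies $[T,T]=0$. $L_\infty$-algebra. An $L_\infty$-structure on a graded space $W$ is a set of maps $\lambda_k:\bigwedge^kW\to W[2-k]$, $k\ge1$, of total degree $1$, such that $\lambda^2=0$ for $\lambda=\sum_{k\ge1}\lambda_k$. Here $\lambda_k$ acts on $\bigwedge^nW$ as a coderivation: $\lambda_k(v_1\wedge\cdots\wedge v_n)=0$ if $k>n$, and otherwise it equals $\sum_\sigma(-1)^{\mathrm{sgn}\,\sigma}\lambda_k(v_{\sigma(1)}\wedge\cdots\wedge v_{\sigma(k)})\wedge v_{\sigma(k+1)}\wedge\cdots\wedge v_{\sigma(n)}$, the sum being over permutations $\sigma$ of $n$ elements with $\sigma(1)<\cdots<\sigma(k)$ and $\sigma(k+1)<\cdots<\sigma(n)$. A subspace $U\subset W$ is an $L_\infty$-subalgebra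 if it is invariant under the $L_\infty$-structure, i.e. the maps $\lambda_k$ restrict to maps $\bigwedge^kU\to U[2-k]$. Manin $L_\infty$-triple. A finite dimensional Manin $L_\infty$-triple is a triple of finite dimensional $L_\infty$-algebras $(\mathfrak g,\mathfrak g_+,\mathfrak g_-)$ equipped with a nondegenerate bilinear form $\langle\cdot,\cdot\rangle$ such that: $\mathfrak g_+,\mathfrak g_-$ are $L_\infty$-subalgebras of $\mathfrak g$ with $\mathfrak g=\mathfrak g_+\oplus\mathfrak g_-$ as a vector space; $\mathfrak g_+$ and $\mathfrak g_-$ are isotropic with respect to $\langle\cdot,\cdot\rangle$; and the $n$-brackets $\lambda_n:\bigwedge^n\mathfrak g\to\mathfrak g$ constituting the $L_\infty$-algebra structure of $\mathfrak g$ are invariant with respect to the form, that is $$\langle\lambda_n(v_1\wedge\cdots\wedge v_n),v_0\rangle=(-1)^{\widetilde{v_n}\,\widetilde{v_0}}\langle\lambda_n(v_1\wedge\cdots\wedge v_{n-1}\wedge v_0),v_n\rangle .$$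
   Formalization: The form of a Manin triple is also required to be graded symmetric and of degree 0, and the invariance sign uses total degrees (degree minus 1) of v_n and v_0; without this the equivalence fails, e.g. for zero brackets with a nonsymmetric form, or for ordinary Lie bialgebras. *)

(* Defs.v *)
From HB Require Import structures.
From mathcomp Require Import all_boot all_order all_algebra perm.
From mathcomp Require Import finmap.
From mathcomp.multinomials Require Import monalg.

Set Implicit Arguments.
Unset Strict Implicit.
Unset Printing Implicit Defensive.

Import Order.TTheory GRing.Theory Num.Theory.
Local Open Scope ring_scope.

(* A finite dimensional graded vector space, presented by a homogeneous basis:
   the space is K^gdim and its i-th standard basis vector has degree gdeg i. *)
Record gvect := GVect { gdim : nat; gdeg : 'I_gdim -> int }.

Notation letter V := ('I_(gdim V)).
Notation vec K V := 'rV[K]_(gdim V).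

Section Words.
Variable V : gvect.
Implicit Types (i : letter V) (w : seq (letter V)).

(* Parity of the total degree of the basis vector e_i viewed in the exterior
   algebra, which is gdeg i + (1 - 2).  All Koszul signs are taken with respect
   to total degree: v /\ w = (-1)^(|v||w|) w /\ v, with |v| the total degree. *)
Definition par i : bool := odd `|gdeg i - 1|%N.

Definition wpar w : bool := odd (count par w).

Definition wdeg w : int := \sum_(i <- w) gdeg i.

(* Words indexing the monomial basis of the exterior algebra: a letter of even
   total degree may be repeated, a letter of odd total degree may not. *)
Definition is_normal w : bool :=
  sorted (fun i j : letter V => (i < j)%N || (i == j) && ~~ par i) w.

Record nword := NWord { nwval :> seq (letter V); nwvalP : is_normal nwval }.

HB.instance Definition _ := [isSub for nwval].
HB.instance Definition _ := [Choice of nword by <:].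

End Words.

(* The exterior algebra, with the ordered monomials as basis. *)
Notation ext K V := {malg K[nword V]}.

Section Exterior.
Variables (K : numFieldType) (V : gvect).
Local Notation ext := (ext K V).
Implicit Types (i : letter V).

Definition sgnb (b : bool) : K := (-1) ^+ b.

(* Koszul sign of the permutation sorting w. *)
Fixpoint ksgn (w : seq (letter V)) : K :=
  if w is i :: w' then
    (-1) ^+ count (fun j : letter V => [&& (j < i)%N, par i & par j]) w' * ksgn w'
  else 1.

(* The monomial e_{w_1} /\ ... /\ e_{w_n}; it vanishes when a letter of odd
   total degree is repeated. *)
Definition mono (w : seq (letter V)) : ext :=
  if insub (sort (fun i j : letter V => (i <= j)%N) w) is Some u
  then ksgn w *: << (u : nword V) >> else 0.

Definition ext_lin (E : lmodType K) (F : nword V -> E) (x : ext) : E :=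
  \sum_(w <- msupp x) x@_w *: F w.

Definition wedge (x y : ext) : ext :=
  ext_lin (fun v => ext_lin (fun w => mono (v ++ w)) y) x.

Definition gen (v : vec K V) : ext := \sum_i v 0 i *: mono [:: i].

Definition wprod (vs : seq (vec K V)) : ext :=
  foldr (fun v x => wedge (gen v) x) (mono [::]) vs.

(* Coordinates of the component of x in weight 1, i.e. in V itself. *)
Definition proj1 (x : ext) : vec K V :=
  ext_lin (fun w => if (w : seq _) is [:: i] then delta_mx 0 i else 0) x.

Definition vhom (a : int) (v : vec K V) : Prop :=
  forall i, v 0 i != 0 -> gdeg i = a.

Definition in_ext (k : nat) (x : ext) : Prop :=
  forall w : nword V, w \in msupp x -> size w = k.

(* x lies in the k-th exterior power and is homogeneous of (internal) degree
   a. *)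
Definition ext_hom (k : nat) (a : int) (x : ext) : Prop :=
  in_ext k x /\ forall w : nword V, w \in msupp x -> wdeg w = a.

End Exterior.

Arguments mono {K V} w.
Arguments sgnb K b : clear implicits.

Definition ext_map (K : numFieldType) (V W : gvect) (f : vec K V -> vec K W)
    (x : ext K V) : ext K W :=
  ext_lin (fun w => wprod [seq f (delta_mx 0 i) | i <- w]) x.

Section LInfinity.
Variables (K : numFieldType) (W : gvect).

Definition unshuffle (k n : nat) (s : 'S_n) : bool :=
  [forall i : 'I_n, forall j : 'I_n,
     [&& (i < j)%N & (j < k)%N || (k <= i)%N] ==> (s i < s j)%N].

(* Koszul sign of v_1 ... v_n |-> v_{s 1} ... v_{s n}, the parity of v_i being
   p i. *)
Definition koszul (n : nat) (p : 'I_n -> bool) (s : 'S_n) : K :=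
  \prod_(i < n) \prod_(j < n | (i < j)%N && (s j < s i)%N)
     sgnb K (p (s i) && p (s j)).

(* The coderivation extending f : /\^k W -> W, on a monomial e_w. *)
Definition coder_word (k : nat) (f : ext K W -> vec K W) (w : seq (letter W))
    : ext K W :=
  if (k <= size w)%N then
    \sum_(s : 'S_(size w) | unshuffle k s)
       let w' := [seq tnth (in_tuple w) (s i) | i <- enum 'I_(size w)] in
       koszul (fun i => par (tnth (in_tuple w) i)) s
         *: wedge (gen (f (mono (take k w')))) (mono (drop k w'))
  else 0.

(* lambda = \sum_(k >= 1) lambda_k; on a monomial of weight n only the terms
   with k <= n contribute. *)
Definition coder_sum (lam : nat -> ext K W -> vec K W) : ext K W -> ext K W :=
  ext_lin (fun w => \sum_(1 <= k < (size w).+1) coder_word k (lam k) w).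

(* lam_deg says that lam k maps /\^k W to W[2 - k] with degree 0, that is, has
   total degree 1.  Only the restriction of lam k to the k-th exterior power, k >= 1, is
   meaningful. *)
Record linf := Linf {
  lam :> nat -> {linear ext K W -> vec K W};
  lam_deg : forall k a (x : ext K W), (1 <= k)%N ->
    ext_hom k a x -> vhom (a + (2 - k%:Z)) (lam k x);
  lam_square : forall x : ext K W,
    coder_sum lam (coder_sum lam x) = 0
}.

Definition graded_sub (U : {vspace vec K W}) : Prop :=
  forall (v : vec K W) (a : int), v \in U ->
    \row_i (if gdeg i == a then v 0 i else 0) \in U.

Definition linf_sub (L : linf) (U : {vspace vec K W}) : Prop :=
  forall (k : nat) (vs : k.-tuple (vec K W)), (1 <= k)%N ->
    {in vs, forall v, v \in U} -> L k (wprod vs) \in U.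

Definition isotropic (B : vec K W -> vec K W -> K) (U : {vspace vec K W})
    : Prop :=
  {in U &, forall u v, B u v = 0}.

(* The form is a graded symmetric form of degree 0 (the convention for the
   pairing in the big bracket).  In the invariance condition the sign is the
   Koszul sign for exchanging v_n and v_0 in the exterior algebra, hence is
   given by their total degrees a - 1 and b - 1; for W concentrated in degree 0
   it is -1, as for Lie algebras. *)
Record manin_triple := ManinTriple {
  mt_linf :> linf;
  mt_plus : {vspace vec K W};
  mt_minus : {vspace vec K W};
  mt_form : {biscalar vec K W};
  mt_plus_graded : graded_sub mt_plus;
  mt_minus_graded : graded_sub mt_minus;
  mt_plus_sub : linf_sub mt_linf mt_plus;
  mt_minus_sub : linf_sub mt_linf mt_minus;
  mt_sum : (mt_plus + mt_minus = fullv)%VS;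
  mt_direct : (mt_plus :&: mt_minus = 0)%VS;
  mt_form_deg : forall a b u v, vhom a u -> vhom b v ->
    a + b != 0 -> mt_form u v = 0;
  mt_form_sym : forall a b u v, vhom a u -> vhom b v ->
    mt_form u v = sgnb K (odd `|a|%N && odd `|b|%N) * mt_form v u;
  mt_form_nondeg : forall u, (forall v, mt_form u v = 0) -> u = 0;
  mt_plus_iso : isotropic mt_form mt_plus;
  mt_minus_iso : isotropic mt_form mt_minus;
  mt_invariant : forall (n : nat) (vs : n.-tuple (vec K W)) (a b : int) vn v0,
    vhom a vn -> vhom b v0 ->
    mt_form (mt_linf n.+1 (wprod (rcons vs vn))) v0 =
      sgnb K (odd `|a - 1|%N && odd `|b - 1|%N)
        * mt_form (mt_linf n.+1 (wprod (rcons vs v0))) vn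
}.

End LInfinity.

(* V (+) V^*: the first gdim V letters are the basis of V, the last ones the
   dual basis of V^*. *)
Definition dbl (V : gvect) : gvect :=
  @GVect (gdim V + gdim V)
    (fun i => match split i with inl j => gdeg j | inr j => - gdeg j end).

Section BigBracket.
Variables (K : numFieldType) (V : gvect).
Implicit Types (i j : letter (dbl V)) (u w : seq (letter (dbl V))).

Definition is_dual i : bool := ~~ (i < gdim V)%N.

Definition inV (v : vec K V) : vec K (dbl V) := row_mx v 0.
Definition inVdual (v : vec K V) : vec K (dbl V) := row_mx 0 v.

(* <xi, y> = xi(y) and <x, xi> = (-1)^(|x||xi|) xi(x). *)
Definition dpair i j : K :=
  match split i, split j with
  | inr a, inl b => (a == b)%:R
  | inl a, inr b => sgnb K (odd `|gdeg a|%N) * (a == b)%:R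
  | _, _ => 0
  end.

Definition dform (x y : vec K (dbl V)) : K :=
  \sum_i \sum_j x 0 i * y 0 j * dpair i j.

(* [e_i, e_w], by the Leibniz rule
   [e_i, e_j /\ z] = <e_i, e_j> z + (-1)^(|i||j|) e_j /\ [e_i, z]. *)
Fixpoint bracket_letter i w : ext K (dbl V) :=
  if w is j :: w' then
    dpair i j *: mono w'
      + sgnb K (par i && par j) *: wedge (mono [:: j]) (bracket_letter i w')
  else 0.

(* [e_u, e_w], by the Leibniz rule in the first argument
   [e_i /\ z, y] = e_i /\ [z, y] + (-1)^(|z||y|) [e_i, y] /\ z, which
   is equivalent to the one in the second argument by graded antisymmetry. *)
Fixpoint bracket_word u w : ext K (dbl V) :=
  if u is i :: u' then
    wedge (mono [:: i]) (bracket_word u' w)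
      + sgnb K (wpar u' && wpar w) *: wedge (bracket_letter i w) (mono u')
  else 0.

Definition bracket (x y : ext K (dbl V)) : ext K (dbl V) :=
  ext_lin (fun u : nword _ =>
    ext_lin (fun w : nword _ => bracket_word u w) y) x.

(* [[...[x, v_1], v_2]...], v_n]. *)
Definition iter_bracket (x : ext K (dbl V)) (vs : seq (vec K (dbl V)))
    : ext K (dbl V) :=
  foldl (fun y v => bracket y (gen v)) x vs.

(* T = \sum_(k, l >= 1) t_kl has in general infinitely many terms, so
   [T, T] = 0 is expressed componentwise: bi_square says that the component of
   [T, T] in /\^a V^* (x) /\^b V vanishes.  Indices 0 are irrelevant. *)
Record linf_bialgebra := LinfBialgebra {
  bi_tau : nat -> nat -> {linear ext K V -> ext K V};
  bi_t : nat -> nat -> ext K (dbl V);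
  bi_tau_deg : forall k l a (x : ext K V), (1 <= k)%N -> (1 <= l)%N ->
    ext_hom k a x -> ext_hom l (a + (3 - (k + l)%:Z)) (bi_tau k l x);
  bi_t_bideg : forall k l (w : nword (dbl V)), (1 <= k)%N -> (1 <= l)%N ->
    w \in msupp (bi_t k l) ->
    count is_dual w = k /\ count (predC is_dual) w = l;
  bi_t_deg : forall k l (w : nword (dbl V)), (1 <= k)%N -> (1 <= l)%N ->
    w \in msupp (bi_t k l) -> wdeg w + ((k + l)%:Z - 2) = 1;
  bi_tauE : forall k l (vs : k.-tuple (vec K V)), (1 <= k)%N -> (1 <= l)%N ->
    ext_map inV (bi_tau k l (wprod vs)) = iter_bracket (bi_t k l) (map inV vs);
  bi_square : forall a b : nat,
    \sum_(1 <= k < a.+1) \sum_(1 <= l < b.+1)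
       bracket (bi_t k l) (bi_t (a.+1 - k) (b.+1 - l)) = 0
}.

Definition bialgebra_eq (X Y : linf_bialgebra) : Prop :=
  forall k l (x : ext K V), (1 <= k)%N -> (1 <= l)%N -> in_ext k x ->
    bi_tau X k l x = bi_tau Y k l x.

(* The n-bracket on V (+) V^* defined by a bialgebra structure:
   \sum_(k + l = n + 1) [[...[t_kl, v_1], ...], v_n]. *)
Definition double_bracket (X : linf_bialgebra) (n : nat)
    (vs : seq (vec K (dbl V))) : vec K (dbl V) :=
  proj1 (\sum_(1 <= k < n.+1) iter_bracket (bi_t X k (n.+1 - k)) vs).

End BigBracket.

Section Comparison.
Variables (K : numFieldType) (V W : gvect).

(* f is an isomorphism of graded spaces from V onto the subspace U of W. *)
Definition graded_iso_onto (f : 'Hom(vec K V, vec K W)) (U : {vspace vec K W})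
    : Prop :=
  [/\ forall a v, vhom a v -> vhom a (f v), lker f = 0%VS & limg f = U].

End Comparison.

(* phi is an isomorphism from the double of X, that is V (+) V^* with the
   brackets double_bracket, the subspaces V and V^*, and the canonical pairing,
   to the Manin triple M. *)
Definition double_iso (K : numFieldType) (V W : gvect) (X : linf_bialgebra K V)
    (M : manin_triple K W) (phi : 'Hom(vec K (dbl V), vec K W)) : Prop :=
  [/\ graded_iso_onto phi fullv,
      (forall u, phi u \in mt_plus M <-> exists v, u = inV v),
      (forall u, phi u \in mt_minus M <-> exists v, u = inVdual v),
      (forall u v, mt_form M (phi u) (phi v) = dform u v)
    & (forall n (vs : n.-tuple (vec K (dbl V))), (1 <= n)%N ->
         M n (wprod (map phi vs)) = phi (double_bracket X n vs))].

(* Main.v *)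
(* Taken in total degree, the exterior algebra S of V (+) V^* is a free
   supercommutative algebra, and the big bracket is an even Poisson bracket on
   it. Let a word v_1 ... v_n act on Q by [...[Q, v_1], ..., v_n] and keep the
   scalar part: this pairs S with the exterior algebra, and Euler's identity
   shows that the pairing is perfect in each weight. Under it, the coderivation
   whose n-ary part is the n-fold bracket with T is the adjoint of
   Q |-> [Q, T]. As T is odd, the adjoint of the squared coderivation is
   [[Q, T], T] = [Q, [T, T]] / 2, so the coderivation squares to zero if and
   only if [T, T] = 0.
   Conversely, invariance of the form of a Manin triple says that
   <lambda_n (v_1 ... v_n), v_{n+1}> is supersymmetric in all its arguments, so
   that it is represented by some T_{n+1} of weight n + 1; since both halves are
   isotropic subalgebras, T_{n+1} has no component in the exterior powers of V
   or of V^* alone. The form identifies the negative half with V^*, which leaves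
   no choice for the isomorphism nor for T. *)

From HB Require Import structures.
From mathcomp Require Import all_boot all_order all_algebra perm.
From mathcomp Require Import finmap.
From mathcomp.multinomials Require Import monalg.
From mathcomp Require Import reals complex.
From mathcomp Require Import zify ring.
(* Last, since [perm] has another [dpair]. *)
Require Import Defs.

Set Implicit Arguments.
Unset Strict Implicit.
Unset Printing Implicit Defensive.

Import Order.TTheory GRing.Theory Num.Theory.
Local Open Scope ring_scope.

(** * The monomial basis and its universal property *)

(** T is an infinite sum while elements of the exterior algebra are finite, so the adjunction cannot
    be stated for T itself. It is stated for the truncations [ttrunc]: a word of length at most N
    detects only terms of weight at most N + 1, and the coderivation never lengthens words, so one
    truncation serves for both of its applications. The components that truncation distorts in
    [T, T] are invisible for reasons of weight or bidegree. A finer grading, by the numbers of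
    letters from V and from V^*, separates T_{n+1} into its pieces: a word with k letters in V and l
    in V^* is brought to a scalar by [t k l] alone. To recover [T, T] = 0 from the vanishing of [Q,
    [T, T]], Q is taken to be a letter; antisymmetry then gives a bracket of [T, T] with a vector,
    which nondegeneracy can use. The bracket is a recursion on words, so each of its properties has
    two stages: the word formula respects adjacent transpositions ([swaps]) and hence descends to
    the algebra, then the identity follows by induction on words from the Leibniz rules. Jacobi is
    proved in the two cases that the adjunction calls for: against a vector, and for two odd
    elements. *)

Section LinearMaps.
Variable K : numFieldType.

(** Linearity is carried as a predicate on bare functions with closure lemmas: the maps compared
    below are brackets and pairings with one free slot, whose canonical linear structures would have
    to be rebuilt at each use. *)
Lemma lin0 (E E' : lmodType K) (f : E -> E') : linear f -> f 0 = 0.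
Proof.
move=> lf; have /esym/eqP := lf 1 0 0.
by rewrite !scale1r addr0 -subr_eq0 addrK => /eqP.
Qed.

Lemma linD (E E' : lmodType K) (f : E -> E') : linear f -> {morph f : x y / x + y}.
Proof. by move=> lf x y; have := lf 1 x y; rewrite !scale1r. Qed.

Lemma linZ (E E' : lmodType K) (f : E -> E') : linear f ->
  forall c x, f (c *: x) = c *: f x.
Proof. by move=> lf c x; have := lf c x 0; rewrite !addr0 (lin0 lf) addr0. Qed.

Lemma lin_sumf (E E' : lmodType K) (f : E -> E') : linear f ->
  forall I (r : seq I) (P : pred I) (F : I -> E),
  f (\sum_(i <- r | P i) F i) = \sum_(i <- r | P i) f (F i).
Proof.
by move=> lf I r P F; apply: (big_morph f (linD lf) (lin0 lf)).
Qed.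

Lemma lin_id (E : lmodType K) : linear (fun x : E => x).
Proof. by []. Qed.

Lemma lin_cst0 (E E' : lmodType K) : linear (fun _ : E => 0 : E').
Proof. by move=> c x y; rewrite scaler0 addr0. Qed.

Lemma lin_add (E E' : lmodType K) (f g : E -> E') :
  linear f -> linear g -> linear (fun x => f x + g x).
Proof. by move=> lf lg c x y; rewrite lf lg scalerDr addrACA. Qed.

Lemma lin_opp (E E' : lmodType K) (f : E -> E') :
  linear f -> linear (fun x => - f x).
Proof. by move=> lf c x y; rewrite lf opprD scalerN. Qed.

Lemma lin_scale (E E' : lmodType K) (a : K) (f : E -> E') :
  linear f -> linear (fun x => a *: f x).
Proof. by move=> lf c x y; rewrite lf scalerDr !scalerA mulrC. Qed.

Lemma lin_scalev (E E' : lmodType K) (f : E -> K^o) (e : E') :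
  linear f -> linear (fun x => f x *: e).
Proof. by move=> lf c x y; rewrite lf scalerDl scalerA. Qed.

Lemma lin_sum (E E' : lmodType K) I (r : seq I) (P : pred I) (f : I -> E -> E') :
  (forall i, linear (f i)) -> linear (fun x => \sum_(i <- r | P i) f i x).
Proof.
move=> lf c x y; rewrite scaler_sumr -big_split /=.
by apply: eq_bigr => i _; rewrite lf.
Qed.

Lemma lin_comp (E E' E'' : lmodType K) (g : E' -> E'') (f : E -> E') :
  linear g -> linear f -> linear (fun x => g (f x)).
Proof. by move=> lg lf c x y; rewrite lf lg. Qed.

End LinearMaps.

Section ExtBasics.
Variables (K : numFieldType) (V : gvect).
Local Notation ext := (ext K V).
Local Notation leT := (fun i j : letter V => (i <= j)%N).
Implicit Types (i j : letter V) (u w : seq (letter V)).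

Lemma sgnbD (b c : bool) : sgnb K (b (+) c) = sgnb K b * sgnb K c.
Proof. by rewrite /sgnb signr_addb. Qed.

Lemma sgnbK (b : bool) : sgnb K b * sgnb K b = 1.
Proof. by rewrite -sgnbD addbb. Qed.

Lemma sgnb_neq0 (b : bool) : sgnb K b != 0.
Proof. by rewrite signr_eq0. Qed.

(** [ext_lin] sums over the support, which changes under addition; a common larger index set makes
    such sums comparable. *)
Lemma ext_linEw (E : lmodType K) (F : nword V -> E) (D : {fset nword V}) (x : ext) :
  (msupp x `<=` D)%fset -> ext_lin F x = \sum_(w <- D) x@_w *: F w.
Proof.
move=> sub; rewrite /ext_lin; symmetry.
rewrite (big_fset_incl _ sub) // => w _ nw.
by rewrite mcoeff_outdom ?scale0r.
Qed.

Lemma lin_ext (E : lmodType K) (F : nword V -> E) : linear (ext_lin F : ext -> E).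
Proof.
move=> c x y.
pose D := (msupp x `|` msupp y `|` msupp (c *: x + y))%fset.
rewrite (@ext_linEw _ _ D x) ?(@ext_linEw _ _ D y) ?(@ext_linEw _ _ D (c *: x + y)).
- rewrite scaler_sumr -big_split /=; apply: eq_bigr => w _.
  by rewrite mcoeffD mcoeffZ scalerDl scalerA.
- by rewrite fsubsetUr.
- by rewrite /D -fsetUA fsetUCA fsubsetUl.
- by rewrite /D -fsetUA fsubsetUl.
Qed.

HB.instance Definition _ (E : lmodType K) (F : nword V -> E) :=
  GRing.isLinear.Build K ext E _ (ext_lin F) (lin_ext F).

Lemma ext_linU (E : lmodType K) (F : nword V -> E) (w : nword V) : ext_lin F << w >> = F w.
Proof.
by rewrite /ext_lin msuppU oner_eq0 big_seq_fset1 mcoeffUU scale1r.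
Qed.

Lemma malg_sum (x : ext) : x = \sum_(w <- msupp x) x@_w *: << w >>.
Proof.
rewrite [LHS]monalgE; apply: eq_bigr => w _.
by apply/malgP => k; rewrite mcoeffZ !mcoeffU mulr_natr.
Qed.

Lemma eq_ext_lin (E : lmodType K) (F G : nword V -> E) :
  F =1 G -> ext_lin F =1 (ext_lin G : ext -> E).
Proof. by move=> FG x; apply: eq_bigr => w _; rewrite FG. Qed.

Lemma letter_leq_total : total leT.
Proof. by move=> i j; apply: leq_total. Qed.
Lemma letter_leq_trans : transitive leT.
Proof. by move=> i j k; apply: leq_trans. Qed.
Lemma letter_leq_anti : antisymmetric leT.
Proof. by move=> i j /anti_leq /val_inj. Qed.

Lemma normal_sorted w : is_normal w -> sorted leT w.
Proof.
apply: sub_sorted => i j /orP[/ltnW //|/andP[/eqP -> _]]; exact: leqnn.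
Qed.

Lemma ksgn_sorted w : sorted leT w -> ksgn K w = 1.
Proof.
elim: w => //= i w IH pw.
have al : all (leT i) w by apply: order_path_min pw; exact: letter_leq_trans.
rewrite IH ?(path_sorted pw) // mulr1 (_ : count _ _ = 0%N) ?expr0 //.
apply/eqP; rewrite -leqn0 leqNgt -has_count; apply/hasPn => j jw /=.
by rewrite ltnNge (allP al).
Qed.

Lemma monoU (w : nword V) : mono w = << w >> :> ext.
Proof.
have sw := normal_sorted (nwvalP w).
rewrite /mono sorted_sort //; last exact: letter_leq_trans.
rewrite insubT; first exact: nwvalP.
move=> Hw; rewrite ksgn_sorted // scale1r; congr (<< _ >>); exact: val_inj.
Qed.

Lemma malg_mono (x : ext) : x = \sum_(w <- msupp x) x@_w *: mono w.
Proof. by rewrite [LHS]malg_sum; apply: eq_bigr => w _; rewrite monoU. Qed.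

Lemma eq_linear_ext (E : lmodType K) (f g : ext -> E) : linear f -> linear g ->
  (forall w : nword V, f (mono w) = g (mono w)) -> f =1 g.
Proof.
move=> lf lg fg x; rewrite [x]malg_mono (lin_sumf lf) (lin_sumf lg).
by apply: eq_bigr => w _; rewrite (linZ lf) (linZ lg) fg.
Qed.

Lemma normal_odd w i : is_normal w -> par i -> (count_mem i w <= 1)%N.
Proof.
rewrite /is_normal => + pi; elim: w => //= j w IH pw.
have tr : transitive (fun i j : letter V => (i < j)%N || (i == j) && ~~ par i).
  move=> b a c /orP[ab|/andP[/eqP -> pb]] // /orP[bc|/andP[/eqP <- pb']].
  - by rewrite (ltn_trans ab bc).
  - by rewrite ab.
have := IH (path_sorted pw).
case: (j =P i) => //= ji; rewrite ?add0n // ji in pw *.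
have al := order_path_min tr pw.
suff -> : count_mem i w = 0%N by [].
apply/eqP; rewrite -leqn0 leqNgt -has_count; apply/hasPn => k kw /=.
by apply/eqP => ki; have := allP al _ kw; rewrite /= ki ltnn eqxx pi.
Qed.

Lemma not_normal w : sorted leT w -> ~~ is_normal w ->
  exists a i b, w = a ++ i :: i :: b /\ par i.
Proof.
elim: w => [|i [|j w] IH] //= /andP[ij pw]; rewrite /is_normal /= negb_and.
case: (boolP (path _ _ _)) => /= [_|np _].
  rewrite orbF negb_or negb_and negbK -leqNgt => /andP[ji /orP[ne|pi]].
    by case/negP: ne; apply/eqP/val_inj/eqP; rewrite eqn_leq ij.
  have e : i = j by apply/val_inj/eqP; rewrite eqn_leq ij.
  by exists [::], i, w; rewrite -e.
have [a [k [b [-> pk]]]] := IH pw np.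
by exists (i :: a), k, b.
Qed.

(** The condition for a family indexed by words to factor through [mono]. As 2 is invertible, it
    already forces the value to vanish when an odd letter occurs twice in a row. *)
Definition swaps (E : lmodType K) (F : seq (letter V) -> E) :=
  forall a i j b,
    F (a ++ j :: i :: b) = sgnb K (par i && par j) *: F (a ++ i :: j :: b).

Lemma ksgn_swap a i j b : i != j ->
  ksgn K (a ++ j :: i :: b) = sgnb K (par i && par j) * ksgn K (a ++ i :: j :: b).
Proof.
move=> ij; elim: a => [|k a IH] /=; last first.
  rewrite IH mulrCA; congr (_ * (_ ^+ _ * _)).
  by apply/seq.permP/perm_cat => //; apply/seq.permP => p /=; rewrite addnCA.
rewrite /sgnb; case: (ltngtP i j) => [h|h|/val_inj h]; last by rewrite h eqxx in ij.
all: by case: (par i) (par j) => [] [] /=; rewrite ?andbF /= ?add0n ?exprD ?expr0 ?expr1; ring.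
Qed.

Lemma mono_dup w i : par i -> (1 < count_mem i w)%N -> mono w = 0 :> ext.
Proof.
move=> pi c; rewrite /mono; case: insubP => // s ns es.
have := normal_odd ns pi; rewrite leqNgt.
by have /seq.permP -> : perm_eq (sort leT w) w; rewrite ?perm_sort ?c.
Qed.

Lemma mono_swap : swaps (fun w => mono w : ext).
Proof.
move=> a i j b.
case: (eqVneq i j) => [->|ij].
  rewrite andbb; case: (boolP (par j)) => [pj|_]; last by rewrite /sgnb expr0 scale1r.
  rewrite (@mono_dup _ j) ?scaler0 // count_cat /= eqxx addnA addnCA; lia.
rewrite /mono.
have -> : sort leT (a ++ j :: i :: b) = sort leT (a ++ i :: j :: b).
  apply/perm_sortP; [exact: letter_leq_total|exact: letter_leq_trans|exact: letter_leq_anti|].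
  by rewrite perm_cat2l; apply/seq.permP => p /=; rewrite addnCA.
case: insub => [s|]; last by rewrite scaler0.
by rewrite scalerA ksgn_swap.
Qed.

Lemma mono_swapE a i j b : mono (a ++ j :: i :: b) =
  sgnb K (par i && par j) *: mono (a ++ i :: j :: b) :> ext.
Proof. exact: mono_swap. Qed.

Section Universal.
Variables (E : lmodType K) (F : seq (letter V) -> E).
Hypothesis sF : swaps F.

(** One step of insertion sort: [i] passes the smaller letters only, and the exponent is the one
    that [ksgn] accumulates. *)
Lemma swaps_insert a i s : sorted leT s ->
  F (a ++ i :: s) =
  (-1) ^+ count (fun j : letter V => [&& (j < i)%N, par i & par j]) s
    *: F (a ++ sort leT (i :: s)).
Proof.
have to := @letter_leq_total; have tr := @letter_leq_trans; have an := @letter_leq_anti.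
elim: s a => [|j s IH] a ss; first by rewrite expr0 scale1r.
have al : all (leT j) s by apply: order_path_min ss; exact: tr.
case: (ltnP j i) => ji.
  have -> : sort leT (i :: j :: s) = j :: sort leT (i :: s).
    apply: (sorted_eq tr an); first exact: sort_sorted.
    - rewrite /= path_sortedE // sort_sorted // andbT all_sort /= al andbT.
      exact: ltnW.
    rewrite perm_sort; apply/seq.permP => p /=.
    have /seq.permP -> : perm_eq (sort leT (i :: s)) (i :: s) by rewrite perm_sort.
    by rewrite /= addnCA.
  rewrite sF -cat_rcons IH ?(path_sorted ss) // cat_rcons scalerA.
  by rewrite /= ji exprD andbC.
have si : sorted leT (i :: j :: s) by rewrite /= ji.
rewrite sorted_sort // (_ : count _ _ = 0%N) ?expr0 ?scale1r //.
apply/eqP; rewrite -leqn0 leqNgt -has_count; apply/hasPn => k kw /=.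
rewrite ltnNge (leq_trans ji) //.
by move: kw; rewrite inE => /orP[/eqP -> //|/(allP al)].
Qed.

Lemma swaps_sort a u : F (a ++ u) = ksgn K u *: F (a ++ sort leT u).
Proof.
elim: u a => [|i u IH] a; first by rewrite scale1r.
rewrite -cat_rcons IH cat_rcons swaps_insert; last by apply/sort_sorted/letter_leq_total.
rewrite scalerA /= mulrC.
have pe : perm_eq (sort leT u) u by rewrite perm_sort.
congr (_ *: F (_ ++ _)).
  by congr (_ ^+ _ * _); apply/seq.permP.
apply/perm_sortP; [exact: letter_leq_total|exact: letter_leq_trans|exact: letter_leq_anti|].
by rewrite perm_cons.
Qed.

(** The universal property of the exterior algebra. Sorting [u] multiplies both sides by the same
    Koszul sign, which leaves sorted words to compare. *)
Lemma ext_lin_mono u : ext_lin (fun w : nword V => F w) (mono u : ext) = F u.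
Proof.
rewrite -[u]cat0s swaps_sort /=.
case: (boolP (is_normal (sort leT u))) => [ns|nn].
  rewrite /mono insubT linearZ /=; congr (_ *: _).
  by rewrite (ext_linU (fun w : nword V => F w)) .
rewrite /mono insubN // linear0.
(* A sorted word that is not normal repeats an odd letter; exchanging the two copies gives
   [F = - F], so [F] vanishes where [mono] does. *)
have [a [i [b [e pi]]]] := not_normal (sort_sorted letter_leq_total u) nn.
have := sF a i i b; rewrite -e andbb pi /sgnb expr1 scaleN1r => /eqP.
rewrite -addr_eq0 -mulr2n -scaler_nat scaler_eq0 pnatr_eq0 /= => /eqP ->.
by rewrite scaler0.
Qed.

End Universal.
End ExtBasics.

(** * The exterior algebra *)

Lemma wpar_cat (V : gvect) (u v : seq (letter V)) : wpar (u ++ v) = wpar u (+) wpar v.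
Proof. by rewrite /wpar count_cat oddD. Qed.

Lemma wpar_cons (V : gvect) (i : letter V) v : wpar (i :: v) = par i (+) wpar v.
Proof. by rewrite /wpar /= oddD oddb. Qed.

Lemma wpar_nil (V : gvect) : wpar ([::] : seq (letter V)) = false.
Proof. by []. Qed.

(** Koszul signs have boolean exponents, polynomial in a few parities; equality of two such
    exponents is decided by a truth table. *)
Ltac bools := rewrite ?wpar_cat ?wpar_cons ?wpar_nil; repeat match goal with
  | |- context [par ?i] => case: (par i)
  | |- context [wpar ?w] => case: (wpar w)
  | b : bool |- context [?c] => constr_eq b c; destruct b
  end; rewrite /= ?addbT ?addbF /=; reflexivity.

Section Wedge.
Variables (K : numFieldType) (V : gvect).
Local Notation ext := (ext K V).
Implicit Types (i j : letter V) (u v w : seq (letter V)).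

Lemma wparE w : wpar w = \sum_(i <- w) par i.
Proof.
rewrite /wpar; elim: w => [|i w IH] /=; first by rewrite big_nil.
by rewrite big_cons -IH oddD oddb.
Qed.

Lemma wpar1 i : wpar [:: i] = par i.
Proof. by rewrite wpar_cons addbF. Qed.

Lemma lin_wedgel (E : lmodType K) (f : E -> ext) y :
  linear f -> linear (fun x => wedge (f x) y).
Proof. by move=> lf; apply: (lin_comp (g := fun x => wedge x y)) => //; apply: lin_ext. Qed.

Lemma lin_wedger (E : lmodType K) (f : E -> ext) x :
  linear f -> linear (fun y => wedge x (f y)).
Proof.
move=> lf; apply: (lin_comp (g := wedge x)) => //.
by apply: lin_sum => w; apply: lin_scale; apply: lin_ext.
Qed.

Lemma wedgeZl c (x y : ext) : wedge (c *: x) y = c *: wedge x y.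
Proof. exact: (linZ (lin_wedgel y (@lin_id _ _))). Qed.
Lemma wedgeZr c (x y : ext) : wedge x (c *: y) = c *: wedge x y.
Proof. exact: (linZ (lin_wedger x (@lin_id _ _))). Qed.
Lemma swaps_lin (E E' : lmodType K) (f : E -> E') (F : seq (letter V) -> E) :
  linear f -> swaps F -> swaps (fun w => f (F w)).
Proof. by move=> lf sF a i j b; rewrite sF (linZ lf). Qed.

Lemma swaps_add (E : lmodType K) (F G : seq (letter V) -> E) :
  swaps F -> swaps G -> swaps (fun w => F w + G w).
Proof. by move=> sF sG a i j b; rewrite sF sG scalerDr. Qed.

Lemma swaps_cat (E : lmodType K) (F : seq (letter V) -> E) u v :
  swaps F -> swaps (fun w => F (u ++ w ++ v)).
Proof.
move=> sF a i j b; have := sF (u ++ a) i j (b ++ v).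
by rewrite -!catA !cat_cons.
Qed.

Lemma swaps_wpar (E : lmodType K) (F : seq (letter V) -> E) (p : bool -> K) :
  swaps F -> swaps (fun w => p (wpar w) *: F w).
Proof.
move=> sF a i j b; rewrite sF !scalerA mulrC; congr (_ * _ *: _).
by rewrite !wpar_cat !wpar_cons; congr (p _); bools.
Qed.

Lemma wedge_mono u v : wedge (mono u) (mono v) = mono (u ++ v) :> ext.
Proof.
rewrite /wedge.
rewrite (eq_ext_lin (G := fun n : nword V => mono (n ++ v))).
  rewrite (ext_lin_mono (F := fun w => mono (w ++ v))) //.
  exact: (swaps_cat [::] v (@mono_swap K V)).
move=> w; rewrite (ext_lin_mono (F := fun v => mono (w ++ v))) //.
move=> a i j b; rewrite !catA; exact: mono_swap.
Qed.

Lemma wedgeA : associative (@wedge K V).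
Proof.
move=> x y z.
apply: (eq_linear_ext (f := fun x => wedge x (wedge y z))
  (g := fun x => wedge (wedge x y) z)) => [||u].
- exact/lin_wedgel/lin_id.
- exact/lin_wedgel/lin_wedgel/lin_id.
apply: (eq_linear_ext (f := fun y => wedge (mono u) (wedge y z))
  (g := fun y => wedge (wedge (mono u) y) z)) => [||v].
- exact/lin_wedger/lin_wedgel/lin_id.
- exact/lin_wedgel/lin_wedger/lin_id.
apply: (eq_linear_ext (f := fun z => wedge (mono u) (wedge (mono v) z))
  (g := fun z => wedge (wedge (mono u) (mono v)) z)) => [||w].
- exact/lin_wedger/lin_wedger/lin_id.
- exact/lin_wedger/lin_id.
by rewrite !wedge_mono catA.
Qed.

Lemma wedge1l : left_id (mono [::] : ext) (@wedge K V).
Proof.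
apply: eq_linear_ext => [||u]; [exact/lin_wedger/lin_id|exact: lin_id|].
by rewrite wedge_mono.
Qed.

Lemma wedge1r : right_id (mono [::] : ext) (@wedge K V).
Proof.
apply: eq_linear_ext => [||u]; [exact/lin_wedgel/lin_id|exact: lin_id|].
by rewrite wedge_mono cats0.
Qed.

Lemma mono_cons i u : mono (i :: u) = wedge (mono [:: i]) (mono u) :> ext.
Proof. by rewrite wedge_mono. Qed.

Lemma swaps_rot1 (E : lmodType K) (F : seq (letter V) -> E) : swaps F ->
  forall a u j b, F (a ++ u ++ j :: b) =
    sgnb K (wpar u && par j) *: F (a ++ j :: u ++ b).
Proof.
move=> sF a u j b; elim: u a => [|i u IH] a /=; first by rewrite scale1r.
rewrite -cat_rcons IH cat_rcons sF scalerA -sgnbD wpar_cons.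
congr (sgnb _ _ *: _); bools.
Qed.

Lemma mono_catC u v : mono (u ++ v) = sgnb K (wpar u && wpar v) *: mono (v ++ u) :> ext.
Proof.
suff H b : mono (u ++ v ++ b) = sgnb K (wpar u && wpar v) *: mono (v ++ u ++ b) :> ext.
  by have := H [::]; rewrite !cats0.
elim: v b => [|j v IH] b /=; first by rewrite andbF scale1r.
rewrite (swaps_rot1 (@mono_swap K V) [::]) /= mono_cons IH wedgeZr -mono_cons scalerA.
rewrite -sgnbD wpar_cons; congr (sgnb _ _ *: _); bools.
Qed.

End Wedge.

(** * Gradings of the exterior algebra *)

Section Gradings.
Variables (K : numFieldType).

(** The group is left free: [bool] under exclusive or gives the parity, [int] gives the weight, the
    degree, and the numbers of letters from V and from V^*. Zero has every degree. *)
Definition gr (V : gvect) (G : zmodType) (g : letter V -> G) (a : G) (x : ext K V) :=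
  forall w : nword V, w \in msupp x -> \sum_(i <- w) g i = a.

Section Gr.
Variables (V : gvect) (G : zmodType) (g : letter V -> G).
Local Notation ext := (ext K V).
Local Notation gr := (gr g).

Lemma gr0 a : gr a 0.
Proof. by move=> w; rewrite msupp0. Qed.

Lemma grD a x y : gr a x -> gr a y -> gr a (x + y).
Proof.
by move=> gx gy w /(fsubsetP (msuppD_le x y)); rewrite in_fsetU => /orP[/gx|/gy].
Qed.

Lemma grZ a c x : gr a x -> gr a (c *: x).
Proof. by move=> gx w /(fsubsetP (msuppZ_le c x))/gx. Qed.

Lemma gr_sum a I (r : seq I) (P : pred I) (F : I -> ext) :
  (forall i, P i -> gr a (F i)) -> gr a (\sum_(i <- r | P i) F i).
Proof. by move=> H; elim/big_ind: _ => //; [exact: gr0|exact: grD]. Qed.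

Lemma gr_mono u : gr (\sum_(i <- u) g i) (mono u).
Proof.
rewrite /mono; case: insubP => [s _ es|_]; last exact: gr0.
move=> w /(fsubsetP (msuppZ_le _ _)); rewrite msuppU oner_eq0 in_fset1 => /eqP ->.
by apply: perm_big; rewrite es perm_sort.
Qed.

Lemma gr_eq_linear (E : lmodType K) (f h : ext -> E) a x :
  gr a x -> linear f -> linear h ->
  (forall w, \sum_(i <- w) g i = a -> f (mono w) = h (mono w)) -> f x = h x.
Proof.
move=> gx lf lh fh; rewrite [x]malg_mono (lin_sumf lf) (lin_sumf lh).
rewrite big_seq [RHS]big_seq; apply: eq_bigr => w ws.
by rewrite (linZ lf) (linZ lh) fh // gx.
Qed.

End Gr.

Lemma gr_linear (V V' : gvect) (G G' : zmodType) (g : letter V -> G)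
    (g' : letter V' -> G') (f : ext K V -> ext K V') a b x :
  linear f -> gr g a x ->
  (forall w, \sum_(i <- w) g i = a -> gr g' b (f (mono w))) -> gr g' b (f x).
Proof.
move=> lf gx H; rewrite [x]malg_mono (lin_sumf lf) big_seq.
by apply: gr_sum => w ws; rewrite (linZ lf); apply/grZ/H/gx.
Qed.

Lemma gr_wedge (V : gvect) (G : zmodType) (g : letter V -> G) a b x y :
  gr g a x -> gr g b y -> gr g (a + b) (wedge x y).
Proof.
move=> gx gy; apply: (gr_linear (f := fun x => wedge x y) _ gx) => [|u eu].
  exact/lin_wedgel/lin_id.
apply: (gr_linear (f := wedge (mono u)) _ gy) => [|v ev].
  exact/lin_wedger/lin_id.
by rewrite wedge_mono -eu -ev -big_cat; apply: gr_mono.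
Qed.

Local Notation hpar b x := (gr (@par _) b x).

Lemma hpar_eq (V : gvect) (E : lmodType K) (f h : ext K V -> E) b x :
  hpar b x -> linear f -> linear h ->
  (forall w, wpar w = b -> f (mono w) = h (mono w)) -> f x = h x.
Proof.
by move=> gx lf lh H; apply: (gr_eq_linear gx lf lh) => w e; apply: H; rewrite wparE.
Qed.

Lemma wedgeC (V : gvect) b c (x y : ext K V) : hpar b x -> hpar c y ->
  wedge x y = sgnb K (b && c) *: wedge y x.
Proof.
move=> gx gy; apply: (hpar_eq gx (f := fun x => wedge x y)
   (h := fun x => sgnb K (b && c) *: wedge y x)) => [||u <-].
- exact/lin_wedgel/lin_id.
- exact/lin_scale/lin_wedger/lin_id.
apply: (hpar_eq gy (f := fun y => wedge (mono u) y)
   (h := fun y => sgnb K (wpar u && c) *: wedge y (mono u))) => [||v <-].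
- exact/lin_wedger/lin_id.
- exact/lin_scale/lin_wedgel/lin_id.
by rewrite !wedge_mono mono_catC.
Qed.

End Gradings.

Notation hpar b x := (gr (@par _) b x).

Section Gen.
Variables (K : numFieldType) (V : gvect).
Implicit Types (v : vec K V) (i : letter V).

Lemma lin_gen (E : lmodType K) (f : E -> vec K V) : linear f -> linear (fun x => gen (f x)).
Proof.
move=> lf; apply: (lin_comp (g := @gen K V)) => //.
move=> c x y; rewrite /gen scaler_sumr -big_split /=; apply: eq_bigr => i _.
by rewrite !mxE scalerDl scalerA.
Qed.

Lemma gen_delta i : gen (delta_mx 0 i) = mono [:: i] :> ext K V.
Proof.
rewrite /gen (bigD1 i) //= mxE !eqxx scale1r big1 ?addr0 // => j ji.
by rewrite mxE eqxx (negbTE ji) scale0r.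
Qed.

Lemma gr_gen (G : zmodType) (g : letter V -> G) a v :
  (forall i, v 0 i != 0 -> g i = a) -> gr g a (gen v).
Proof.
move=> H; apply: gr_sum => i _; have [->|/H <-] := eqVneq (v 0 i) 0.
  by rewrite scale0r; apply: gr0.
by apply: grZ; have := @gr_mono K V G g [:: i]; rewrite big_seq1.
Qed.

End Gen.

(* Unification is prone to unfolding the canonical structures of [ext K V];
   computations in the exterior algebra take place in an opaque copy of it. *)
Lemma ext_copy (K : numFieldType) (V : gvect) :
  {E : lmodType K & {f : ext K V -> E & {g : E -> ext K V |
     [/\ linear f, linear g, cancel f g & cancel g f]}}}.
Proof. by exists (ext K V : lmodType K), id, id; split. Qed.

Section Copy.
Variables (K : numFieldType) (V : gvect).
Implicit Types (i j : letter V) (u v w : seq (letter V)).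

Definition xext : lmodType K := projT1 (ext_copy K V).
Definition toX : ext K V -> xext := projT1 (projT2 (ext_copy K V)).
Definition ofX : xext -> ext K V := sval (projT2 (projT2 (ext_copy K V))).

Lemma lin_toX : linear toX.
Proof. by case: (svalP (projT2 (projT2 (ext_copy K V)))). Qed.
Lemma lin_ofX : linear ofX.
Proof. by case: (svalP (projT2 (projT2 (ext_copy K V)))). Qed.
Lemma toXK : cancel toX ofX.
Proof. by case: (svalP (projT2 (projT2 (ext_copy K V)))). Qed.
Lemma ofXK : cancel ofX toX.
Proof. by case: (svalP (projT2 (projT2 (ext_copy K V)))). Qed.

End Copy.

HB.lock Definition xmono (K : numFieldType) (V : gvect) (u : seq (letter V)) : xext K V :=
  toX (mono u).
HB.lock Definition xwedge (K : numFieldType) (V : gvect) (x y : xext K V) : xext K V :=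
  toX (wedge (ofX x) (ofX y)).
HB.lock Definition xgen (K : numFieldType) (V : gvect) (v : vec K V) : xext K V :=
  toX (gen v).

Section CopyOps.
Variables (K : numFieldType) (V : gvect).
Local Notation xext := (xext K V).
Local Notation xmono := (@xmono K V).
Local Notation xwedge := (@xwedge K V).
Local Notation xgen := (@xgen K V).
Local Notation lin_ofX := (@lin_ofX K V).
Local Notation lin_toX := (@lin_toX K V).
Local Notation toX := (@toX K V).
Local Notation ofX := (@ofX K V).
Implicit Types (i j : letter V) (u v w : seq (letter V)).

Lemma ofX_inj : injective ofX.
Proof. exact: can_inj (@ofXK K V). Qed.
Lemma ofX_mono u : ofX (xmono u) = mono u.
Proof. by rewrite xmono.unlock; apply: toXK. Qed.
Lemma ofX_wedge x y : ofX (xwedge x y) = wedge (ofX x) (ofX y).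
Proof. by rewrite xwedge.unlock; apply: toXK. Qed.
Lemma ofX_gen (v : vec K V) : ofX (xgen v) = gen v.
Proof. by rewrite xgen.unlock; apply: toXK. Qed.
Lemma toX_mono u : toX (mono u) = xmono u.
Proof. by rewrite xmono.unlock. Qed.
Definition xlift (E : lmodType K) (F : seq (letter V) -> E) (x : xext) : E :=
  ext_lin (fun w : nword V => F w) (ofX x).

Lemma eq_linear_xext (E : lmodType K) (f g : xext -> E) : linear f -> linear g ->
  (forall w, f (xmono w) = g (xmono w)) -> f =1 g.
Proof.
move=> lf lg fg x; rewrite -[x]ofXK.
apply: (eq_linear_ext (f := fun x => f (toX x)) (g := fun x => g (toX x))) => [||w].
- exact: lin_comp lf lin_toX.
- exact: lin_comp lg lin_toX.
- by rewrite toX_mono; apply: fg.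
Qed.

Lemma lin_xlift (E E' : lmodType K) (F : seq (letter V) -> E') (f : E -> xext) :
  linear f -> linear (fun x => xlift F (f x)).
Proof.
by move=> lf; apply: lin_comp (lin_comp (lin_ext _) lin_ofX) lf.
Qed.

Lemma xlift_mono (E : lmodType K) (F : seq (letter V) -> E) u :
  swaps F -> xlift F (xmono u) = F u.
Proof. by move=> sF; rewrite /xlift ofX_mono ext_lin_mono. Qed.

Lemma swaps_xmono : swaps xmono.
Proof.
by move=> a i j b; rewrite -!toX_mono mono_swapE; apply: (linZ lin_toX).
Qed.

Lemma xmonoS a i j b :
  xmono (a ++ j :: i :: b) = sgnb K (par i && par j) *: xmono (a ++ i :: j :: b).
Proof. exact: swaps_xmono. Qed.

Lemma lin_xwedgel (E : lmodType K) (f : E -> xext) y :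
  linear f -> linear (fun x => xwedge (f x) y).
Proof.
move=> lf; apply: (lin_comp (g := fun x => xwedge x y)) lf.
by move=> c a b; rewrite xwedge.unlock; apply: (lin_comp lin_toX (lin_wedgel _ lin_ofX)).
Qed.

Lemma lin_xwedger (E : lmodType K) (f : E -> xext) x :
  linear f -> linear (fun y => xwedge x (f y)).
Proof.
move=> lf; apply: (lin_comp (g := xwedge x)) lf.
by move=> c a b; rewrite xwedge.unlock; apply: (lin_comp lin_toX (lin_wedger _ lin_ofX)).
Qed.

Lemma xwedgeDl x z y : xwedge (x + z) y = xwedge x y + xwedge z y.
Proof. exact: (linD (lin_xwedgel y (@lin_id _ xext)) x z). Qed.
Lemma xwedgeDr x y z : xwedge x (y + z) = xwedge x y + xwedge x z.
Proof. exact: (linD (lin_xwedger x (@lin_id _ xext)) y z). Qed.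
Lemma xwedgeZl c x y : xwedge (c *: x) y = c *: xwedge x y.
Proof. exact: (linZ (lin_xwedgel y (@lin_id _ xext)) c x). Qed.
Lemma xwedgeZr c x y : xwedge x (c *: y) = c *: xwedge x y.
Proof. exact: (linZ (lin_xwedger x (@lin_id _ xext)) c y). Qed.
Lemma xwedge0l y : xwedge 0 y = 0.
Proof. exact: (lin0 (lin_xwedgel y (@lin_id _ xext))). Qed.
Lemma xwedge0r x : xwedge x 0 = 0.
Proof. exact: (lin0 (lin_xwedger x (@lin_id _ xext))). Qed.
Lemma xwedgeNl x y : xwedge (- x) y = - xwedge x y.
Proof. by rewrite -scaleN1r xwedgeZl scaleN1r. Qed.
Lemma xwedgeNr x y : xwedge x (- y) = - xwedge x y.
Proof. by rewrite -scaleN1r xwedgeZr scaleN1r. Qed.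

Lemma xwedge_mono u v : xwedge (xmono u) (xmono v) = xmono (u ++ v).
Proof. by apply: ofX_inj; rewrite ofX_wedge !ofX_mono wedge_mono. Qed.

Lemma xwedgeA : associative xwedge.
Proof. by move=> x y z; apply: ofX_inj; rewrite !ofX_wedge wedgeA. Qed.

Lemma xwedge1l : left_id (xmono [::]) xwedge.
Proof. by move=> x; apply: ofX_inj; rewrite !ofX_wedge ofX_mono wedge1l. Qed.

Lemma xwedge1r : right_id (xmono [::]) xwedge.
Proof. by move=> x; apply: ofX_inj; rewrite !ofX_wedge ofX_mono wedge1r. Qed.

Lemma xmono_cons i u : xmono (i :: u) = xwedge (xmono [:: i]) (xmono u).
Proof. by rewrite xwedge_mono. Qed.

Lemma xmono_catC u v : xmono (u ++ v) = sgnb K (wpar u && wpar v) *: xmono (v ++ u).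
Proof. by rewrite -!toX_mono mono_catC; apply: (linZ lin_toX). Qed.

Lemma lin_xgen (E : lmodType K) (f : E -> vec K V) :
  linear f -> linear (fun x => xgen (f x)).
Proof.
by move=> lf c x y; rewrite xgen.unlock; apply: (lin_comp lin_toX (lin_gen lf)).
Qed.

Lemma xgen_delta i : xgen (delta_mx 0 i) = xmono [:: i].
Proof. by apply: ofX_inj; rewrite ofX_gen ofX_mono gen_delta. Qed.

End CopyOps.

Section CopyGradings.
Variables (K : numFieldType).

Definition xgr (V : gvect) (G : zmodType) (g : letter V -> G) (a : G)
  (x : xext K V) := gr g a (ofX x).

Section Gr.
Variables (V : gvect) (G : zmodType) (g : letter V -> G).
Local Notation ext := (xext K V).
Local Notation gr := (xgr g).

Lemma xgr0 a : gr a 0.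
Proof. by rewrite /xgr (lin0 (@lin_ofX K V)); apply: gr0. Qed.

Lemma xgrD a x y : gr a x -> gr a y -> gr a (x + y).
Proof. by rewrite /xgr (linD (@lin_ofX K V)); apply: grD. Qed.

Lemma xgrZ a c x : gr a x -> gr a (c *: x).
Proof. by rewrite /xgr (linZ (@lin_ofX K V)); apply: grZ. Qed.

Lemma xgr_sum a I (r : seq I) (P : pred I) (F : I -> ext) :
  (forall i, P i -> gr a (F i)) -> gr a (\sum_(i <- r | P i) F i).
Proof. by move=> H; elim/big_ind: _ => //; [exact: xgr0|exact: xgrD]. Qed.

Lemma xgr_mono u : gr (\sum_(i <- u) g i) (xmono K u).
Proof. by rewrite /xgr ofX_mono; apply: gr_mono. Qed.

Lemma xgr_eq_linear (E : lmodType K) (f h : ext -> E) a x :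
  gr a x -> linear f -> linear h ->
  (forall w, \sum_(i <- w) g i = a -> f (xmono K w) = h (xmono K w)) -> f x = h x.
Proof.
move=> gx lf lh fh; rewrite -[x]ofXK.
apply: (gr_eq_linear gx (f := fun x => f (toX x)) (h := fun x => h (toX x))) => [||w].
- exact: lin_comp lf (@lin_toX _ _).
- exact: lin_comp lh (@lin_toX _ _).
- by move=> e; rewrite toX_mono; apply: fh.
Qed.

Lemma xgr_gen a (v : vec K V) : (forall i, v 0 i != 0 -> g i = a) -> gr a (xgen v).
Proof. by move=> H; rewrite /xgr ofX_gen; apply: gr_gen. Qed.

End Gr.

Lemma xgr_linear (V V' : gvect) (G G' : zmodType) (g : letter V -> G)
    (g' : letter V' -> G') (f : xext K V -> xext K V') a b x :
  linear f -> xgr g a x ->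
  (forall w, \sum_(i <- w) g i = a -> xgr g' b (f (xmono K w))) -> xgr g' b (f x).
Proof.
move=> lf gx H; rewrite /xgr -[x]ofXK.
apply: (gr_linear (f := fun x => ofX (f (toX x))) _ gx) => [|w e].
  exact: (lin_comp (@lin_ofX _ _) (lin_comp lf (@lin_toX _ _))).
by rewrite toX_mono; apply: H.
Qed.

Lemma xgr_wedge (V : gvect) (G : zmodType) (g : letter V -> G) a b x y :
  xgr g a x -> xgr g b y -> xgr g (a + b) (xwedge x y).
Proof. by rewrite /xgr ofX_wedge; apply: gr_wedge. Qed.

Local Notation hpar b x := (xgr (@par _) b x).

Lemma xhpar_mono V (u : seq (letter V)) : hpar (wpar u) (xmono K u).
Proof. by rewrite wparE; apply: xgr_mono. Qed.

Lemma xhpar_mono1 V (i : letter V) : hpar (par i) (xmono K [:: i]).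
Proof. by rewrite -wpar1; apply: xhpar_mono. Qed.

Lemma xhpar_eq (V : gvect) (E : lmodType K) (f h : xext K V -> E) b x :
  hpar b x -> linear f -> linear h ->
  (forall w, wpar w = b -> f (xmono K w) = h (xmono K w)) -> f x = h x.
Proof.
by move=> gx lf lh H; apply: (xgr_eq_linear gx lf lh) => w e; apply: H; rewrite wparE.
Qed.

Lemma xwedgeC (V : gvect) b c (x y : xext K V) : hpar b x -> hpar c y ->
  xwedge x y = sgnb K (b && c) *: xwedge y x.
Proof.
move=> gx gy; apply: (xhpar_eq gx (f := fun x => xwedge x y)
   (h := fun x => sgnb K (b && c) *: xwedge y x)) => [||u <-].
- exact/lin_xwedgel/lin_id.
- exact/lin_scale/lin_xwedger/lin_id.
apply: (xhpar_eq gy (f := fun y => xwedge (xmono K u) y)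
   (h := fun y => sgnb K (wpar u && c) *: xwedge y (xmono K u))) => [||v <-].
- exact/lin_xwedger/lin_id.
- exact/lin_scale/lin_xwedgel/lin_id.
by rewrite !xwedge_mono xmono_catC.
Qed.

End CopyGradings.

Notation xhpar b x := (xgr (@par _) b x).

(** * The big bracket *)

Section BracketWord.
Variables (K : numFieldType) (V : gvect).
Local Notation D := (dbl V).
Local Notation ext := (xext K D).
Local Notation xmono := (@xmono K D).
Local Notation xwedge := (@xwedge K D).
Implicit Types (i j : letter D) (u v w : seq (letter D)).

Lemma odd_abszB1 (a : int) : odd `|a - 1|%N = ~~ odd `|a|%N.
Proof. lia. Qed.

Lemma odd_abszN (a : int) : odd `|- a|%N = odd `|a|%N.
Proof. by rewrite abszN. Qed.

Lemma parE (U : gvect) (i : letter U) : par i = ~~ odd `|gdeg i|%N.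
Proof. exact: odd_abszB1. Qed.

(** The only letter that pairs with [j] to a nonzero scalar ([dpair_dl], [dpair_neq]); sums against
    the form collapse onto it. *)
Definition dl j : letter D :=
  match split j with inl a => rshift _ a | inr a => lshift _ a end.

Lemma split_lshift (a : letter V) : split (lshift (gdim V) a) = inl a.
Proof. exact: (unsplitK (inl a)). Qed.

Lemma split_rshift (a : letter V) : split (rshift (gdim V) a) = inr a.
Proof. exact: (unsplitK (inr a)). Qed.

Variant dletter_spec : letter D -> Type :=
  | DletterV a : dletter_spec (lshift (gdim V) a)
  | DletterVdual a : dletter_spec (rshift (gdim V) a).

Lemma dletterP i : dletter_spec i.
Proof. by rewrite -{1}(splitK i); case: (split i) => a; constructor. Qed.

Lemma gdegl (a : letter V) : @gdeg D (lshift _ a) = gdeg a.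
Proof. by rewrite /= split_lshift. Qed.
Lemma gdegr (a : letter V) : @gdeg D (rshift _ a) = - gdeg a.
Proof. by rewrite /= split_rshift. Qed.

Lemma is_duall (a : letter V) : @is_dual V (lshift _ a) = false.
Proof. by rewrite /is_dual /= ltn_ord. Qed.
Lemma is_dualr (a : letter V) : @is_dual V (rshift _ a) = true.
Proof. by rewrite /is_dual /= ltnNge leq_addr. Qed.

Lemma dll (a : letter V) : dl (lshift _ a) = rshift _ a.
Proof. by rewrite /dl split_lshift. Qed.
Lemma dlr (a : letter V) : dl (rshift _ a) = lshift _ a.
Proof. by rewrite /dl split_rshift. Qed.

Lemma dlK : involutive dl.
Proof. by move=> j; case: (dletterP j) => a; rewrite ?(dll, dlr). Qed.

Lemma gdeg_dl j : gdeg (dl j) = - gdeg j.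
Proof. by case: (dletterP j) => a; rewrite ?(dll, dlr) gdegl gdegr ?opprK. Qed.

Lemma par_dl j : par (dl j) = par j.
Proof. by rewrite !parE gdeg_dl odd_abszN. Qed.

Lemma is_dual_dl j : is_dual (dl j) = ~~ is_dual j.
Proof. by case: (dletterP j) => a; rewrite ?(dll, dlr) is_duall is_dualr. Qed.

Lemma dpair_dl j : dpair K (dl j) j != 0.
Proof.
case: (dletterP j) => a; rewrite /dpair ?(dll, dlr) !(split_lshift, split_rshift) eqxx.
  exact: oner_neq0.
by rewrite mulr1 sgnb_neq0.
Qed.

Lemma dpair_neq i j : i != dl j -> dpair K i j = 0.
Proof.
case: (dletterP i) => a; case: (dletterP j) => b;
  rewrite /dpair ?(dll, dlr) !(split_lshift, split_rshift) //= => ab.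
- by rewrite (_ : a == b = false) ?mulr0 //; apply: contraNF ab => /eqP ->.
- by rewrite (_ : a == b = false) //; apply: contraNF ab => /eqP ->.
Qed.

(** Paired letters have opposite degrees, hence equal parities. The form is graded symmetric for the
    degree, and the shift by one to total degree turns this into the antisymmetry of a Poisson
    bracket. *)
Lemma dpairC i j : dpair K i j = - (sgnb K (par i && par j) * dpair K j i).
Proof.
case: (dletterP i) => a; case: (dletterP j) => b;
  rewrite /dpair ?(dll, dlr) !(split_lshift, split_rshift) ?mulr0 ?oppr0 //=
    !parE gdegl gdegr odd_abszN eq_sym;
  (case: eqP => [->|_]; last by rewrite ?mulr0 ?oppr0);
  by rewrite andbb /sgnb; case: odd; rewrite /= ?expr0 ?expr1; ring.
Qed.

Lemma dpair_par i j : dpair K i j != 0 -> par i = par j.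
Proof.
by have [->|/dpair_neq ->] := eqVneq i (dl j); rewrite ?par_dl ?eqxx.
Qed.

(* An identity between multiples of the pairing may be checked when the
   parities agree, as the pairing vanishes otherwise. *)
Lemma dpair_scale (E : lmodType K) i j (a b : K) (x : E) :
  (par i = par j -> a = b) -> (a * dpair K i j) *: x = (b * dpair K i j) *: x.
Proof.
have [->|/dpair_par e ->] := eqVneq (dpair K i j) 0; by rewrite ?mulr0.
Qed.

Fixpoint xbl i w : ext :=
  if w is j :: w' then
    dpair K i j *: xmono w' + sgnb K (par i && par j) *: xwedge (xmono [:: j]) (xbl i w')
  else 0.

Fixpoint xbw u w : ext :=
  if u is i :: u' then
    xwedge (xmono [:: i]) (xbw u' w)
      + sgnb K (wpar u' && wpar w) *: xwedge (xbl i w) (xmono u')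
  else 0.

Section GrBracket.
Variables (G : zmodType) (g : letter D -> G) (c : G).
Hypothesis gc : forall j, g (dl j) + g j = c.

(** A bracket removes one pair [dl j], [j], so it lowers by [c] any grading in which all these pairs
    have degree [c]. The uses are [c] = 2 for the weight, 1 for the letters of one kind, 0 for
    degree and parity. *)
Lemma xgr_bl i w :
  xgr g (g i + \sum_(j <- w) g j - c) (xbl i w).
Proof.
elim: w => [|j w IH] /=; first exact: xgr0.
apply: xgrD; last first.
  apply: xgrZ.
  have -> : g i + \sum_(j <- (j :: w)) g j - c =
     \sum_(j <- [:: j]) g j + (g i + \sum_(j <- w) g j - c).
    by rewrite big_cons big_seq1 addrCA -!addrA.
  exact/xgr_wedge/IH/xgr_mono.
have [->|/dpair_neq ->] := eqVneq i (dl j); last by rewrite scale0r; apply: xgr0.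
apply: xgrZ; rewrite big_cons addrA gc.
have -> : c + \sum_(j0 <- w) g j0 - c = \sum_(j0 <- w) g j0 by rewrite addrC addKr.
exact: xgr_mono.
Qed.

Lemma xgr_bw u w :
  xgr g (\sum_(j <- u) g j + \sum_(j <- w) g j - c) (xbw u w).
Proof.
elim: u => [|i u IH] /=; first exact: xgr0.
apply: xgrD.
  have -> : \sum_(j <- (i :: u)) g j + \sum_(j <- w) g j - c =
     \sum_(j <- [:: i]) g j + (\sum_(j <- u) g j + \sum_(j <- w) g j - c).
    by rewrite big_cons big_seq1 !addrA.
  exact/xgr_wedge/IH/xgr_mono.
apply: xgrZ; rewrite big_cons.
have -> : g i + \sum_(j <- u) g j + \sum_(j <- w) g j - c =
   g i + \sum_(j <- w) g j - c + \sum_(j <- u) g j.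
  by rewrite [RHS]addrAC; congr (_ - _); rewrite addrAC.
exact/xgr_wedge/xgr_mono/xgr_bl.
Qed.

End GrBracket.

Lemma xhpar_bl i w : xhpar (par i (+) wpar w) (xbl i w).
Proof.
have := @xgr_bl bool (@par D) false _ i w; rewrite -wparE subr0; apply.
by move=> j; rewrite par_dl; case: (par j).
Qed.

Lemma xbw_nil u : xbw u [::] = 0.
Proof.
by elim: u => //= i u ->; rewrite xwedge0r xwedge0l scaler0 addr0.
Qed.

(** What lets the recursion on words descend to the algebra. The two terms where a transposed letter
    is paired trade places; their signs agree because the pairing vanishes between letters of
    different parity. *)
Lemma swaps_xbl i : swaps (xbl i).
Proof.
move=> a j k b; elim: a => [|l a IH] /=; last first.
  rewrite IH xmonoS xwedgeZr scalerDr !scalerA.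
  by congr (_ *: _ + _ *: _); apply: mulrC.
rewrite !xwedgeDr !xwedgeZr !xwedge_mono /= !scalerDr !scalerA.
rewrite addrCA; congr (_ + (_ + _)).
- by apply: dpair_scale => ->.
- rewrite -[X in X *: _ = _]mul1r -sgnbD; apply: dpair_scale => ->.
  by rewrite andbC addbb.
- rewrite !xwedgeA (xwedgeC (@xhpar_mono1 K _ k) (@xhpar_mono1 K _ j)).
  rewrite xwedgeZl scalerA -!sgnbD; congr (sgnb _ _ *: _); bools.
Qed.

Lemma swaps_xbwr u : swaps (xbw u).
Proof.
elim: u => [|i u IH]; first by move=> a j k b; rewrite scaler0.
apply: swaps_add; first by apply: swaps_lin IH; exact/lin_xwedger/lin_id.
apply: (swaps_wpar (fun b => sgnb K (wpar u && b))).
apply: (swaps_lin (f := fun x => xwedge x (xmono u))) (swaps_xbl i).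
exact/lin_xwedgel/lin_id.
Qed.

(** As for the second argument, the two terms where one transposed letter is bracketed with [w]
    trade places; here the other letter must first be moved across that bracket, whose parity is
    known from [xhpar_bl]. *)
Lemma swaps_xbwl w : swaps (fun u => xbw u w).
Proof.
move=> a i j b; elim: a => [|k a IH] /=; last first.
  rewrite IH xmonoS !xwedgeZr scalerDr !scalerA; congr (_ + _ *: _).
  by rewrite mulrC; congr (_ * sgnb K (_ && _)); rewrite !wpar_cat !wpar_cons; bools.
rewrite !xwedgeDr !xwedgeZr !scalerDr !scalerA -!addrA.
congr (_ + _).
  rewrite !xwedgeA (xwedgeC (@xhpar_mono1 K _ j) (@xhpar_mono1 K _ i)).
  by rewrite xwedgeZl andbC.
rewrite addrC; congr (_ + _).
  rewrite [in RHS]xwedgeA (xwedgeC (@xhpar_mono1 K _ i) (@xhpar_bl j w)).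
  rewrite xwedgeZl -xwedgeA -xmono_cons scalerA -!sgnbD wpar_cons.
  congr (sgnb _ _ *: _); bools.
rewrite [in LHS]xwedgeA (xwedgeC (@xhpar_mono1 K _ j) (@xhpar_bl i w)).
rewrite xwedgeZl -xwedgeA -xmono_cons scalerA -!sgnbD wpar_cons.
congr (sgnb _ _ *: _); bools.
Qed.

End BracketWord.

HB.lock Definition xbracket (K : numFieldType) (V : gvect) (x y : xext K (dbl V)) :
    xext K (dbl V) :=
  xlift (fun u => xlift (fun w => xbw K u w) y) x.

(** * Leibniz rules, antisymmetry and Jacobi identities of the big bracket *)

Section Bracket.
Variables (K : numFieldType) (V : gvect).
Local Notation D := (dbl V).
Local Notation ext := (xext K D).
Local Notation xmono := (@xmono K D).
Local Notation xwedge := (@xwedge K D).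
Local Notation xbl := (@xbl K V).
Local Notation xbw := (@xbw K V).
Local Notation xbracket := (@xbracket K V).
Implicit Types (i j : letter D) (u v w : seq (letter D)).

Lemma xbracket_mono u w : xbracket (xmono u) (xmono w) = xbw u w.
Proof.
rewrite xbracket.unlock xlift_mono.
  by rewrite xlift_mono //; apply: swaps_xbwr.
move=> a i j b; rewrite !xlift_mono; try exact: swaps_xbwr.
exact: swaps_xbwl.
Qed.

Lemma lin_xbracketl (E : lmodType K) (f : E -> ext) y :
  linear f -> linear (fun x => xbracket (f x) y).
Proof. by move=> lf c x z; rewrite xbracket.unlock; apply: lin_xlift. Qed.

Lemma lin_xbracketr (E : lmodType K) (f : E -> ext) x :
  linear f -> linear (fun y => xbracket x (f y)).
Proof.
move=> lf; apply: (lin_comp (g := xbracket x)) => //.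
have H : linear (fun y => xlift (fun u => xlift (fun w => xbw u w) y) x).
  by apply: lin_sum => w; apply: lin_scale; apply/lin_xlift/lin_id.
by move=> c y z; rewrite xbracket.unlock; apply: H.
Qed.

Lemma xbracketDl x z y : xbracket (x + z) y = xbracket x y + xbracket z y.
Proof. exact: (linD (lin_xbracketl y (@lin_id _ ext)) x z). Qed.
Lemma xbracketDr x y z : xbracket x (y + z) = xbracket x y + xbracket x z.
Proof. exact: (linD (lin_xbracketr x (@lin_id _ ext)) y z). Qed.
Lemma xbracketZl c (x y : ext) : xbracket (c *: x) y = c *: xbracket x y.
Proof. exact: (linZ (lin_xbracketl y (@lin_id _ ext)) c x). Qed.
Lemma xbracketZr c (x y : ext) : xbracket x (c *: y) = c *: xbracket x y.
Proof. exact: (linZ (lin_xbracketr x (@lin_id _ ext)) c y). Qed.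
Lemma xbracket0l (y : ext) : xbracket 0 y = 0.
Proof. exact: (lin0 (lin_xbracketl y (@lin_id _ ext))). Qed.
Lemma xbracket0r (x : ext) : xbracket x 0 = 0.
Proof. exact: (lin0 (lin_xbracketr x (@lin_id _ ext))). Qed.

Lemma xgr_xbracket (G : zmodType) (g : letter D -> G) (c : G) a b x y :
  (forall j, g (dl j) + g j = c) -> xgr g a x -> xgr g b y ->
  xgr g (a + b - c) (xbracket x y).
Proof.
move=> gc gx gy; apply: (xgr_linear (f := fun x => xbracket x y) _ gx) => [|u eu].
  exact/lin_xbracketl/lin_id.
apply: (xgr_linear (f := xbracket (xmono u)) _ gy) => [|v ev].
  exact/lin_xbracketr/lin_id.
by rewrite xbracket_mono -eu -ev; apply: xgr_bw.
Qed.

Lemma xhpar_xbracket (b c : bool) (x y : ext) :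
  xhpar b x -> xhpar c y -> xhpar (b (+) c) (xbracket x y).
Proof.
move=> gx gy; have := xgr_xbracket (c := false) _ gx gy; rewrite subr0; apply.
by move=> j; rewrite par_dl; case: (par j).
Qed.

Lemma xbw_cat u v w : xbw (u ++ v) w =
  xwedge (xmono u) (xbw v w)
    + sgnb K (wpar v && wpar w) *: xwedge (xbw u w) (xmono v).
Proof.
elim: u => [|i u IH] /=; first by rewrite xwedge1l xwedge0l scaler0 addr0.
rewrite IH xwedgeDr xwedgeDl scalerDr addrA xwedgeA xwedge_mono; congr (_ + _ + _).
  by rewrite xwedgeZr xwedgeA.
rewrite xwedgeZl -xwedgeA xwedge_mono scalerA -sgnbD wpar_cat.
congr (sgnb _ _ *: _); bools.
Qed.

Lemma xbl_cat i u v : xbl i (u ++ v) =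
  xwedge (xbl i u) (xmono v)
    + sgnb K (par i && wpar u) *: xwedge (xmono u) (xbl i v).
Proof.
elim: u => [|j u IH] /=; first by rewrite xwedge1l xwedge0l andbF scale1r add0r.
rewrite IH xwedgeDr xwedgeDl scalerDr addrA xwedgeZl xwedge_mono xwedgeZl !xwedgeA.
congr (_ + _ + _).
rewrite xwedgeZr scalerA xwedgeA xwedge_mono -sgnbD wpar_cons.
congr (sgnb _ _ *: _); bools.
Qed.

Lemma xbracketMl (b t : bool) (A B T : ext) : xhpar b B -> xhpar t T ->
  xbracket (xwedge A B) T =
    xwedge A (xbracket B T) + sgnb K (b && t) *: xwedge (xbracket A T) B.
Proof.
move=> hB hT.
apply: (eq_linear_xext (f := fun A => xbracket (xwedge A B) T) (g := fun A =>
  xwedge A (xbracket B T) + sgnb K (b && t) *: xwedge (xbracket A T) B)) => [||u].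
- exact/lin_xbracketl/lin_xwedgel/lin_id.
- apply/lin_add; first exact/lin_xwedgel/lin_id.
  exact/lin_scale/lin_xwedgel/lin_xbracketl/lin_id.
apply: (xhpar_eq hB (f := fun B => xbracket (xwedge _ B) T) (h := fun B =>
  xwedge _ (xbracket B T) + sgnb K (b && t) *: xwedge (xbracket _ T) B)) => [||v <-].
- exact/lin_xbracketl/lin_xwedger/lin_id.
- apply/lin_add; first exact/lin_xwedger/lin_xbracketl/lin_id.
  exact/lin_scale/lin_xwedger/lin_id.
apply: (xhpar_eq hT (f := fun T => xbracket _ T) (h := fun T =>
  xwedge _ (xbracket _ T) + sgnb K (wpar v && t) *: xwedge (xbracket _ T) _)) => [||w <-].
- exact/lin_xbracketr/lin_id.
- apply/lin_add; first exact/lin_xwedger/lin_xbracketr/lin_id.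
  exact/lin_scale/lin_xwedgel/lin_xbracketr/lin_id.
by rewrite xwedge_mono !xbracket_mono xbw_cat.
Qed.

(** The recursion builds in the Leibniz rule for the first argument. The rule for the second
    argument, by which the big bracket is usually defined, is recovered by induction on [q], from
    the case of one letter [xbl_cat]. *)
Lemma xbw_catr q u v : xbw q (u ++ v) =
  xwedge (xbw q u) (xmono v)
    + sgnb K (wpar q && wpar u) *: xwedge (xmono u) (xbw q v).
Proof.
elim: q => [|i q IH] /=; first by rewrite xwedge0l xwedge0r scaler0 addr0.
rewrite IH xbl_cat !(xwedgeDr, xwedgeDl, scalerDr, xwedgeZl, xwedgeZr, scalerA).
rewrite -!addrA xwedgeA; congr (_ + _).
rewrite addrCA; congr (_ + _).
  rewrite -!xwedgeA !xwedge_mono xmono_catC xwedgeZr scalerA -sgnbD wpar_cat.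
  congr (sgnb _ _ *: _); bools.
congr (_ + _).
  rewrite !xwedgeA !xwedge_mono xmono_catC xwedgeZl scalerA -sgnbD wpar_cons.
  congr (sgnb _ _ *: _); bools.
rewrite xwedgeA -!sgnbD wpar_cat wpar_cons.
congr (sgnb _ _ *: _); bools.
Qed.

Lemma xbracketMr (q a : bool) (Q A B : ext) : xhpar q Q -> xhpar a A ->
  xbracket Q (xwedge A B) =
    xwedge (xbracket Q A) B + sgnb K (q && a) *: xwedge A (xbracket Q B).
Proof.
move=> hQ hA.
apply: (eq_linear_xext (f := fun B => xbracket Q (xwedge A B)) (g := fun B =>
  xwedge (xbracket Q A) B + sgnb K (q && a) *: xwedge A (xbracket Q B))) => [||v].
- exact/lin_xbracketr/lin_xwedger/lin_id.
- apply/lin_add; first exact/lin_xwedger/lin_id.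
  exact/lin_scale/lin_xwedger/lin_xbracketr/lin_id.
apply: (xhpar_eq hA (f := fun A => xbracket Q (xwedge A _)) (h := fun A =>
  xwedge (xbracket Q A) _ + sgnb K (q && a) *: xwedge A (xbracket Q _))) => [||u <-].
- exact/lin_xbracketr/lin_xwedgel/lin_id.
- apply/lin_add; first exact/lin_xwedgel/lin_xbracketr/lin_id.
  exact/lin_scale/lin_xwedgel/lin_id.
apply: (xhpar_eq hQ (f := fun Q => xbracket Q _) (h := fun Q =>
  xwedge (xbracket Q _) _ + sgnb K (q && wpar u) *: xwedge _ (xbracket Q _))) => [||w <-].
- exact/lin_xbracketl/lin_id.
- apply/lin_add; first exact/lin_xwedgel/lin_xbracketl/lin_id.
  exact/lin_scale/lin_xwedger/lin_xbracketl/lin_id.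
by rewrite xwedge_mono !xbracket_mono xbw_catr.
Qed.

Lemma xbracket_letter i w : xbracket (xmono [:: i]) (xmono w) = xbl i w.
Proof. by rewrite xbracket_mono /= xwedge0r add0r xwedge1r scale1r. Qed.

Lemma xbracket_letters i j : xbracket (xmono [:: i]) (xmono [:: j]) = dpair K i j *: xmono [::].
Proof. by rewrite xbracket_letter /= xwedge0r scaler0 addr0. Qed.

Lemma xbracket1l (y : ext) : xbracket (xmono [::]) y = 0.
Proof.
apply: (eq_linear_xext (f := fun y => xbracket (xmono [::]) y) (g := fun=> 0)) => [||u].
- exact/lin_xbracketr/lin_id.
- exact: lin_cst0.
by rewrite xbracket_mono.
Qed.

Lemma xbracket1r (y : ext) : xbracket y (xmono [::]) = 0.
Proof.
apply: (eq_linear_xext (f := fun y => xbracket y (xmono [::])) (g := fun=> 0)) => [||u].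
- exact/lin_xbracketl/lin_id.
- exact: lin_cst0.
by rewrite xbracket_mono xbw_nil.
Qed.

(** Both sides obey the same Leibniz rules, so the identity descends to two letters, where it is
    [dpairC]. *)
Lemma xbracketC (q t : bool) (Q T : ext) : xhpar q Q -> xhpar t T ->
  xbracket Q T = - (sgnb K (q && t) *: xbracket T Q).
Proof.
move=> hQ hT.
(* The first argument is a letter here; the induction on the first word then takes this as its
   step. *)
have L1 i w : xbracket (xmono [:: i]) (xmono w)
    = - (sgnb K (par i && wpar w) *: xbracket (xmono w) (xmono [:: i])).
  elim: w => [|j w IH].
    by rewrite xbracket1r xbracket1l scaler0 oppr0.
  rewrite [xmono (j :: w)]xmono_cons (xbracketMr _ (@xhpar_mono1 K _ i) (@xhpar_mono1 K _ j)).
  rewrite (xbracketMl _ (@xhpar_mono K _ w) (@xhpar_mono1 K _ i)).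
  rewrite IH !xbracket_letters !xwedgeZl !xwedge1l xwedgeNr xwedgeZr.
  rewrite addrC scalerDr opprD !scalerN !scalerA; congr (_ + _).
    rewrite -!sgnbD wpar_cons; congr (- (sgnb _ _ *: _)); bools.
  rewrite [dpair K i j]dpairC scaleNr -sgnbD; congr (- _).
  apply: dpair_scale => e; congr (sgnb _ _); rewrite wpar_cons e; bools.
apply: (xhpar_eq hQ (f := fun Q => xbracket Q T) (h := fun Q =>
  - (sgnb K (q && t) *: xbracket T Q))) => [||u <-].
- exact/lin_xbracketl/lin_id.
- exact/lin_opp/lin_scale/lin_xbracketr/lin_id.
apply: (xhpar_eq hT (f := fun T => xbracket _ T) (h := fun T =>
  - (sgnb K (wpar u && t) *: xbracket T _))) => [||w <-].
- exact/lin_xbracketr/lin_id.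
- exact/lin_opp/lin_scale/lin_xbracketl/lin_id.
elim: u => [|i u IH].
  by rewrite xbracket1r xbracket1l scaler0 oppr0.
rewrite [xmono (i :: u)]xmono_cons (xbracketMl _ (@xhpar_mono K _ u) (@xhpar_mono K _ w)).
rewrite (xbracketMr _ (@xhpar_mono K _ w) (@xhpar_mono1 K _ i)).
rewrite IH L1 !(xwedgeNl, xwedgeNr, xwedgeZl, xwedgeZr, scalerDr, opprD, scalerN, scalerA).
rewrite addrC -!sgnbD; congr (- (sgnb _ _ *: _) - (sgnb _ _ *: _)).
  by rewrite wpar_cons; bools.
by rewrite wpar_cons; bools.
Qed.

(** The Jacobi identity for two letters: its third term is a bracket with the scalar [[e_i, e_j]],
    which is zero. *)
Lemma xbracket_bracket_letters i j (T : ext) : xbracket (xbracket (xmono [:: i]) T) (xmono [:: j])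
  = xbracket (xmono [:: i]) (xbracket T (xmono [:: j])).
Proof.
apply: (eq_linear_xext (f := fun T => xbracket (xbracket (xmono [:: i]) T) (xmono [:: j]))
  (g := fun T => xbracket (xmono [:: i]) (xbracket T (xmono [:: j])))) => [||w].
- exact/lin_xbracketl/lin_xbracketr/lin_id.
- exact/lin_xbracketr/lin_xbracketl/lin_id.
elim: w => [|k w IH].
  by rewrite xbracket1l !xbracket1r xbracket0l xbracket0r.
have [hi hj hk hw] : [/\ xhpar (par i) (xmono [:: i] : ext), xhpar (par j) (xmono [:: j] : ext),
   xhpar (par k) (xmono [:: k] : ext) & xhpar (wpar w) (xmono w : ext)].
  by split; (exact: xhpar_mono1 || exact: xhpar_mono).
rewrite [xmono (k :: w)]xmono_cons (xbracketMr _ hi hk) (xbracketMl _ hw hj) xbracketDl xbracketDr.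
rewrite xbracketZl xbracketZr !xbracket_letters !xwedgeZl !xwedge1l.
rewrite !xbracketZl !xbracketZr.
rewrite (xbracketMl _ (xhpar_xbracket hi hw) hj) (xbracketMr _ hi hk) IH.
rewrite !xbracket_letters !xwedgeZl !xwedge1l !scalerDr !scalerA -!addrA.
congr (_ + (_ + _)).
rewrite -!sgnbD; apply: dpair_scale => e; congr (sgnb _ _); rewrite e; bools.
Qed.

(** As functions of [Q] both sides are derivations of the same parity, so they need only agree on
    letters, which is the preceding lemma. *)
Lemma jacobi_letter (t : bool) (Q T : ext) j : xhpar t T ->
  xbracket (xbracket Q T) (xmono [:: j]) = xbracket Q (xbracket T (xmono [:: j]))
    + sgnb K (t && par j) *: xbracket (xbracket Q (xmono [:: j])) T.
Proof.
move=> hT; have hj : xhpar (par j) (xmono [:: j] : ext) by apply: xhpar_mono1.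
apply: (eq_linear_xext (f := fun Q => xbracket (xbracket Q T) (xmono [:: j]))
  (g := fun Q => xbracket Q (xbracket T (xmono [:: j]))
    + sgnb K (t && par j) *: xbracket (xbracket Q (xmono [:: j])) T)) => [||u].
- exact/lin_xbracketl/lin_xbracketl/lin_id.
- apply/lin_add; first exact/lin_xbracketl/lin_id.
  exact/lin_scale/lin_xbracketl/lin_xbracketl/lin_id.
elim: u => [|i u IH].
  by rewrite !xbracket1l !xbracket0l scaler0 addr0.
have hu := @xhpar_mono K _ u.
have hi : xhpar (par i) (xmono [:: i] : ext) by apply: xhpar_mono1.
rewrite [xmono (i :: u)]xmono_cons (xbracketMl _ hu hT) (xbracketMl _ hu (xhpar_xbracket hT hj)).
rewrite (xbracketMl _ hu hj) xbracketDl xbracketZl (xbracketMl _ (xhpar_xbracket hu hT) hj).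
rewrite (xbracketMl _ hu hj) xbracketDl xbracketZl (xbracketMl _ (xhpar_xbracket hu hj) hT).
rewrite IH -xbracket_bracket_letters.
rewrite xbracket_letters !xwedgeZl !xwedge1l xbracketZl.
rewrite !(scalerDr, xwedgeDr, xwedgeZr, scalerA, sgnbD) -!addrA; congr (_ + _).
rewrite [RHS]addrCA; congr (_ + _); rewrite [LHS]addrC [RHS]addrA; congr (_ + _).
  rewrite addrC -!sgnbD; congr (sgnb _ _ *: _ + sgnb _ _ *: _); bools.
by rewrite mulrA -sgnbD; apply: dpair_scale => <-; congr (sgnb _ _); bools.
Qed.

(** Bracketing with an odd element is an odd derivation, and the anticommutator of two odd
    derivations is a derivation; so letters suffice again. For [T = T'] the left side is twice the
    double bracket, the source of the factor 1/2 in [pairing_coder_square]. *)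
Lemma jacobi_odd (Q T T' : ext) : xhpar true T -> xhpar true T' ->
  xbracket (xbracket Q T) T' + xbracket (xbracket Q T') T = xbracket Q (xbracket T T').
Proof.
move=> hT hT'; have hTT := xhpar_xbracket hT hT'.
apply: (eq_linear_xext (f := fun Q => xbracket (xbracket Q T) T' + xbracket (xbracket Q T') T)
  (g := fun Q => xbracket Q (xbracket T T'))) => [||u].
- by apply/lin_add; apply/lin_xbracketl/lin_xbracketl/lin_id.
- exact/lin_xbracketl/lin_id.
elim: u => [|i u IH]; first by rewrite !xbracket1l !xbracket0l addr0.
have hu := @xhpar_mono K _ u; have hi := @xhpar_mono1 K _ i.
(* For a letter, antisymmetry moves it to the last slot, where [jacobi_letter] applies. *)
have L : xbracket (xbracket (xmono [:: i]) T) T' + xbracket (xbracket (xmono [:: i]) T') T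
    = xbracket (xmono [:: i]) (xbracket T T').
  rewrite [RHS](xbracketC hi hTT) (jacobi_letter _ _ hT').
  rewrite [xbracket T' _](xbracketC hT' hi) [xbracket T (xmono _)](xbracketC hT hi).
  rewrite -!scaleN1r !(xbracketZl, xbracketZr).
  rewrite (xbracketC hT (xhpar_xbracket hi hT')) addrC.
  rewrite -!scaleN1r !(scalerDr, scalerA) -[X in X + _ = _]scale1r -[X in _ + X = _]scale1r.
  by congr (_ *: _ + _ *: _); rewrite /sgnb; case: (par i); rewrite /= ?expr0 ?expr1; ring.
rewrite [xmono (i :: u)]xmono_cons (xbracketMl _ hu hT) (xbracketMl _ hu hT')
  (xbracketMl _ hu hTT) !xbracketDl !xbracketZl.
rewrite (xbracketMl _ (xhpar_xbracket hu hT) hT') (xbracketMl _ (xhpar_xbracket hu hT') hT).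
rewrite (xbracketMl _ hu hT) (xbracketMl _ hu hT') -IH -L.
rewrite !(scalerDr, xwedgeDr, xwedgeDl, scalerA).
(* [X] and [Y] stand for the mixed products, in which [T] hits one factor and [T'] the other. Each
   comes once from either summand, with opposite signs since both are odd. *)
have cancel (A A' X Y Z Z' : ext) :
    A - X + (Y + Z) + (A' - Y + (X + Z')) = A + A' + (Z + Z').
  rewrite addrACA [A - X + _]addrACA [Y + Z + _]addrACA -addrA; congr (_ + _).
  by rewrite -opprD [Y + X]addrC addKr.
rewrite -!sgnbD !andbT addbb /sgnb.
case: (wpar u); rewrite /= ?expr0 ?expr1 !scaleN1r !scale1r; last exact: cancel.
by rewrite -[X in _ + X + _ + _]opprK -[X in _ + (_ + X + _)]opprK cancel.
Qed.

End Bracket.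

(** * Unshuffles and their signs *)

Section Splits.

(* m splits a word w into [mask m w] and [mask (map negb m) w]. *)
Fixpoint splits (n : nat) : seq bitseq :=
  if n is n'.+1 then map (cons true) (splits n') ++ map (cons false) (splits n')
  else [:: [::]].

Lemma mem_splits n m : (m \in splits n) = (size m == n).
Proof.
elim: n m => [|n IH] [|b m] //=.
  by rewrite mem_cat; apply/negbTE; rewrite negb_or; apply/andP; split; apply/mapP => -[].
rewrite mem_cat eqSS -IH.
case: b; [rewrite orbC|]; (rewrite (_ : _ \in map _ _ = false) /=;
  last by apply/mapP => -[x _ []]); by rewrite mem_map // => x y [].
Qed.

Lemma uniq_splits n : uniq (splits n).
Proof.
elim: n => //= n IH; rewrite cat_uniq !map_inj_uniq ?IH /=; try by move=> x y [].
by rewrite andbT; apply/hasPn => x /mapP[y _ ->]; apply/mapP => -[].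
Qed.

Lemma big_tuple_splits (E : nmodType) n (P : pred bitseq) (F : bitseq -> E) :
  \sum_(m : n.-tuple bool | P m) F m = \sum_(m <- splits n | P m) F m.
Proof.
rewrite -(big_map (@tval n bool) P F); apply: perm_big; apply: uniq_perm.
- by rewrite map_inj_uniq ?index_enum_uniq //; apply: val_inj.
- exact: uniq_splits.
move=> m; rewrite mem_splits; apply/mapP/eqP => [[t _ ->]|<-].
  by rewrite size_tuple.
by exists (in_tuple m); rewrite ?mem_index_enum.
Qed.

Variable W : gvect.
Implicit Types (w : seq (letter W)).

(* Exponent of the Koszul sign of [w |-> mask m w ++ mask (map negb m) w]. *)
Fixpoint split_sign (m : bitseq) w : bool :=
  match m, w with
  | b :: m', i :: w' => split_sign m' w' (+) [&& ~~ b, par i & wpar (mask m' w')]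
  | _, _ => false
  end.

Lemma swaps_split (K : numFieldType) (E : lmodType K) (F : seq (letter W) -> E)
    m w a : swaps F -> size m = size w ->
  F (a ++ w) = sgnb K (split_sign m w) *: F (a ++ mask m w ++ mask (map negb m) w).
Proof.
move=> sF; elim: w m a => [|i w IH] [|b m] a //= => [_|[sm]].
  by rewrite scale1r.
rewrite -cat_rcons (IH m) // cat_rcons sgnbD -scalerA; congr (_ *: _).
case: b => /=; first by rewrite scale1r.
by rewrite (swaps_rot1 sF) andbC scalerA sgnbK scale1r.
Qed.

End Splits.

Lemma split_sign_map (U W : gvect) (f : letter U -> letter W) m w :
  (forall i, par (f i) = par i) -> split_sign m (map f w) = split_sign m w.
Proof.
move=> pf; have wf v : wpar (map f v) = wpar v.
  by rewrite /wpar count_map; congr odd; apply: eq_count => i; apply: pf.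
elim: w m => [|i w IH] [|b m] //=; by rewrite IH pf -map_mask wf.
Qed.

Lemma perm_mask (T : eqType) (m : bitseq) (w : seq T) : size m = size w ->
  perm_eq (mask m w ++ mask (map negb m) w) w.
Proof.
elim: w m => [|i w IH] [|[] m] //= [/IH sm]; first by rewrite perm_cons.
by rewrite perm_catC /= perm_cons perm_catC.
Qed.

Section Koszul.
Variables (K : numFieldType) (U : gvect).
Local Notation n := (gdim U).
Local Notation E := (enum 'I_n).

Lemma sign_count (I : eqType) (a : pred I) (b : pred I) (l : seq I) :
  (-1) ^+ count (fun j => a j && b j) l = \prod_(j <- l | a j) sgnb K (b j) :> K.
Proof.
elim: l => [|j l IH] /=; first by rewrite big_nil.
by rewrite big_cons exprD IH; case: (a j); rewrite ?mul1r.
Qed.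

Lemma ksgn_map (f : 'I_n -> 'I_n) (l : seq 'I_n) :
  sorted (fun i j : 'I_n => (i < j)%N) l ->
  ksgn K (map f l : seq (letter U)) =
  \prod_(i <- l) \prod_(j <- l | (i < j)%N && (f j < f i)%N)
     sgnb K (@par U (f i) && @par U (f j)).
Proof.
elim: l => [|i l IH] /= sl; first by rewrite big_nil.
have al : all (fun j : 'I_n => (i < j)%N) l.
  by apply: order_path_min sl => x y z; apply: ltn_trans.
rewrite IH ?(path_sorted sl) // big_cons; congr (_ * _).
  rewrite big_cons ltnn /= count_map sign_count big_seq_cond [RHS]big_seq_cond.
  by apply: eq_bigl => j; case: (boolP (j \in l)) => //= /(allP al) ->.
rewrite big_seq [RHS]big_seq; apply: eq_bigr => j jl.
by rewrite big_cons ltnNge (ltnW (allP al _ jl)).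
Qed.

Lemma sorted_enum : sorted (fun i j : 'I_n => (i < j)%N) E.
Proof. by have := iota_ltn_sorted 0 n; rewrite -val_enum_ord sorted_map. Qed.

(** Positions are read as the letters of an auxiliary graded space [U], so that the sign of a
    permutation becomes the sorting sign of a word with distinct letters. *)
Lemma koszulE (s : 'S_n) :
  koszul K (@par U) s = ksgn K (map s E : seq (letter U)).
Proof.
rewrite ksgn_map; last exact: sorted_enum.
by rewrite /koszul big_enum /=; apply: eq_bigr => i _; rewrite big_enum_cond.
Qed.

(** [mono L] is computed twice, by sorting and by undoing the split. The sorted word has distinct
    letters, so its monomial is a basis element and the two signs can be compared as its
    coefficients. *)
Lemma ksgn_perm (L : seq 'I_n) m : size m = n ->
  L = mask m E ++ mask (map negb m) E ->
  ksgn K (L : seq (letter U)) = sgnb K (@split_sign U m E).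
Proof.
move=> sm eL.
have nE : @is_normal U E.
  by apply: sub_sorted sorted_enum => i j ->.
pose e : nword U := NWord nE.
have H0 : mono (L : seq (letter U)) = ksgn K (L : seq (letter U)) *: << e >>.
  have pL : perm_eq L E.
    by rewrite eL perm_mask // size_enum_ord.
  have es : sort (fun i j : letter U => (i <= j)%N) L = E.
    rewrite (_ : sort _ L = sort (fun i j : letter U => (i <= j)%N) E).
      by apply: sorted_sort; [exact: letter_leq_trans|exact: normal_sorted nE].
    by apply/perm_sortP => //; [exact: letter_leq_total|exact: letter_leq_trans|exact: letter_leq_anti].
  rewrite /mono es insubT; congr (_ *: << _ >>); exact: val_inj.
have := @swaps_split U K _ (fun w => mono w : ext K U) m E [::] (@mono_swap K U).
rewrite !cat0s -eL H0 -(monoU K e) scalerA size_enum_ord => /(_ sm).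
rewrite [mono E](monoU K e) => /(congr1 (fun x => x@_e)).
rewrite mcoeffZ mcoeffUU mulr1 => h.
by apply: (mulfI (sgnb_neq0 K (@split_sign U m E))); rewrite sgnbK -h.
Qed.

End Koszul.

Section Unshuffle.
Variable n : nat.
Local Notation E := (enum 'I_n).
Local Notation ltO := (fun i j : 'I_n => (i < j)%N).
Implicit Types (s : 'S_n) (m : n.-tuple bool).

Lemma ltO_trans : transitive ltO.
Proof. by move=> i j k; apply: ltn_trans. Qed.

Lemma ltO_sorted : sorted ltO E.
Proof. by have := iota_ltn_sorted 0 n; rewrite -val_enum_ord sorted_map. Qed.

Lemma sorted_ltO_eq (l1 l2 : seq 'I_n) :
  sorted ltO l1 -> sorted ltO l2 -> l1 =i l2 -> l1 = l2.
Proof. by apply: irr_sorted_eq; [exact: ltO_trans|move=> i; apply: ltnn]. Qed.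

Definition split_word m : seq 'I_n := mask m E ++ mask (map negb m) E.

Lemma split_word_perm m : perm_eq (split_word m) E.
Proof. by apply: perm_mask; rewrite size_tuple size_enum_ord. Qed.

Lemma size_split_word m : size (split_word m) = n.
Proof. by rewrite (perm_size (split_word_perm m)) size_enum_ord. Qed.

(** Taking the index itself as the default of [nth] avoids choosing an element of a possibly empty
    ['I_n]; the default is never returned, the word having length n. *)
Lemma split_fun_inj m : injective (fun i => nth i (split_word m) i).
Proof.
move=> i j; rewrite (set_nth_default i j) ?size_split_word // => /eqP.
rewrite nth_uniq ?size_split_word //; first by move/eqP/val_inj.
by rewrite (perm_uniq (split_word_perm m)) enum_uniq.
Qed.

Definition split_perm m : 'S_n := perm (@split_fun_inj m).

Lemma map_split_perm m : map (split_perm m) E = split_word m.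
Proof.
(* Comparing lists entry by entry needs a default, hence the separate case n = 0. *)
have [i0|n0] := pickP 'I_n; last first.
  have e : n = 0%N by move: n0; case: (n) => // n' /(_ ord0).
  have := size_split_word m; rewrite {2}e => /size0nil ->.
  by apply/size0nil; rewrite size_map size_enum_ord.
move=> _; apply: (@eq_from_nth _ i0); rewrite size_map size_enum_ord ?size_split_word //.
move=> i ni; rewrite (nth_map i0) ?size_enum_ord // permE.
have -> : nth i0 E i = Ordinal ni by apply: val_inj; rewrite /= nth_enum_ord.
by apply: set_nth_default; rewrite size_split_word.
Qed.

Lemma map_perm_inj s s' : map s E = map s' E -> s = s'.
Proof.
by move=> /eq_in_map e; apply/permP => i; apply: e; rewrite mem_enum.
Qed.

Variable k : nat.

Definition perm_split s : n.-tuple bool :=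
  [tuple of map (mem (take k (map s E))) (ord_tuple n)].

Lemma perm_splitE s : perm_split s = map (mem (take k (map s E))) E :> seq bool.
Proof. exact: (congr1 (map _) (val_ord_tuple n)). Qed.

Lemma perm_map_enum s : perm_eq (map s E) E.
Proof.
apply: uniq_perm; [by rewrite map_inj_uniq ?enum_uniq //; apply: perm_inj|exact: enum_uniq|].
by move=> i; rewrite mem_enum inE; apply/mapP; exists ((s^-1)%g i); rewrite ?mem_enum ?inE ?permKV.
Qed.

(** Both halves of the list of images are increasing, and an increasing list is determined by its
    set of entries; so an unshuffle is determined by the set of its first [k] images. *)
Lemma unshuffle_split s : unshuffle k s -> map s E = split_word (perm_split s).
Proof.
move=> us; have H (i j : 'I_n) : (i < j)%N -> (j < k)%N || (k <= i)%N -> (s i < s j)%N.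
  by move=> ij kk; move/forallP: us => /(_ i)/forallP/(_ j)/implyP; apply; rewrite ij.
have uL : uniq (map s E) by rewrite (perm_uniq (perm_map_enum s)) enum_uniq.
have cat_take := cat_take_drop k (map s E).
rewrite /split_word perm_splitE -map_comp -[LHS]cat_take; congr (_ ++ _).
  rewrite -filter_mask; apply: sorted_ltO_eq.
  - rewrite -map_take sorted_map; apply: (sub_in_sorted (e := ltO) (P := fun i : 'I_n => (i < k)%N)).
    + move=> i j _ jk ij; by apply: H => //; apply/orP; left.
    + apply/allP => i; rewrite -(mem_map val_inj) map_take val_enum_ord take_iota.
      by rewrite mem_iota add0n => /andP[_ /leq_trans]; apply; rewrite geq_minl.
    + exact/take_sorted/ltO_sorted.
  - exact/(sorted_filter ltO_trans)/ltO_sorted.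
  - by move=> i; rewrite mem_filter mem_enum andbT.
rewrite -filter_mask; apply: sorted_ltO_eq.
- rewrite -map_drop sorted_map; apply: (sub_in_sorted (e := ltO) (P := fun i : 'I_n => (k <= i)%N)).
  + by move=> i j ki _ ij; apply: H => //; apply/orP; right.
  + apply/allP => i; rewrite -(mem_map val_inj) map_drop val_enum_ord drop_iota.
    by rewrite mem_iota add0n => /andP[].
  + exact/drop_sorted/ltO_sorted.
- exact/(sorted_filter ltO_trans)/ltO_sorted.
move=> i; rewrite mem_filter mem_enum andbT /=.
have iL : i \in take k (map s E) ++ drop k (map s E).
  by rewrite cat_take (perm_mem (perm_map_enum s)) mem_enum.
move: iL; rewrite mem_cat; move: uL; rewrite -{1}cat_take cat_uniq.
move=> /and3P[_ /hasPn nd _] /orP[it|id]; last by rewrite id (negbTE (nd _ id)).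
by rewrite it; apply/negbTE/negP => /nd; rewrite /= it.
Qed.

(** The side condition of [reindex_onto]: it makes [split_perm] and [perm_split] inverse bijections
    between masks with [k] bits set and unshuffles. *)
Lemma split_perm_pred m : (k <= n)%N ->
  unshuffle k (split_perm m) && (perm_split (split_perm m) == m) = (count id m == k).
Proof.
move=> kn; apply/andP/eqP => [[_ /eqP <-]|cm].
  rewrite perm_splitE count_map -size_filter.
  have uL : uniq (map (split_perm m) E).
    by rewrite (perm_uniq (perm_map_enum _)) enum_uniq.
  have /perm_size -> : perm_eq (filter (mem (take k (map (split_perm m) E))) E)
     (take k (map (split_perm m) E)).
    apply: uniq_perm; [exact/filter_uniq/enum_uniq|exact: take_uniq|].
    by move=> i; rewrite mem_filter mem_enum andbT.
  by rewrite size_take size_map size_enum_ord; case: ltngtP kn.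
have sE : size m = size E by rewrite size_tuple size_enum_ord.
have sk : size (mask m E) = k by rewrite size_mask.
have tk : take k (map (split_perm m) E) = mask m E.
  by rewrite map_split_perm take_size_cat.
split; last first.
  apply/eqP/val_inj; rewrite /= -[LHS]/(tval (perm_split _)) perm_splitE tk.
  apply: (@eq_from_nth _ false) => [|i]; first by rewrite size_map -sE.
  rewrite size_map => iE; have i0 := Ordinal (ltn_ord (tnth (in_tuple E) (Ordinal iE))).
  rewrite (nth_map i0) //= in_mask ?enum_uniq // mem_nth //= index_uniq ?enum_uniq //.
apply/forallP => i; apply/forallP => j; apply/implyP => /andP[ij kk].
rewrite !permE (set_nth_default i j) ?size_split_word // /split_word !nth_cat sk.
have sd : size (mask (map negb m) E) = (n - k)%N.
  by have := size_split_word m; rewrite /split_word size_cat sk => /(congr1 (fun x => (x - k)%N)); rewrite addKn.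
case/orP: kk => [jk|ki].
  rewrite jk (ltn_trans ij jk).
  apply: (sorted_ltn_nth ltO_trans) => //; rewrite ?inE ?sk ?(ltn_trans ij jk) //.
  exact/(sorted_mask ltO_trans)/ltO_sorted.
rewrite [(i < k)%N]ltnNge ki [(j < k)%N]ltnNge (ltnW (leq_ltn_trans ki ij)) /=.
apply: (sorted_ltn_nth ltO_trans); rewrite ?inE ?sd ?ltn_sub2r //.
- exact/(sorted_mask ltO_trans)/ltO_sorted.
- exact: leq_ltn_trans ki (ltn_ord i).
- exact: leq_ltn_trans ki (ltn_ord i).
- exact: leq_ltn_trans ki ij.
Qed.

End Unshuffle.

(** Permutations do not lend themselves to induction on the word, whereas masks do. This trades one
    index set for the other. *)
Lemma sum_unshuffle (K : numFieldType) (W : gvect) (k : nat) (w : seq (letter W))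
    (E : lmodType K) (G : seq (letter W) -> seq (letter W) -> E) : (k <= size w)%N ->
  \sum_(s : 'S_(size w) | unshuffle k s)
     koszul K (fun i => par (tnth (in_tuple w) i)) s *:
       G (take k [seq tnth (in_tuple w) (s i) | i <- enum 'I_(size w)])
         (drop k [seq tnth (in_tuple w) (s i) | i <- enum 'I_(size w)]) =
  \sum_(m <- splits (size w) | count id m == k)
     sgnb K (split_sign m w) *: G (mask m w) (mask (map negb m) w).
Proof.
move=> kw; set n := size w; pose t : 'I_n -> letter W := tnth (in_tuple w).
rewrite -(big_tuple_splits n (fun m => count id m == k)).
rewrite (reindex_onto (@split_perm n) (@perm_split n k)); last first.
  move=> s us; apply: map_perm_inj; rewrite map_split_perm.
  by rewrite -unshuffle_split.
apply: eq_big => [m|m /andP[us /eqP em]]; first exact: split_perm_pred.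
pose U := @GVect n (fun i => gdeg (t i)).
have wE : w = map t (enum 'I_n).
  by rewrite -{1}[w]/(tval (in_tuple w)) -(map_tnth_enum (in_tuple w)).
have cm : count id m = k.
  by apply/eqP; rewrite -(split_perm_pred _ kw) us em eqxx.
have eL : [seq t (split_perm m i) | i <- enum 'I_n] = mask m w ++ mask (map negb m) w.
  by rewrite (map_comp t) map_split_perm /split_word map_cat !map_mask -wE.
have sk : size (mask m w) = k by rewrite size_mask // size_tuple.
rewrite eL take_size_cat // drop_size_cat //; congr (_ *: _).
rewrite -[LHS]/(koszul K (@par U) (split_perm m)) (@koszulE K U).
rewrite (@ksgn_perm K U _ m) ?size_tuple //; last exact: map_split_perm.
by rewrite wE (@split_sign_map U W t).
Qed.

(** * The adjoint of a coderivation *)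

Section Pairing.
Variables (K : numFieldType) (V : gvect).
Local Notation D := (dbl V).
Local Notation ext := (xext K D).
Local Notation xmono := (@xmono K D).
Local Notation xwedge := (@xwedge K D).
Local Notation xbracket := (@xbracket K V).
Local Notation xgen := (@xgen K D).
Local Notation xwt := (xgr (fun _ : letter D => 1 : int)).

Definition eps (x : ext) : K :=
  xlift (fun w => (nilp w)%:R : K^o) x.

Lemma lin_eps (E : lmodType K) (f : E -> ext) :
  linear f -> linear (fun x => eps (f x) : K^o).
Proof. exact: lin_xlift. Qed.

Lemma epsD x y : eps (x + y) = eps x + eps y.
Proof. exact: (linD (lin_eps (@lin_id _ ext)) x y). Qed.
Lemma epsZ c x : eps (c *: x) = c * eps x.
Proof. exact: (linZ (lin_eps (@lin_id _ ext)) c x). Qed.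
Lemma eps0 : eps 0 = 0.
Proof. exact: (lin0 (lin_eps (@lin_id _ ext))). Qed.
Lemma eps_sum I (r : seq I) (P : pred I) (F : I -> ext) :
  eps (\sum_(i <- r | P i) F i) = \sum_(i <- r | P i) eps (F i).
Proof. exact: (lin_sumf (lin_eps (@lin_id _ ext))). Qed.

Lemma eps_mono w : eps (xmono w) = (nilp w)%:R.
Proof.
apply: (@xlift_mono K D K^o (fun w => (nilp w)%:R)) => a i j b; rewrite /nilp !size_cat /= !addnS /=.
by rewrite scaler0.
Qed.

Lemma sum_const1 (T : Type) (w : seq T) : \sum_(i <- w) (1 : int) = (size w)%:Z.
Proof. by rewrite big_const_seq count_predT iter_addr addr0 natz. Qed.

Lemma eps_wt a x : xwt a x -> a != 0 -> eps x = 0.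
Proof.
move=> wx a0; apply: (xgr_eq_linear (f := fun x => eps x : K^o) (h := fun=> 0) wx) => [||w].
- exact/lin_eps/lin_id.
- exact: lin_cst0.
rewrite eps_mono sum_const1; case: w => // e.
by rewrite -e in a0.
Qed.

Lemma wt0P x : xwt 0 x -> x = eps x *: xmono [::].
Proof.
move=> wx; apply: (xgr_eq_linear (f := fun x => x) (h := fun x => eps x *: xmono [::]) wx).
- exact: lin_id.
- exact/lin_scalev/lin_eps/lin_id.
move=> w; rewrite sum_const1; case: w => // _.
by rewrite eps_mono scale1r.
Qed.

Lemma wt_xbracket a b x y : xwt a x -> xwt b y -> xwt (a + b - 2) (xbracket x y).
Proof. exact: (@xgr_xbracket K V int (fun=> 1) 2). Qed.

Lemma wt_xgen v : xwt 1 (xgen v).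
Proof. exact: xgr_gen. Qed.

Lemma xgenE v : xgen v = \sum_i v 0 i *: xmono [:: i].
Proof.
rewrite {1}[v]row_sum_delta (lin_sumf (lin_xgen (@lin_id _ _))).
by apply: eq_bigr => i _; rewrite (linZ (lin_xgen (@lin_id _ _))) xgen_delta.
Qed.

Definition vpar (U : gvect) (p : bool) (v : vec K U) := forall i, v 0 i != 0 -> par i = p.

Lemma xhpar_gen p v : vpar p v -> xhpar p (xgen v).
Proof. exact: xgr_gen. Qed.

Definition xproj1 (x : ext) : vec K D :=
  xlift (fun w => if w is [:: i] then delta_mx 0 i else 0) x.

Lemma lin_xproj1 (E : lmodType K) (f : E -> ext) :
  linear f -> linear (fun x => xproj1 (f x)).
Proof. exact: lin_xlift. Qed.

Lemma xproj1_mono w : xproj1 (xmono w) = if w is [:: i] then delta_mx 0 i else 0.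
Proof.
apply: xlift_mono => a i j b; case: a => [|k [|l a]] /=; by rewrite scaler0.
Qed.

Lemma xproj1_gen v : xproj1 (xgen v) = v.
Proof.
rewrite xgenE (lin_sumf (lin_xproj1 (@lin_id _ _))) [RHS]row_sum_delta.
by apply: eq_bigr => i _; rewrite (linZ (lin_xproj1 (@lin_id _ _))) xproj1_mono.
Qed.

Lemma wt1P x : xwt 1 x -> x = xgen (xproj1 x).
Proof.
move=> wx; apply: (xgr_eq_linear (f := fun x => x) (h := fun x => xgen (xproj1 x)) wx).
- exact: lin_id.
- exact/lin_xgen/lin_xproj1/lin_id.
move=> w; rewrite sum_const1 xproj1_mono; case: w => [|i [|j w]] // _.
by rewrite xgen_delta.
Qed.

Lemma xgr_proj1 (G : zmodType) (g : letter D -> G) a x : xgr g a x ->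
  forall i, xproj1 x 0 i != 0 -> g i = a.
Proof.
move=> gx i; apply: contraNeq => ga.
have lf : linear (fun x => xproj1 x 0 i : K^o).
  by move=> c y z; rewrite (lin_xproj1 (@lin_id _ _)) !mxE.
apply/eqP; apply: (xgr_eq_linear gx lf (@lin_cst0 _ _ _)) => w ew.
rewrite xproj1_mono; case: w ew => [|j [|k w]] ew; rewrite !mxE ?eqxx //=.
case: eqP => // e; case/eqP: ga; rewrite e -ew big_seq1 //.
Qed.

Lemma vpar_gen p v : xhpar p (xgen v) -> vpar p v.
Proof. by move=> /xgr_proj1; rewrite xproj1_gen. Qed.

Lemma jacobi_gen (t p : bool) (Q T : ext) v : xhpar t T -> vpar p v ->
  xbracket (xbracket Q T) (xgen v) = xbracket Q (xbracket T (xgen v))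
    + sgnb K (t && p) *: xbracket (xbracket Q (xgen v)) T.
Proof.
move=> hT hv; rewrite xgenE.
rewrite !(lin_sumf (lin_xbracketr _ (@lin_id _ _))).
rewrite (lin_sumf (lin_xbracketl T (@lin_id _ _))) scaler_sumr -big_split /=.
apply: eq_bigr => i _; rewrite !(xbracketZr, xbracketZl) (jacobi_letter _ _ hT).
rewrite scalerDr !scalerA; congr (_ + _ *: _).
by have [->|/hv ->] := eqVneq (v 0 i) 0; rewrite ?mul0r ?mulr0 // mulrC.
Qed.

Lemma xbracket_gens u v : exists c : K, xbracket (xgen u) (xgen v) = c *: xmono [::].
Proof.
exists (eps (xbracket (xgen u) (xgen v))); apply: wt0P.
by have := wt_xbracket (@wt_xgen u) (@wt_xgen v); rewrite (_ : 1 + 1 - 2 = 0 :> int).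
Qed.

(** The correction term of the Jacobi identity is a bracket with [[u, v]], a scalar. This
    supersymmetry of iterated brackets is also what makes the form of the double invariant. *)
Lemma gen_swap (p q : bool) Q u v : vpar p u -> vpar q v ->
  xbracket (xbracket Q (xgen u)) (xgen v) =
    sgnb K (p && q) *: xbracket (xbracket Q (xgen v)) (xgen u).
Proof.
move=> hu hv; rewrite (jacobi_gen _ (xhpar_gen hu) hv).
by have [c ->] := xbracket_gens u v; rewrite xbracketZr xbracket1r scaler0 add0r.
Qed.

Definition xiter (x : ext) (vs : seq (vec K D)) : ext :=
  foldl (fun y v => xbracket y (xgen v)) x vs.

Lemma lin_xiter (E : lmodType K) (f : E -> ext) vs :
  linear f -> linear (fun x => xiter (f x) vs).
Proof. by elim: vs f => [|v vs IH] f lf //=; apply/IH/lin_xbracketl. Qed.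

Lemma xiterD x y vs : xiter (x + y) vs = xiter x vs + xiter y vs.
Proof. exact: (linD (lin_xiter vs (@lin_id _ ext)) x y). Qed.
Lemma xiterZ c x vs : xiter (c *: x) vs = c *: xiter x vs.
Proof. exact: (linZ (lin_xiter vs (@lin_id _ ext)) c x). Qed.
Lemma xiter_sum I (r : seq I) (P : pred I) (F : I -> ext) vs :
  xiter (\sum_(i <- r | P i) F i) vs = \sum_(i <- r | P i) xiter (F i) vs.
Proof. exact: (lin_sumf (lin_xiter vs (@lin_id _ ext))). Qed.

Lemma xiter_cat x us vs : xiter x (us ++ vs) = xiter (xiter x us) vs.
Proof. exact: foldl_cat. Qed.

Lemma xiter_rcons x us v : xiter x (rcons us v) = xbracket (xiter x us) (xgen v).
Proof. by rewrite -cats1 xiter_cat. Qed.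

Lemma gr_xiter (I : Type) (q : I -> vec K D) (G : zmodType) (g : letter D -> G)
    (gq : I -> G) (c a : G) x w :
  (forall j, g (dl j) + g j = c) -> (forall i, xgr g (gq i) (xgen (q i))) ->
  xgr g a x -> xgr g (a + \sum_(i <- w) (gq i - c)) (xiter x (map q w)).
Proof.
move=> gc hq; elim: w x a => [|i w IH] x a hx /=; first by rewrite big_nil addr0.
rewrite big_cons addrA; apply: IH.
by rewrite addrA; apply: xgr_xbracket.
Qed.

Lemma wt_xiter a x vs : xwt a x -> xwt (a - (size vs)%:Z) (xiter x vs).
Proof.
move=> hx; rewrite -[vs]map_id.
have := gr_xiter (q := id) (g := fun=> 1 : int) (gq := fun=> 1) (c := 2) (w := vs) _ _ hx.
rewrite (eq_bigr (fun=> - 1)) // sumrN sum_const1 size_map; apply=> //.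
exact: wt_xgen.
Qed.

(* A bracket of weight 0 is either a bracket of two vectors or a bracket with a
   scalar, which vanishes. *)
Lemma eps_bracket_wt b (A B : ext) : xwt b B -> b != 1 -> eps (xbracket A B) = 0.
Proof.
move=> hB b1.
apply: (eq_linear_xext (f := fun A => eps (xbracket A B) : K^o) (g := fun=> 0)) => [||u].
- exact/lin_eps/lin_xbracketl/lin_id.
- exact: lin_cst0.
apply: (xgr_eq_linear (f := fun B => eps (xbracket _ B) : K^o) (h := fun=> 0) hB) => [||w].
- exact/lin_eps/lin_xbracketr/lin_id.
- exact: lin_cst0.
rewrite sum_const1 => e.
have wtm (z : seq (letter D)) : xwt (size z)%:Z (xmono z).
  by rewrite -sum_const1; apply: xgr_mono.
have wb := wt_xbracket (wtm u) (wtm w).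
case: u w e wb => [|i [|j u]] [|k w] e wb; rewrite ?xbracket1l ?xbracket1r ?eps0 //.
- apply: (eps_wt wb); move: b1; rewrite -e; case: w {e wb} => //= l w _; lia.
- by apply: (eps_wt wb); rewrite /=; lia.
Qed.

Variable W : gvect.
Variable psi : vec K W -> vec K D.
Hypothesis lpsi : linear psi.
Local Notation q := (fun i : letter W => psi (delta_mx 0 i)).
Hypothesis ppsi : forall i, vpar (par i) (q i).

Lemma swaps_xiter Q : swaps (fun w => xiter Q (map q w)).
Proof.
move=> a i j b; rewrite !map_cat !xiter_cat /= (gen_swap _ (@ppsi j) (@ppsi i)) xiterZ.
by rewrite andbC.
Qed.

Lemma hpar_xiter t T w : xhpar t T -> xhpar (t (+) wpar w) (xiter T (map q w)).
Proof.
move=> hT; have := gr_xiter (q := q) (g := @par D) (gq := @par W) (c := false) (w := w) _ _ hT.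
rewrite wparE (eq_bigr (@par W)); last by move=> i _; rewrite subr0.
apply=> [j|i]; first by rewrite par_dl; case: (par j).
exact: xhpar_gen.
Qed.

Lemma xiter_gen_comm (p : bool) Q v w : vpar p v ->
  xbracket (xiter Q (map q w)) (xgen v) =
    sgnb K (wpar w && p) *: xiter (xbracket Q (xgen v)) (map q w).
Proof.
move=> hv; elim: w Q => [|i w IH] Q /=; first by rewrite scale1r.
rewrite IH (gen_swap _ (@ppsi i) hv) xiterZ scalerA -sgnbD.
congr (sgnb _ _ *: _); bools.
Qed.

(** Iterated Jacobi identity: each vector goes to [T] (bit true) or to [Q]. The sign is that of the
    split, times the sign for moving the vectors meant for [Q] across [T] and the vectors it has
    absorbed. *)
Lemma xiter_bracket (t : bool) Q T w : xhpar t T ->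
  xiter (xbracket Q T) (map q w) = \sum_(m <- splits (size w))
    sgnb K (split_sign m w (+) (wpar (mask (map negb m) w) && (t (+) wpar (mask m w)))) *:
      xbracket (xiter Q (map q (mask (map negb m) w))) (xiter T (map q (mask m w))).
Proof.
elim: w t Q T => [|i w IH] t Q T hT.
  by rewrite /= big_seq1 /= scale1r.
rewrite [LHS]/= (jacobi_gen _ hT (@ppsi i)) xiterD xiterZ.
have hTi : xhpar (t (+) par i) (xbracket T (xgen (q i))).
  exact: xhpar_xbracket hT (xhpar_gen (@ppsi i)).
rewrite (IH _ _ _ hTi) (IH _ _ _ hT) [RHS]/= big_cat !big_map /= scaler_sumr.
congr (_ + _); apply: eq_bigr => m _.
  by congr (sgnb _ _ *: _); case: (split_sign m w); bools.
by rewrite scalerA -sgnbD; congr (sgnb _ _ *: _); case: (split_sign m w); bools.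
Qed.

(** The map [psi] carries vectors of [W] into the double, so that one adjunction serves both
    directions: [psi] is the identity for the double of a bialgebra, and the inverse of [phi] for a
    Manin triple. *)
Definition pairing (Q : ext) (x : {malg K[nword W]}) : K :=
  ext_lin (fun w : nword W => eps (xiter Q (map q w)) : K^o) x.

Lemma lin_pairing Q : linear (fun x => pairing Q x : K^o).
Proof. exact: lin_ext. Qed.

Lemma pairing_mono Q w : pairing Q (mono w) = eps (xiter Q (map q w)).
Proof.
apply: (ext_lin_mono (F := fun w => eps (xiter Q (map q w)) : K^o)).
by apply: (swaps_lin (f := fun x => eps x : K^o)) (swaps_xiter Q); exact/lin_eps/lin_id.
Qed.

Lemma lin_pairingl (E : lmodType K) (f : E -> ext) x :
  linear f -> linear (fun Q => pairing (f Q) x : K^o).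
Proof.
by move=> lf; apply: lin_sum => w; apply: lin_scale; apply/lin_eps/lin_xiter.
Qed.

Lemma pairing_gen Q v w :
  pairing Q (wedge (gen v) (mono w)) = eps (xiter (xbracket Q (xgen (psi v))) (map q w)).
Proof.
have lf : linear (fun v => pairing Q (wedge (gen v) (mono w)) : K^o).
  apply: lin_comp (lin_pairing Q) _; apply/lin_wedgel/lin_gen/lin_id.
have lg : linear (fun v => eps (xiter (xbracket Q (xgen (psi v))) (map q w)) : K^o).
  exact/lin_eps/lin_xiter/lin_xbracketr/lin_xgen.
rewrite [v]row_sum_delta (lin_sumf lf) (lin_sumf lg); apply: eq_bigr => i _.
rewrite (linZ lf) (linZ lg).
apply: (congr1 (fun z : K^o => v 0 i *: z)).
by rewrite gen_delta wedge_mono pairing_mono.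
Qed.

Lemma coder_wordE k (f : {malg K[nword W]} -> vec K W) w :
  coder_word k f w = \sum_(m <- splits (size w) | count id m == k)
    sgnb K (split_sign m w) *: wedge (gen (f (mono (mask m w)))) (mono (mask (map negb m) w)).
Proof.
rewrite /coder_word; case: leqP => kw.
  exact: (sum_unshuffle (fun u v => wedge (gen (f (mono u))) (mono v)) kw).
rewrite big_seq_cond big_pred0 // => m; rewrite mem_splits; apply/negbTE.
apply/negP => /andP[/eqP sm /eqP cm]; have := count_size id m.
by rewrite cm sm leqNgt kw.
Qed.

(* The bracket with T is adjoint to the coderivation whose n-ary part is
   [v_1, ..., v_n |-> [...[T, v_1], ..., v_n]]: in weight 0 only the terms of
   [xiter_bracket] pairing two vectors survive. *)
Lemma pairing_coder k (f : {malg K[nword W]} -> vec K W) T : xhpar true T ->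
  xwt k.+1%:Z T ->
  (forall u, size u = k -> xiter T (map q u) = xgen (psi (f (mono u)))) ->
  forall Q w, eps (xiter (xbracket Q T) (map q w)) = pairing Q (coder_word k f w).
Proof.
move=> hT wT fT Q w; rewrite (xiter_bracket _ _ hT) coder_wordE eps_sum.
rewrite (lin_sumf (lin_pairing Q)) [RHS]big_mkcond big_seq [RHS]big_seq.
apply: eq_bigr => m; rewrite mem_splits => /eqP sm; rewrite epsZ.
(* [T] has weight k + 1, so it is left with weight 1 exactly when it receives [k] vectors; this
   selects the k-unshuffles. *)
case: eqP => [cm|cm]; last first.
  rewrite (eps_bracket_wt _ (wt_xiter wT)) ?mulr0 // size_map size_mask //.
  by apply/eqP => e; apply: cm; lia.
rewrite (linZ (lin_pairing Q)) pairing_gen.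
have hv : xhpar (true (+) wpar (mask m w)) (xiter T (map q (mask m w))).
  exact: hpar_xiter.
have e := fT (mask m w); rewrite size_mask // in e; rewrite (e cm) in hv *.
rewrite (xiter_gen_comm _ _ (vpar_gen hv)) epsZ mulrA -sgnbD.
by congr (sgnb _ _ * _); case: (split_sign m w); bools.
Qed.

End Pairing.

(** * Euler's identity *)

Section Euler.
Variables (K : numFieldType) (V : gvect).
Local Notation D := (dbl V).
Local Notation ext := (xext K D).
Local Notation xmono := (@xmono K D).
Local Notation xwedge := (@xwedge K D).
Local Notation xbracket := (@xbracket K V).
Local Notation xgen := (@xgen K D).
Local Notation xwt := (xgr (fun _ : letter D => 1 : int)).
Local Notation d j := (dpair K (dl j) j).
Implicit Types (i j : letter D) (u v w : seq (letter D)).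

Definition dvec : letter D -> vec K D := fun i => delta_mx 0 i.

Lemma vpar_dvec i : vpar (par i) (dvec i).
Proof.
by move=> j; rewrite /dvec mxE eqxx /=; have [-> //|_] := eqVneq j i; rewrite eqxx.
Qed.

Lemma xgen_dvec i : xgen (dvec i) = xmono [:: i].
Proof. exact: xgen_delta. Qed.

Lemma sum_dpair (E : lmodType K) i (F : letter D -> E) :
  \sum_j (dpair K i j) *: F j = dpair K i (dl i) *: F (dl i).
Proof.
rewrite (bigD1 (dl i)) //= big1 ?addr0 // => j ji.
rewrite dpair_neq ?scale0r //; apply: contraNneq ji => ->; by rewrite dlK.
Qed.

(** Up to the scalar [d j], bracketing with [e_j] is the derivative in the letter [dl j];
    multiplying back by that letter and summing counts the letters of a monomial. *)
Lemma euler n R : xwt n%:Z R ->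
  \sum_j (d j)^-1 *: xwedge (xbracket R (xmono [:: j])) (xmono [:: dl j]) = n%:R *: R.
Proof.
have lE : linear (fun R =>
    \sum_j (d j)^-1 *: xwedge (xbracket R (xmono [:: j])) (xmono [:: dl j])).
  by apply: lin_sum => j; apply/lin_scale/lin_xwedgel/lin_xbracketl/lin_id.
move=> wR; apply: (xgr_eq_linear wR lE (lin_scale _ (@lin_id _ _))) => u.
rewrite sum_const1 => -[<-] {n R wR}; elim: u => [|i u IH].
  by rewrite big1 ?scale0r // => j _; rewrite xbracket1l xwedge0l scaler0.
rewrite [xmono (i :: u)]xmono_cons -[(size (i :: u))%:R]natr1 scalerDl scale1r.
rewrite -xwedgeZr -IH.
rewrite (eq_bigr (fun j =>
    xwedge (xmono [:: i]) ((d j)^-1 *: xwedge (xbracket (xmono u) (xmono [:: j])) (xmono [:: dl j]))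
    + dpair K i j *: (((d j)^-1 * sgnb K (wpar u && par j)) *: xwedge (xmono u) (xmono [:: dl j])))).
  rewrite big_split /= sum_dpair dlK; congr (_ + _).
    by rewrite (lin_sumf (lin_xwedger _ (@lin_id _ _))).
  rewrite scalerA mulrA mulfV; last by have := dpair_dl K (dl i); rewrite dlK.
  rewrite mul1r par_dl (xwedgeC (@xhpar_mono K _ u) (@xhpar_mono1 K _ i)).
  by rewrite scalerA sgnbK scale1r.
move=> j _.
rewrite (xbracketMl _ (@xhpar_mono K _ u) (@xhpar_mono1 K _ j)) xwedgeDl scalerDr.
rewrite xwedgeZr xwedgeA; congr (_ + _).
rewrite xbracket_letters !xwedgeZl xwedge1l !scalerA; congr (_ *: _).
by rewrite mulrA mulrC.
Qed.

Lemma wt_xbracket_letter n R j : xwt n.+1%:Z R -> xwt n%:Z (xbracket R (xmono [:: j])).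
Proof.
move=> wR; have := wt_xbracket wR (@xgr_mono K D _ (fun=> 1 : int) [:: j]).
by rewrite big_seq1 (_ : n.+1%:Z + 1 - 2 = n%:Z) //; lia.
Qed.

(** By Euler's identity an element of positive weight is determined by its brackets with letters,
    because the weight is invertible in [K]; induction on the weight. *)
Lemma eps_nondeg n R : xwt n%:Z R ->
  (forall w, size w = n -> eps (xiter R (map dvec w)) = 0) -> R = 0.
Proof.
elim: n R => [|n IH] R wR H.
  by rewrite (wt0P wR) (H [::] erefl) scale0r.
have := euler wR; rewrite big1 => [/esym/eqP|j _].
  by rewrite scaler_eq0 pnatr_eq0 /= => /eqP.
rewrite [xbracket _ _]IH ?xwedge0l ?scaler0 //; first exact: wt_xbracket_letter.
by move=> w sw; rewrite -xgen_dvec; apply: (H (j :: w)); rewrite /= sw.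
Qed.

(* By Euler's identity, the element pairing with words of length n as the
   functional c does. *)
Fixpoint represent (n : nat) (c : seq (letter D) -> K) : ext :=
  if n is n'.+1 then n%:R^-1 *: \sum_j (d j)^-1 *:
    xwedge (represent n' (fun w => c (j :: w))) (xmono [:: dl j])
  else c [::] *: xmono [::].

Lemma eq_represent n c c' : c =1 c' -> represent n c = represent n c'.
Proof.
elim: n c c' => [|n IH] c c' e /=; first by rewrite e.
by congr (_ *: _); apply: eq_bigr => j _; rewrite (IH _ (fun w => c' (j :: w))).
Qed.

Lemma represent_scale n a c : represent n (fun w => a * c w) = a *: represent n c.
Proof.
elim: n c => [|n IH] c /=; first by rewrite scalerA.
rewrite scalerA mulrC -scalerA; congr (_ *: _); rewrite scaler_sumr.
by apply: eq_bigr => j _; rewrite IH xwedgeZl !scalerA mulrC.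
Qed.

Lemma swaps_tail (c : seq (letter D) -> K^o) j :
  swaps c -> swaps (fun w => c (j :: w) : K^o).
Proof. by move=> sc a i k b; apply: (sc (j :: a)). Qed.

Lemma represent_bracketS n c i :
  xbracket (represent n.+1 c) (xmono [:: i]) = n.+1%:R^-1 *:
    (represent n (fun w => c (i :: w)) + \sum_j (d j)^-1 *: (sgnb K (par j && par i) *:
       xwedge (xbracket (represent n (fun w => c (j :: w))) (xmono [:: i])) (xmono [:: dl j]))).
Proof.
rewrite [represent n.+1 c]/= -/represent xbracketZl; congr (_ *: _).
rewrite (lin_sumf (lin_xbracketl _ (@lin_id _ _))).
pose F j := (d j)^-1 *: represent n (fun w => c (j :: w)).
transitivity (\sum_j (dpair K (dl j) i *: F j + (d j)^-1 *: (sgnb K (par j && par i) *: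
   xwedge (xbracket (represent n (fun w => c (j :: w))) (xmono [:: i])) (xmono [:: dl j])))).
  apply: eq_bigr => j _.
  rewrite xbracketZl (xbracketMl _ (@xhpar_mono1 K _ (dl j)) (@xhpar_mono1 K _ i)).
  rewrite par_dl scalerDr xbracket_letters xwedgeZr xwedge1r; congr (_ + _).
  by rewrite /F !scalerA mulrC.
rewrite big_split /=; congr (_ + _).
rewrite (bigD1 i) //= big1 ?addr0 => [|j ji].
  by rewrite /F scalerA mulfV ?dpair_dl // scale1r.
by rewrite dpair_neq ?scale0r // (inj_eq (can_inj (@dlK V))).
Qed.

Lemma represent_bracket n (c : seq (letter D) -> K^o) i : swaps c ->
  xbracket (represent n.+1 c) (xmono [:: i]) = represent n (fun w => c (i :: w)).
Proof.
elim: n c i => [|n IH] c i sc; rewrite represent_bracketS.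
  rewrite invr1 scale1r big1 ?addr0 // => j _.
  by rewrite /= xbracketZl xbracket1l scaler0 xwedge0l !scaler0.
(* By induction and the symmetry of [c], this sum is n + 1 copies of the desired element; the
   pairing term supplies one more, and the prefactor divides by n + 2. *)
have -> : \sum_j (d j)^-1 *: (sgnb K (par j && par i) *:
    xwedge (xbracket (represent n.+1 (fun w => c (j :: w))) (xmono [:: i])) (xmono [:: dl j]))
  = n.+1%:R *: represent n.+1 (fun w => c (i :: w)).
  rewrite [represent n.+1 _]/= -/represent scalerA mulfV ?pnatr_eq0 // scale1r.
  apply: eq_bigr => j _; rewrite IH; last exact: swaps_tail.
  rewrite -xwedgeZl -represent_scale; congr (_ *: xwedge _ _).
  by apply: eq_represent => w; rewrite [RHS](sc [::] j i w).
rewrite -[X in X + _]scale1r -scalerDl nat1r scalerA mulVf ?scale1r //.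
by rewrite pnatr_eq0.
Qed.

Lemma represent_iter (c : seq (letter D) -> K^o) w : swaps c ->
  eps (xiter (represent (size w) c) (map dvec w)) = c w.
Proof.
elim: w c => [|i w IH] c sc; first by rewrite /= epsZ eps_mono mulr1.
by rewrite /= xgen_dvec represent_bracket // (IH _ (swaps_tail i sc)).
Qed.

(** Each letter [j] of a word enters the representing element as [dl j], of degree [e - g j], whence
    [e *+ n - a]. *)
Lemma gr_represent (G : zmodType) (g : letter D -> G) (e a : G) n c :
  (forall j, g (dl j) + g j = e) ->
  (forall w, size w = n -> c w != 0 -> \sum_(i <- w) g i = a) ->
  xgr g (e *+ n - a) (represent n c).
Proof.
move=> ge; elim: n a c => [|n IH] a c hc.
  have [c0|c0] := eqVneq (c [::]) 0; first by rewrite /= c0 scale0r; apply: xgr0.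
  rewrite -(hc [::]) // big_nil subr0 mulr0n; apply: xgrZ.
  by have := @xgr_mono K D _ g [::]; rewrite big_nil.
apply/xgrZ/xgr_sum => j _; apply: xgrZ.
have -> : e *+ n.+1 - a = (e *+ n - (a - g j)) + g (dl j).
  by rewrite mulrSr opprB -{2}(ge j) -!addrA; congr (_ + _); rewrite addrC -addrA.
apply: xgr_wedge; last by have := @xgr_mono K D _ g [:: dl j]; rewrite big_seq1.
apply: IH => w sw cw; have := hc (j :: w); rewrite /= sw => /(_ erefl cw) <-.
by rewrite big_cons addrC addKr.
Qed.

Lemma wt_represent n c : xwt n%:Z (represent n c).
Proof.
have := @gr_represent int (fun=> 1) 2 n%:Z n c.
rewrite (_ : 2 *+ n - n%:Z = n%:Z); last by lia.
by apply=> // w <- _; rewrite sum_const1.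
Qed.

(** The coefficient at a normal word [w0] is itself a functional with the symmetry [swaps], so it is
    the pairing with an element given by [represent]; an [x] orthogonal to everything has no nonzero
    coefficient. *)
Lemma pairing_nondeg (x : {malg K[nword D]}) :
  (forall Q, pairing id Q x = 0) -> x = 0.
Proof.
move=> H; apply/malgP => w0; rewrite mcoeff0.
pose c (w : seq (letter D)) : K^o := (mono w)@_w0.
have lw0 : linear (fun x : {malg K[nword D]} => x@_w0 : K^o).
  by move=> b y z; rewrite mcoeffD mcoeffZ.
have sc : swaps c by apply: (swaps_lin lw0 (@mono_swap K D)).
pose T := represent (size w0) c.
rewrite -(H T); apply: (eq_linear_ext (f := fun x => x@_w0 : K^o)
  (g := fun x => pairing id T x : K^o) lw0 (lin_pairing _ _)) => w.
rewrite (pairing_mono (psi := id) vpar_dvec).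
have [e|ne] := eqVneq (size w) (size w0).
  by rewrite /T -e [RHS](represent_iter _ sc).
rewrite (eps_wt (wt_xiter (@wt_represent _ _))); last first.
  by rewrite size_map subr_eq0 eqz_nat eq_sym.
by rewrite monoU mcoeffU; case: eqP => // e; rewrite e eqxx in ne.
Qed.

End Euler.

(** * The square of a coderivation *)

(** The square is cut into antidiagonals [k + k' = a + 1]; those with [a < M] cover the pairs with
    [k + k' <= M], and [F] vanishes on the others. *)
Lemma big_nat_convolution (E : nmodType) (M : nat) (F : nat -> nat -> E) :
  (forall k k', (1 <= k)%N -> (1 <= k')%N -> (M < k + k')%N -> F k k' = 0) ->
  \sum_(1 <= k < M) \sum_(1 <= k' < M) F k k' =
  \sum_(1 <= a < M) \sum_(1 <= k < a.+1) F k (a.+1 - k)%N.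
Proof.
move=> F0.
transitivity (\sum_(1 <= k < M) \sum_(1 <= a < M) if (k <= a)%N then F k (a.+1 - k)%N else 0).
  apply: eq_big_nat => k /andP[k1 kM].
  rewrite -big_mkcond -[RHS](@big_nat_widenl _ _ _ k 1 M predT) //.
  have kE : (1 + k.-1)%N = k by lia.
  have -> : \sum_(k <= a < M) F k (a.+1 - k)%N = \sum_(1 <= k' < M - k.-1) F k k'.
    rewrite -{1}kE big_addn; apply: eq_big_nat => k' _; congr (F _ _); lia.
  rewrite (@big_cat_nat _ _ _ (M - k.-1)%N 1 M) /=; [|lia..].
  rewrite [X in _ + X]big_nat_cond [X in _ + X]big1 ?addr0; last first.
    by move=> k' /andP[/andP[h1 h2] _]; apply: F0; lia.
  by [].
rewrite exchange_big_nat; apply: eq_big_nat => a /andP[a1 aM].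
rewrite -big_mkcond [RHS](@big_nat_widen _ _ _ 1 a.+1 M predT) //.
Qed.

Section Square.
Variables (K : numFieldType) (V : gvect).
Local Notation D := (dbl V).
Local Notation ext := (xext K D).
Local Notation xmono := (@xmono K D).
Local Notation xwedge := (@xwedge K D).
Local Notation xbracket := (@xbracket K V).
Local Notation xgen := (@xgen K D).
Local Notation xwt := (xgr (fun _ : letter D => 1 : int)).

Definition ndual (i : letter D) : int := (is_dual i : nat)%:Z.
Definition nprim (i : letter D) : int := (~~ is_dual i : nat)%:Z.

Lemma ndual_dl j : ndual (dl j) + ndual j = 1.
Proof. by rewrite /ndual is_dual_dl; case: is_dual. Qed.
Lemma nprim_dl j : nprim (dl j) + nprim j = 1.
Proof. by rewrite /nprim is_dual_dl; case: is_dual. Qed.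

Variable t : nat -> nat -> ext.
Hypothesis t_par : forall k l, (1 <= k)%N -> (1 <= l)%N -> xhpar true (t k l).
Hypothesis t_wt : forall k l, (1 <= k)%N -> (1 <= l)%N -> xwt (k + l)%:Z (t k l).
Hypothesis t_dual : forall k l, (1 <= k)%N -> (1 <= l)%N -> xgr ndual k%:Z (t k l).
Hypothesis t_prim : forall k l, (1 <= k)%N -> (1 <= l)%N -> xgr nprim l%:Z (t k l).

(** The part of T of weight n + 1, which governs the n-bracket. *)
Definition tsum n := \sum_(1 <= k < n.+1) t k (n.+1 - k).

Definition tsquare (a b : nat) :=
  \sum_(1 <= k < a.+1) \sum_(1 <= l < b.+1) xbracket (t k l) (t (a.+1 - k) (b.+1 - l)).

(** A finite stand-in for T that contains every [t k l] with [k + l <= M], hence all that words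
    shorter than [M] can detect. *)
Definition ttrunc M := \sum_(1 <= k < M) \sum_(1 <= l < M) t k l.

Lemma xgr_sum_nat (G : zmodType) (g : letter D -> G) a m n (F : nat -> ext) :
  (forall k, (m <= k < n)%N -> xgr g a (F k)) -> xgr g a (\sum_(m <= k < n) F k).
Proof. by move=> H; rewrite big_nat_cond; apply: xgr_sum => k /andP[/H]. Qed.

Lemma ttrunc_par M : xhpar true (ttrunc M).
Proof.
by apply: xgr_sum_nat => k /andP[k1 _]; apply: xgr_sum_nat => l /andP[l1 _]; apply: t_par.
Qed.

Lemma tsum_par n : xhpar true (tsum n).
Proof. by apply: xgr_sum_nat => k kn; apply: t_par; lia. Qed.

Lemma tsum_wt n : xwt n.+1%:Z (tsum n).
Proof.
apply: xgr_sum_nat => k kn.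
by have := @t_wt k (n.+1 - k); rewrite (_ : k + _ = n.+1)%N; [apply; lia|lia].
Qed.

Lemma linear_ttrunc (E : lmodType K) (e : ext -> E) M : linear e ->
  (forall k l, (1 <= k)%N -> (1 <= l)%N -> (M < k + l)%N -> e (t k l) = 0) ->
  e (ttrunc M) = \sum_(1 <= n < M) e (tsum n).
Proof.
move=> le e0; rewrite /ttrunc (lin_sumf le).
rewrite (eq_bigr (fun k => \sum_(1 <= l < M) e (t k l))); last first.
  by move=> k _; rewrite (lin_sumf le).
rewrite big_nat_convolution //; apply: eq_bigr => a _.
by rewrite /tsum (lin_sumf le).
Qed.

(** Two convolutions, one in each index. The truncation leaves the components of [T, T] near its
    edge incomplete, and [e] must vanish on exactly those products. *)
Lemma linear_tsquare (E : lmodType K) (e : ext -> E) M : linear e ->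
  (forall k l k' l', (1 <= k)%N -> (1 <= l)%N -> (1 <= k')%N -> (1 <= l')%N ->
     (M < k + k')%N || (M < l + l')%N -> e (xbracket (t k l) (t k' l')) = 0) ->
  e (xbracket (ttrunc M) (ttrunc M)) =
  \sum_(1 <= a < M) \sum_(1 <= b < M) e (tsquare a b).
Proof.
move=> le e0.
transitivity (\sum_(1 <= k < M) \sum_(1 <= k' < M) \sum_(1 <= l < M) \sum_(1 <= l' < M)
    e (xbracket (t k l) (t k' l'))).
  rewrite {1}/ttrunc (lin_sumf (lin_comp le (lin_xbracketl _ (@lin_id _ _)))).
  apply: eq_bigr => k _.
  rewrite (lin_sumf (lin_comp le (lin_xbracketl _ (@lin_id _ _)))) exchange_big /=.
  apply: eq_bigr => l _; rewrite /ttrunc.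
  rewrite (lin_sumf (lin_comp le (lin_xbracketr _ (@lin_id _ _)))).
  by apply: eq_bigr => k' _; rewrite (lin_sumf (lin_comp le (lin_xbracketr _ (@lin_id _ _)))).
transitivity (\sum_(1 <= a < M) \sum_(1 <= k < a.+1) \sum_(1 <= l < M) \sum_(1 <= l' < M)
    e (xbracket (t k l) (t (a.+1 - k) l'))).
  apply: big_nat_convolution => k k' k1 k'1 kk.
  rewrite big_nat_cond big1 // => l /andP[/andP[l1 _] _].
  rewrite big_nat_cond big1 // => l' /andP[/andP[l'1 _] _].
  by apply: e0; rewrite ?kk.
apply: eq_big_nat => a /andP[a1 aM].
transitivity (\sum_(1 <= k < a.+1) \sum_(1 <= b < M) \sum_(1 <= l < b.+1)
    e (xbracket (t k l) (t (a.+1 - k) (b.+1 - l)))).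
  apply: eq_big_nat => k /andP[k1 ka].
  apply: big_nat_convolution => l l' l1 l'1 ll.
  by apply: e0; rewrite ?ll ?orbT //; lia.
rewrite exchange_big /=; apply: eq_bigr => b _.
rewrite /tsquare (lin_sumf le); apply: eq_bigr => k _.
by rewrite (lin_sumf le).
Qed.

Variables (W : gvect) (psi : vec K W -> vec K D) (f : nat -> {malg K[nword W]} -> vec K W).
Hypothesis lpsi : linear psi.
Local Notation q := (fun i : letter W => psi (delta_mx 0 i)).
Hypothesis ppsi : forall i, vpar (par i) (q i).
Hypothesis ft : forall n u, (1 <= n)%N -> size u = n ->
  xiter (tsum n) (map q u) = xgen (psi (f n (mono u))).

Definition size_le N (x : {malg K[nword W]}) :=
  forall w : nword W, w \in msupp x -> (size w <= N)%N.

(** [X] starts too heavy to be brought down to weight 1, even if it absorbs every letter of [w]. *)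
Lemma eps_iter_bracket_large (p : bool) a Q X w : xhpar p X -> xwt a%:Z X ->
  ((size w).+1 < a)%N -> eps (xiter (xbracket Q X) (map q w)) = 0.
Proof.
move=> hX wX aw; rewrite (xiter_bracket ppsi _ _ hX) eps_sum big_seq.
apply: big1 => m; rewrite mem_splits => /eqP sm; rewrite epsZ.
rewrite (eps_bracket_wt _ (wt_xiter wX)) ?mulr0 // size_map size_mask //.
by have := count_size id m; rewrite sm; lia.
Qed.

Lemma pairing_coder_sum N Q (w : nword W) : (size w <= N)%N ->
  pairing psi Q (coder_sum f (mono w)) = pairing psi (xbracket Q (ttrunc N.+1)) (mono w).
Proof.
move=> wN; rewrite pairing_mono //.
pose e X : K^o := eps (xiter (xbracket Q X) (map q w)).
have le : linear e by exact/lin_eps/lin_xiter/lin_xbracketr/lin_id.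
rewrite -[RHS]/(e (ttrunc N.+1)) linear_ttrunc //; last first.
  move=> k l k1 l1 kl; apply: (eps_iter_bracket_large _ (t_par k1 l1) (t_wt k1 l1)); lia.
rewrite monoU /coder_sum ext_linU (lin_sumf (lin_pairing _ _)).
have eE k : (1 <= k)%N -> e (tsum k) = pairing psi Q (coder_word k (f k) w).
  move=> k1; apply: (pairing_coder lpsi ppsi (@tsum_par k) (@tsum_wt k)) => u su.
  exact: ft.
(* The truncation runs up to N while [coder_sum] stops at the length of the word; in the excess
   terms [coder_word] is zero by definition. *)
rewrite [RHS](@big_cat_nat _ _ _ (size w).+1) //= [X in _ = _ + X]big_nat_cond.
rewrite [X in _ = _ + X]big1 ?addr0 => [|k /andP[/andP[wk kN] _]].
  by apply: eq_big_nat => k /andP[k1 _]; rewrite eE.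
rewrite eE; last by case: (k) wk.
by rewrite /coder_word leqNgt wk /= (lin0 (lin_pairing psi Q)).
Qed.

Lemma size_le0 N : size_le N 0.
Proof. by move=> w; rewrite msupp0. Qed.
Lemma size_leD N x y : size_le N x -> size_le N y -> size_le N (x + y).
Proof.
by move=> gx gy w /(fsubsetP (msuppD_le x y)); rewrite in_fsetU => /orP[/gx|/gy].
Qed.
Lemma size_leZ N c x : size_le N x -> size_le N (c *: x).
Proof. by move=> gx w /(fsubsetP (msuppZ_le c x))/gx. Qed.
Lemma size_le_sum N I (r : seq I) (P : pred I) (F : I -> {malg K[nword W]}) :
  (forall i, P i -> size_le N (F i)) -> size_le N (\sum_(i <- r | P i) F i).
Proof. by move=> H; elim/big_ind: _ => //; [exact: size_le0|exact: size_leD]. Qed.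

Lemma size_le_coder_word N k w : (1 <= k)%N -> (size w <= N)%N ->
  size_le N (coder_word k (f k) w).
Proof.
move=> k1 wN; rewrite coder_wordE big_seq_cond; apply: size_le_sum => m.
rewrite mem_splits => /andP[/eqP sm /eqP cm]; apply: size_leZ.
have gm : gr (fun=> 1 : int) (1 + (size (mask (map negb m) w))%:Z)
    (wedge (gen (f k (mono (mask m w)))) (mono (mask (map negb m) w)) : {malg K[nword W]}).
  apply: gr_wedge; first exact: gr_gen.
  by rewrite -sum_const1; apply: gr_mono.
move=> v /gm; rewrite sum_const1.
rewrite size_mask ?size_map // count_map.
have := count_predC id m; rewrite -[count (preim _ _) m]/(count (predC id) m) cm sm; lia.
Qed.

(** A k-bracket replaces [k >= 1] letters by one; so the bound that is valid for [x] still holds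
    when the coderivation is applied again. *)
Lemma size_le_coder_sum N x : size_le N x -> size_le N (coder_sum f x).
Proof.
move=> sx; rewrite /coder_sum /ext_lin big_seq; apply: size_le_sum => w /sx wN.
apply: size_leZ; rewrite big_nat_cond; apply: size_le_sum => k /andP[/andP[k1 _] _].
exact: size_le_coder_word.
Qed.

Lemma eq_linear_msupp (E : lmodType K) (g h : {malg K[nword W]} -> E) x :
  linear g -> linear h ->
  (forall w : nword W, w \in msupp x -> g (mono w) = h (mono w)) -> g x = h x.
Proof.
move=> lg lh gh; rewrite [x]malg_mono (lin_sumf lg) (lin_sumf lh).
rewrite big_seq [RHS]big_seq; apply: eq_bigr => w ws.
by rewrite (linZ lg) (linZ lh) gh.
Qed.

Lemma pairing_coder_sum_le N Q x : size_le N x ->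
  pairing psi Q (coder_sum f x) = pairing psi (xbracket Q (ttrunc N.+1)) x.
Proof.
move=> sx.
apply: (eq_linear_msupp (g := fun x => pairing psi Q (coder_sum f x) : K^o)
  (h := fun x => pairing psi (xbracket Q (ttrunc N.+1)) x : K^o)) => [||w /sx wN].
- by apply: lin_comp (lin_pairing psi Q) _; apply: lin_ext.
- exact: lin_pairing.
- exact: pairing_coder_sum.
Qed.

(** The adjunction is used twice with one truncation, then [jacobi_odd] is applied to [T = T']. *)
Lemma pairing_coder_square N Q x : size_le N x ->
  pairing psi Q (coder_sum f (coder_sum f x)) =
    2%:R^-1 * pairing psi (xbracket Q (xbracket (ttrunc N.+1) (ttrunc N.+1))) x.
Proof.
move=> sx; rewrite (pairing_coder_sum_le _ (size_le_coder_sum sx)).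
rewrite (pairing_coder_sum_le _ sx) -(jacobi_odd _ (@ttrunc_par _) (@ttrunc_par _)).
have H (A : ext) : pairing psi (A + A) x = 2%:R * pairing psi A x.
  by rewrite mulr_natl; apply: (linD (lin_pairingl psi x (@lin_id _ ext)) A A).
by rewrite H mulKf // pnatr_eq0.
Qed.

Lemma xgr_xbracket_t (G : zmodType) (g : letter D -> G) (c : G)
    (h : nat -> nat -> G) : (forall j, g (dl j) + g j = c) ->
  (forall k l, (1 <= k)%N -> (1 <= l)%N -> xgr g (h k l) (t k l)) ->
  forall k l k' l', (1 <= k)%N -> (1 <= l)%N -> (1 <= k')%N -> (1 <= l')%N ->
  xgr g (h k l + h k' l' - c) (xbracket (t k l) (t k' l')).
Proof. by move=> gc gt *; apply: xgr_xbracket => //; apply: gt. Qed.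

Lemma wt_bracket_t k l k' l' : (1 <= k)%N -> (1 <= l)%N -> (1 <= k')%N -> (1 <= l')%N ->
  xwt (k + l + k' + l' - 2)%N%:Z (xbracket (t k l) (t k' l')).
Proof.
move=> k1 l1 k'1 l'1.
have := @xgr_xbracket_t _ (fun=> 1 : int) 2 (fun k l => (k + l)%:Z) _ _ k l k' l'.
rewrite (_ : (k + l)%:Z + (k' + l')%:Z - 2 = (k + l + k' + l' - 2)%N%:Z); last by lia.
by apply.
Qed.

Lemma par_bracket_t k l k' l' : (1 <= k)%N -> (1 <= l)%N -> (1 <= k')%N -> (1 <= l')%N ->
  xhpar false (xbracket (t k l) (t k' l')).
Proof. by move=> k1 l1 k'1 l'1; apply: (xhpar_xbracket (t_par k1 l1) (t_par k'1 l'1)). Qed.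

Lemma coder_square0 : (forall a b, tsquare a b = 0) ->
  forall Q x, pairing psi Q (coder_sum f (coder_sum f x)) = 0.
Proof.
move=> t0 Q x.
pose N := \max_(w <- msupp x) size w.
have sx : size_le N x by move=> w ws; rewrite /N (big_rem w) //= leq_maxl.
rewrite (pairing_coder_square _ sx).
rewrite (eq_linear_msupp (g := fun x => pairing psi _ x : K^o) (h := fun=> 0)
  (lin_pairing _ _) (@lin_cst0 _ _ _)) ?mulr0 // => w /sx wN.
rewrite pairing_mono //.
pose e X : K^o := eps (xiter (xbracket Q X) (map q w)).
have le : linear e by exact/lin_eps/lin_xiter/lin_xbracketr/lin_id.
rewrite -[LHS]/(e _) linear_tsquare //; last first.
  move=> k l k' l' k1 l1 k'1 l'1 kl.
  apply: (eps_iter_bracket_large _ (par_bracket_t k1 l1 k'1 l'1) (wt_bracket_t k1 l1 k'1 l'1)).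
  by case/orP: kl; lia.
by rewrite big1 // => a _; rewrite big1 // => b _; rewrite t0 (lin0 le).
Qed.

(** Multilinearity and the surjectivity of [psi] pass from images of basis letters of [W] to
    arbitrary vectors of the double. *)
Lemma psi_span R n : (forall v, exists u, v = psi u) ->
  (forall w, size w = n -> eps (xiter R (map q w)) = 0) ->
  forall vs, size vs = n -> eps (xiter R vs) = 0.
Proof.
move=> spsi; elim: n R => [|n IH] R H [|v vs] //= => [_|[svs]].
  exact: (H [::]).
have [u ->] := spsi v; rewrite [u]row_sum_delta (lin_sumf lpsi).
have lF : linear (fun v => eps (xiter (xbracket R (xgen v)) vs) : K^o).
  exact/lin_eps/lin_xiter/lin_xbracketr/lin_xgen/lin_id.
apply: etrans (lin_sumf lF _ _ _ ) _; apply: big1 => j _.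
rewrite (linZ lpsi) (linZ lF) IH ?scaler0 // => w sw.
by apply: (H (j :: w)); rewrite /= sw.
Qed.

Lemma sum_ndual w : \sum_(i <- w) ndual i = (count (@is_dual V) w)%:Z.
Proof.
elim: w => [|i w IH]; first by rewrite big_nil.
by rewrite big_cons IH /= PoszD.
Qed.

Lemma sum_nprim w : \sum_(i <- w) nprim i = (count (predC (@is_dual V)) w)%:Z.
Proof.
elim: w => [|i w IH]; first by rewrite big_nil.
by rewrite big_cons IH /= PoszD.
Qed.

Lemma eps_iter_gr (g : letter D -> int) a X w : (forall j, g (dl j) + g j = 1) ->
  xgr g a X -> a + \sum_(i <- w) g i != (size w)%:Z ->
  eps (xiter X (map (@dvec K V) w)) = 0.
Proof.
move=> g1 gX ne.
have gd i : xgr g (g i) (xgen (dvec K i)).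
  by rewrite xgen_dvec; have := @xgr_mono K D _ g [:: i]; rewrite big_seq1.
have gx := gr_xiter (q := @dvec K V) (w := w) g1 gd gX.
apply: (xgr_eq_linear (f := fun x => eps x : K^o) (h := fun=> 0) gx) => [||u].
- exact/lin_eps/lin_id.
- exact: lin_cst0.
rewrite eps_mono; case: u => // /esym/eqP; rewrite big_nil.
by rewrite sumrB sum_const1 addrA subr_eq0 (negbTE ne).
Qed.

Lemma xgr_tsquare (g : letter D -> int) (h : nat -> nat -> nat) (c r : int) a b :
  (forall j, g (dl j) + g j = c) ->
  (forall k l, (1 <= k)%N -> (1 <= l)%N -> xgr g (h k l)%:Z (t k l)) ->
  (forall k l, (1 <= k)%N -> (1 <= l)%N -> (k <= a)%N -> (l <= b)%N ->
     (h k l)%:Z + (h (a.+1 - k)%N (b.+1 - l)%N)%:Z - c = r) ->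
  xgr g r (tsquare a b).
Proof.
move=> gc gt hr; apply: xgr_sum_nat => k /andP[k1 ka]; apply: xgr_sum_nat => l /andP[l1 lb].
rewrite -(hr k l) //.
by apply: (@xgr_xbracket_t int g c (fun k l => (h k l)%:Z) gc) => //; lia.
Qed.

(** With [Q] a letter [j], the vanishing of [[Q, Y]] on all words becomes, by antisymmetry, the
    vanishing of [Y] on words that begin with [j]. Words of a fixed bidegree then isolate a single
    component of [Y]. *)
Lemma square_of_coder : (forall x, coder_sum f (coder_sum f x) = 0) ->
  (forall v, exists u, v = psi u) -> forall a b, tsquare a b = 0.
Proof.
move=> c0 spsi a b.
case: a => [|a]; first by rewrite /tsquare big_geq.
case: b => [|b]; first by rewrite /tsquare big1 // => k _; rewrite big_geq.
(* [N] is the weight of [tsquare a.+1 b.+1], hence the length of the words that test it; truncating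
   at [N.+1] keeps all of this component. *)
set N := (a.+1 + b.+1)%N; pose Y := xbracket (ttrunc N.+1) (ttrunc N.+1).
have hY : xhpar false Y := xhpar_xbracket (@ttrunc_par N.+1) (@ttrunc_par N.+1).
have H1 Q w : (size w <= N)%N -> eps (xiter (xbracket Q Y) (map q w)) = 0.
  move=> wN; have sw : size_le N (mono w : {malg K[nword W]}).
    by move=> v /(@gr_mono K W _ (fun=> 1 : int)); rewrite !sum_const1 => -[->].
  have /eqP := pairing_coder_square Q sw.
  rewrite c0 (lin0 (lin_pairing psi Q)) eq_sym mulf_eq0 invr_eq0 pnatr_eq0 /=.
  by rewrite pairing_mono // => /eqP.
have H2 Q vs : (size vs <= N)%N -> eps (xiter (xbracket Q Y) vs) = 0.
  by move=> vN; apply: (psi_span spsi (n := size vs)) => // w sw; apply: H1; rewrite sw.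
apply: (@eps_nondeg K V N) => [|w sw].
  apply: (xgr_tsquare (g := fun=> 1) (h := addn) (c := 2)) => // k l k1 l1 ka lb.
  rewrite /N; lia.
have ga : xgr ndual a.+1%:Z (tsquare a.+1 b.+1).
  by apply: (xgr_tsquare (h := fun k _ => k) ndual_dl t_dual) => k l; lia.
have gb : xgr nprim b.+1%:Z (tsquare a.+1 b.+1).
  by apply: (xgr_tsquare (h := fun _ l => l) nprim_dl t_prim) => k l; lia.
have cw : (count (@is_dual V) w + count (predC (@is_dual V)) w = size w)%N := count_predC _ _.
(* A letter of V removes a dual letter and conversely. The component has a + 1 dual letters and b +
   1 others, so only words with a + 1 letters in V and b + 1 in V^* can reduce it to a scalar. *)
have [wa|wa] := eqVneq (count (predC (@is_dual V)) w) a.+1; last first.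
  apply: (eps_iter_gr ndual_dl ga); rewrite sum_ndual; lia.
have [wb|wb] := eqVneq (count (@is_dual V) w) b.+1; last first.
  apply: (eps_iter_gr nprim_dl gb); rewrite sum_nprim; lia.
pose e X : K^o := eps (xiter X (map (@dvec K V) w)).
have le : linear e by exact/lin_eps/lin_xiter/lin_id.
have e0 k l k' l' : (1 <= k)%N -> (1 <= l)%N -> (1 <= k')%N -> (1 <= l')%N ->
    (k + k' != a.+2)%N || (l + l' != b.+2)%N -> e (xbracket (t k l) (t k' l')) = 0.
  move=> k1 l1 k'1 l'1 /orP[ne|ne].
    apply: (eps_iter_gr ndual_dl (@xgr_xbracket_t int ndual 1 (fun k _ => k%:Z) ndual_dl t_dual k l k' l' k1 l1 k'1 l'1)) => //.
    rewrite sum_ndual; lia.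
  apply: (eps_iter_gr nprim_dl (@xgr_xbracket_t int nprim 1 (fun _ l => l%:Z) nprim_dl t_prim k l k' l' k1 l1 k'1 l'1)) => //.
  rewrite sum_nprim; lia.
(* The first letter of [w] plays the part of [Q]. *)
have eY : e Y = 0.
  rewrite /e; case: (w) sw => [|j w'] // [sw'].
  rewrite /= xgen_dvec (xbracketC hY (@xhpar_mono1 K _ j)) -scaleN1r !xiterZ !epsZ.
  by rewrite H2 ?mulr0 // size_map sw'; rewrite /N; lia.
rewrite -[LHS]/(e _) -eY linear_tsquare //; last first.
  move=> k l k' l' k1 l1 k'1 l'1 kl; apply: e0 => //.
  by move: kl; rewrite /N; lia.
have sel M c (F : nat -> K^o) : (1 <= c < M)%N ->
    (forall i, (1 <= i < M)%N -> i != c -> F i = 0) -> \sum_(1 <= i < M) F i = F c.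
  move=> triple_form F0; rewrite (bigD1_seq c) ?mem_index_iota ?iota_uniq //= big_seq_cond big1 ?addr0 //.
  by move=> i /andP[]; rewrite mem_index_iota; apply: F0.
have eS0 a' b' : (a' != a.+1) || (b' != b.+1) -> e (tsquare a' b') = 0.
  move=> ne; rewrite /tsquare (lin_sumf le) big_nat_cond big1 // => k /andP[/andP[k1 ka] _].
  rewrite (lin_sumf le) big_nat_cond big1 // => l /andP[/andP[l1 lb] _].
  by apply: e0 => //; lia.
rewrite (sel _ a.+1); last 2 first.
- by rewrite /N; lia.
- by move=> a' _ ne; rewrite big1 // => b' _; rewrite eS0 // ne.
rewrite (sel _ b.+1) //; first by rewrite /N; lia.
by move=> b' _ ne; rewrite eS0 // ne orbT.
Qed.

End Square.

(** * The double of a bialgebra *)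

Section Action.
Variables (K : numFieldType) (V : gvect).
Local Notation D := (dbl V).
Local Notation ext := (xext K D).
Local Notation xmono := (@xmono K D).
Local Notation xwedge := (@xwedge K D).
Local Notation xbracket := (@xbracket K V).
Local Notation xgen := (@xgen K D).
Local Notation xwt := (xgr (fun _ : letter D => 1 : int)).

Lemma ofX_bl (i : letter D) (w : seq (letter D)) : ofX (xbl K i w) = bracket_letter K i w.
Proof.
elim: w => [|j w IH] /=; first exact: (lin0 (@lin_ofX K D)).
rewrite (linD (@lin_ofX K D)) !(linZ (@lin_ofX K D)).
by rewrite ofX_wedge !ofX_mono IH.
Qed.

Lemma ofX_bw (u w : seq (letter D)) : ofX (xbw K u w) = bracket_word K u w.
Proof.
elim: u => [|i u IH] /=; first exact: (lin0 (@lin_ofX K D)).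
rewrite (linD (@lin_ofX K D)) (linZ (@lin_ofX K D)).
by rewrite !ofX_wedge !ofX_mono IH ofX_bl.
Qed.

Lemma ofX_ext_lin (F : nword D -> ext) (x : {malg K[nword D]}) :
  ofX (ext_lin F x) = ext_lin (fun w => ofX (F w)) x.
Proof.
rewrite /ext_lin (lin_sumf (@lin_ofX K D)).
by apply: eq_bigr => w _; apply: (linZ (@lin_ofX K D)).
Qed.

Lemma ofX_bracket x y : ofX (xbracket x y) = @bracket K V (ofX x) (ofX y).
Proof.
rewrite xbracket.unlock /xlift ofX_ext_lin; apply: eq_ext_lin => u.
by rewrite ofX_ext_lin; apply: eq_ext_lin => w; apply: ofX_bw.
Qed.

Lemma ofX_iter x vs : ofX (xiter x vs) = @iter_bracket K V (ofX x) vs.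
Proof.
elim: vs x => [|v vs IH] x //=; by rewrite IH ofX_bracket ofX_gen.
Qed.

Lemma xproj1E (x : ext) : xproj1 x = proj1 (ofX x).
Proof. by []. Qed.

Lemma gr_xiter_const (G : zmodType) (g : letter D -> G) (a b c : G) x (vs : seq (vec K D)) :
  (forall j, g (dl j) + g j = c) -> xgr g a x ->
  (forall v, v \in vs -> xgr g b (xgen v)) ->
  xgr g (a + (b - c) *+ size vs) (xiter x vs).
Proof.
move=> gc; elim: vs x a => [|v vs IH] x a gx H; first by rewrite addr0.
rewrite mulrS addrA; apply: IH => [|u uv]; last by apply: H; rewrite inE uv orbT.
rewrite addrA; apply: xgr_xbracket => //; apply: H.
exact: mem_head.
Qed.

Variables (W : gvect) (psi : vec K W -> vec K D).
Hypothesis lpsi : linear psi.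
Local Notation q := (fun i : letter W => psi (delta_mx 0 i)).
Hypothesis ppsi : forall i, vpar (par i) (q i).

(** The action behind [pairing], before the scalar part is taken. It turns iterated brackets into
    linear maps on the exterior algebra, as both the n-brackets of the double and the maps [tau]
    require. *)
Definition act (Q : ext) (x : {malg K[nword W]}) : ext :=
  ext_lin (fun w : nword W => xiter Q (map q w)) x.

Lemma lin_act Q : linear (act Q).
Proof. exact: lin_ext. Qed.

Lemma act_mono Q w : act Q (mono w) = xiter Q (map q w).
Proof. exact: (ext_lin_mono (swaps_xiter ppsi Q)). Qed.

Lemma lin_actl (E : lmodType K) (h : E -> ext) x : linear h -> linear (fun Q => act (h Q) x).
Proof. by move=> lh; apply: lin_sum => w; apply/lin_scale/lin_xiter. Qed.

Lemma act_gen Q v (x : {malg K[nword W]}) :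
  act Q (wedge (gen v) x) = act (xbracket Q (xgen (psi v))) x.
Proof.
apply: (eq_linear_ext (f := fun x => act Q (wedge (gen v) x))
  (g := act (xbracket Q (xgen (psi v))))) => [||w].
- by apply: lin_comp (lin_act Q) _; apply/lin_wedger/lin_id.
- exact: lin_act.
have lf : linear (fun v => act Q (wedge (gen v) (mono w))).
  by apply: lin_comp (lin_act Q) _; apply/lin_wedgel/lin_gen/lin_id.
have lg : linear (fun v => act (xbracket Q (xgen (psi v))) (mono w)).
  exact/lin_actl/lin_xbracketr/lin_xgen.
rewrite [v]row_sum_delta (lin_sumf lf) (lin_sumf lg); apply: eq_bigr => i _.
rewrite (linZ lf) (linZ lg) gen_delta wedge_mono !act_mono //.
Qed.

Lemma act_wprod Q (us : seq (vec K W)) : act Q (wprod us) = xiter Q (map psi us).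
Proof.
elim: us Q => [|u us IH] Q; first by rewrite /= act_mono.
by rewrite /= act_gen IH.
Qed.

Lemma gr_act (G : zmodType) (g : letter D -> G) (gq : letter W -> G) (a b c : G) Q
    (x : {malg K[nword W]}) :
  (forall j, g (dl j) + g j = c) -> (forall i, xgr g (gq i) (xgen (q i))) ->
  xgr g a Q -> (forall w : nword W, w \in msupp x -> \sum_(i <- w) (gq i - c) = b) ->
  xgr g (a + b) (act Q x).
Proof.
move=> gc hq gQ hx; rewrite /act /ext_lin big_seq; apply: xgr_sum => w ws.
by apply: xgrZ; rewrite -(hx w ws); apply: gr_xiter.
Qed.

End Action.

(** * The canonical form and the two halves of the double *)

Section DoubleForm.
Variables (K : numFieldType) (V : gvect).
Local Notation D := (dbl V).
Local Notation xbracket := (@xbracket K V).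
Local Notation xgen := (@xgen K D).
Implicit Types (i j : letter D).
Local Notation dform := (@dform K V).

Lemma lin_dforml y : linear (fun x => dform x y : K^o).
Proof.
apply: lin_sum => i; apply: lin_sum => j c x z.
by rewrite !mxE !mulrDl -!mulrA.
Qed.

Lemma lin_dformr x : linear (fun y => dform x y : K^o).
Proof.
apply: lin_sum => i; apply: lin_sum => j c y z.
by rewrite !mxE mulrDr mulrDl -!mulrA mulrCA.
Qed.

Lemma dform_dvec i j : dform (dvec K i) (dvec K j) = dpair K i j.
Proof.
rewrite /dform (bigD1 i) //= (bigD1 j) //= big1 => [|k kj]; last first.
  by rewrite [dvec K j 0 k]mxE eqxx (negbTE kj) mulr0 mul0r.
rewrite big1 => [|k ki]; last first.
  by rewrite big1 // => l _; rewrite [dvec K i 0 k]mxE eqxx (negbTE ki) !mul0r.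
by rewrite !mxE !eqxx !mul1r !addr0.
Qed.

(** Reading the form as a big bracket makes the form applied to an n-bracket one longer iterated
    bracket. *)
Lemma dform_eps u v : dform u v = eps (xbracket (xgen u) (xgen v)).
Proof.
have lf w : linear (fun u => eps (xbracket (xgen u) (xgen w)) : K^o).
  exact/lin_eps/lin_xbracketl/lin_xgen/lin_id.
have lg w : linear (fun v => eps (xbracket (xgen w) (xgen v)) : K^o).
  exact/lin_eps/lin_xbracketr/lin_xgen/lin_id.
rewrite [u]row_sum_delta; apply: etrans (lin_sumf (lin_dforml v) _ _ _) _.
apply: etrans _ (esym (lin_sumf (lf v) _ _ _)); apply: eq_bigr => i _.
rewrite (linZ (lin_dforml v)) (linZ (lf v)); apply: (congr1 (fun z : K^o => u 0 i *: z)).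
rewrite [v]row_sum_delta; apply: etrans (lin_sumf (lin_dformr _) _ _ _) _.
apply: etrans _ (esym (lin_sumf (lg _) _ _ _)); apply: eq_bigr => j _.
rewrite (linZ (lin_dformr _)) (linZ (lg _)); apply: (congr1 (fun z : K^o => v 0 j *: z)).
by rewrite dform_dvec !xgen_delta xbracket_letters epsZ eps_mono mulr1.
Qed.

Lemma dform_subl y : zmod_morphism (fun x => dform x y).
Proof.
move=> a b; have l := lin_dforml y.
by rewrite addrC -scaleN1r l scaleN1r addrC.
Qed.

Lemma dform_subr x : zmod_morphism (dform x).
Proof.
move=> a b; have l := lin_dformr x.
by rewrite addrC -scaleN1r l scaleN1r addrC.
Qed.

Lemma dform_scalel y : scalable_for ( *%R : K -> K -> K) (fun x => dform x y).
Proof. by move=> a b; apply: (linZ (lin_dforml y)). Qed.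

Lemma dform_scaler x : scalable_for ( *%R : K -> K -> K) (dform x).
Proof. by move=> a b; apply: (linZ (lin_dformr x)). Qed.

HB.instance Definition _ := isBilinear.Build K (vec K D) (vec K D) K *%R *%R
  (dform) dform_subl dform_subr dform_scalel dform_scaler.

Definition dform_biscalar : {biscalar vec K D} := dform.

Lemma dpair_sym (i j : letter D) : dpair K i j =
  sgnb K (odd `|gdeg i|%N && odd `|gdeg j|%N) * dpair K j i.
Proof.
have [->|ne] := eqVneq i (dl j).
  rewrite {1}dpairC !parE gdeg_dl odd_abszN !andbb -mulNr; congr (_ * _).
  by rewrite /sgnb; case: odd; rewrite /= ?expr0 ?expr1 ?opprK.
rewrite !dpair_neq ?mulr0 //; apply: contraNneq ne => ->; by rewrite dlK.
Qed.

Lemma dform_sym a b u v : vhom a u -> vhom b v ->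
  dform u v = sgnb K (odd `|a|%N && odd `|b|%N) * dform v u.
Proof.
move=> hu hv; rewrite /dform exchange_big mulr_sumr; apply: eq_bigr => j _.
rewrite mulr_sumr; apply: eq_bigr => i _.
have [->|/hu <-] := eqVneq (u 0 i) 0; first by rewrite !(mul0r, mulr0).
have [->|/hv <-] := eqVneq (v 0 j) 0; first by rewrite !(mul0r, mulr0).
by rewrite dpair_sym [v 0 j * _]mulrC !mulrA; congr (_ * _); rewrite mulrC mulrA.
Qed.

Lemma dform_deg a b u v : vhom a u -> vhom b v -> a + b != 0 -> dform u v = 0.
Proof.
move=> hu hv; apply: contraNeq; rewrite /dform.
apply: contra_neqT => ab; apply: big1 => i _; apply: big1 => j _.
have [->|/hu ea] := eqVneq (u 0 i) 0; first by rewrite !mul0r.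
have [->|/hv eb] := eqVneq (v 0 j) 0; first by rewrite mulr0 mul0r.
rewrite dpair_neq ?mulr0 //; apply: contraNneq ab => e.
by rewrite -ea -eb e gdeg_dl addNr.
Qed.

Lemma dform_nondeg u : (forall v, dform u v = 0) -> u = 0.
Proof.
move=> H; apply/rowP => i; rewrite mxE.
have := H (dvec K (dl i)); rewrite [u in dform u _]row_sum_delta.
move=> h; have {h} := etrans (esym (lin_sumf (lin_dforml _) _ _ _)) h.
rewrite (bigD1 i) //= big1 => [|j ji].
  rewrite addr0 (linZ (lin_dforml _)) dform_dvec => /eqP.
  rewrite [_ == 0]mulf_eq0 => /orP[/eqP //|/eqP h].
  by have := dpair_dl K (dl i); rewrite dlK h eqxx.
rewrite (linZ (lin_dforml _)) dform_dvec dpair_neq ?scaler0 //.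
by rewrite dlK.
Qed.

End DoubleForm.

Section Halves.
Variables (K : numFieldType) (V : gvect).
Local Notation D := (dbl V).

Definition plusV : {vspace vec K D} := lker (linfun (@rsubmx K 1 (gdim V) (gdim V))).
Definition minusV : {vspace vec K D} := lker (linfun (@lsubmx K 1 (gdim V) (gdim V))).

Lemma inVE (v : vec K V) i : inV v 0 i = if split i is inl a then v 0 a else 0.
Proof. by rewrite mxE; case: split => a; rewrite ?mxE. Qed.
Lemma inVdualE (v : vec K V) i : inVdual v 0 i = if split i is inr a then v 0 a else 0.
Proof. by rewrite mxE; case: split => a; rewrite ?mxE. Qed.

Lemma mem_plusV u : u \in plusV <-> exists v, u = inV v.
Proof.
rewrite memv_ker lfunE /=; split=> [/eqP u0|[v ->]].
  by exists (lsubmx u); rewrite /inV -u0 hsubmxK.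
by rewrite /inV row_mxKr.
Qed.

Lemma mem_minusV u : u \in minusV <-> exists v, u = inVdual v.
Proof.
rewrite memv_ker lfunE /=; split=> [/eqP u0|[v ->]].
  by exists (rsubmx u); rewrite /inVdual -u0 hsubmxK.
by rewrite /inVdual row_mxKl.
Qed.

(** Membership as a grading condition: closure under brackets can then be read off from the number
    of dual letters. *)
Lemma plusVP u : u \in plusV <-> forall i, u 0 i != 0 -> ndual i = 0.
Proof.
rewrite mem_plusV; split=> [[v ->] i|H].
  rewrite inVE; case: (dletterP i) => a; rewrite ?(split_lshift, split_rshift) ?eqxx //.
  by rewrite /ndual is_duall.
exists (lsubmx u); apply/rowP => i; rewrite inVE.
case: (dletterP i) => a; rewrite ?(split_lshift, split_rshift) ?mxE //.
have := H (rshift _ a); rewrite /ndual is_dualr.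
by have [//|_ /(_ isT)] := eqVneq (u 0 (rshift _ a)) 0.
Qed.

Lemma minusVP u : u \in minusV <-> forall i, u 0 i != 0 -> nprim i = 0.
Proof.
rewrite mem_minusV; split=> [[v ->] i|H].
  rewrite inVdualE; case: (dletterP i) => a; rewrite ?(split_lshift, split_rshift) ?eqxx //.
  by rewrite /nprim is_dualr.
exists (rsubmx u); apply/rowP => i; rewrite inVdualE.
case: (dletterP i) => a; rewrite ?(split_lshift, split_rshift) ?mxE //.
have := H (lshift _ a); rewrite /nprim is_duall.
by have [//|_ /(_ isT)] := eqVneq (u 0 (lshift _ a)) 0.
Qed.

Lemma plusV_graded : graded_sub plusV.
Proof.
move=> v a /plusVP H; apply/plusVP => i; rewrite mxE.
by case: ifP => _; [apply: H|rewrite eqxx].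
Qed.

Lemma minusV_graded : graded_sub minusV.
Proof.
move=> v a /minusVP H; apply/minusVP => i; rewrite mxE.
by case: ifP => _; [apply: H|rewrite eqxx].
Qed.

Lemma inV_add (u : vec K D) : u = inV (lsubmx u) + inVdual (rsubmx u).
Proof. by rewrite /inV /inVdual add_row_mx addr0 add0r hsubmxK. Qed.

Lemma plus_minus_full : (plusV + minusV = fullv)%VS.
Proof.
apply/eqP; rewrite eqEsubv subvf; apply/subvP => u _; rewrite [u]inV_add.
by apply: memv_add; [apply/mem_plusV|apply/mem_minusV]; eexists.
Qed.

Lemma plus_minus_cap : (plusV :&: minusV = 0)%VS.
Proof.
apply/eqP; rewrite -subv0; apply/subvP => u; rewrite memv_cap memv0.
move=> /andP[/plusVP p /minusVP m]; apply/eqP/rowP => i; rewrite mxE.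
apply/eqP; apply: contraT => ui; move: (p _ ui) (m _ ui); rewrite /ndual /nprim.
by case: is_dual.
Qed.

Lemma dform_plus : isotropic (@dform K V) plusV.
Proof.
move=> u v /plusVP pu /plusVP pv; rewrite /dform big1 // => i _; rewrite big1 // => j _.
have [->|/pu di] := eqVneq (u 0 i) 0; first by rewrite !mul0r.
have [->|/pv dj] := eqVneq (v 0 j) 0; first by rewrite mulr0 mul0r.
rewrite dpair_neq ?mulr0 //; apply/eqP => e.
by have := ndual_dl j; rewrite -e di dj.
Qed.

Lemma dform_minus : isotropic (@dform K V) minusV.
Proof.
move=> u v /minusVP pu /minusVP pv; rewrite /dform big1 // => i _; rewrite big1 // => j _.
have [->|/pu di] := eqVneq (u 0 i) 0; first by rewrite !mul0r.
have [->|/pv dj] := eqVneq (v 0 j) 0; first by rewrite mulr0 mul0r.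
rewrite dpair_neq ?mulr0 //; apply/eqP => e.
by have := nprim_dl j; rewrite -e di dj.
Qed.

End Halves.

Section Double.
Variables (K : numFieldType) (V : gvect).
Local Notation D := (dbl V).
Local Notation ext := (xext K D).
Local Notation xmono := (@xmono K D).
Local Notation xbracket := (@xbracket K V).
Local Notation xgen := (@xgen K D).
Local Notation xwt := (xgr (fun _ : letter D => 1 : int)).
Local Notation idD := (id : vec K D -> vec K D).

Variable t : nat -> nat -> ext.
Hypothesis t_par : forall k l, (1 <= k)%N -> (1 <= l)%N -> xhpar true (t k l).
Hypothesis t_wt : forall k l, (1 <= k)%N -> (1 <= l)%N -> xwt (k + l)%:Z (t k l).
Hypothesis t_dual : forall k l, (1 <= k)%N -> (1 <= l)%N -> xgr (@ndual V) k%:Z (t k l).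
Hypothesis t_prim : forall k l, (1 <= k)%N -> (1 <= l)%N -> xgr (@nprim V) l%:Z (t k l).
Hypothesis t_deg : forall k l, (1 <= k)%N -> (1 <= l)%N ->
  xgr (@gdeg D) (3 - (k + l)%:Z) (t k l).
Hypothesis t_square : forall a b, tsquare t a b = 0.

Definition dlam_fun n (x : {malg K[nword D]}) : vec K D :=
  xproj1 (act idD (tsum t n) x).

Lemma lin_dlam n : linear (dlam_fun n).
Proof. by apply: lin_comp (lin_xproj1 (@lin_id _ _)) _; apply: lin_act. Qed.

HB.instance Definition _ n := GRing.isLinear.Build K {malg K[nword D]} (vec K D) _
  (dlam_fun n) (lin_dlam n).

Definition dlam n : {linear {malg K[nword D]} -> vec K D} := dlam_fun n.

Lemma id_par i : vpar (par i) (idD (delta_mx 0 i)).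
Proof. exact: vpar_dvec. Qed.

Lemma wt_tsum_iter n vs : size vs = n -> xwt 1 (xiter (tsum t n) vs).
Proof.
move=> <-; have := wt_xiter (vs := vs) (@tsum_wt K V t t_wt (size vs)).
by rewrite (_ : (size vs).+1%:Z - (size vs)%:Z = 1) //; lia.
Qed.

Lemma dlam_wprod n (vs : seq (vec K D)) : dlam n (wprod vs) = xproj1 (xiter (tsum t n) vs).
Proof. by rewrite /= /dlam_fun (act_wprod (psi := idD)) ?map_id //; apply: id_par. Qed.

Lemma dlam_iter n u : (1 <= n)%N -> size u = n ->
  xiter (tsum t n) (map (fun i => idD (delta_mx 0 i)) u) = xgen (idD (dlam n (mono u))).
Proof.
move=> _ su; rewrite /= /dlam_fun (act_mono (psi := idD)); last exact: id_par.
by apply: wt1P; apply: wt_tsum_iter; rewrite size_map.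
Qed.

Lemma dlam_square x : coder_sum dlam (coder_sum dlam x) = 0.
Proof.
apply: pairing_nondeg => Q.
by apply: (coder_square0 t_par t_wt (psi := idD)) => //; [exact: id_par|exact: dlam_iter].
Qed.

Lemma tsum_deg n : xgr (@gdeg D) (2 - n%:Z) (tsum t n).
Proof.
apply: xgr_sum_nat => k kn.
have := @t_deg k (n.+1 - k); rewrite (_ : 3 - _ = 2 - n%:Z); last by lia.
by apply; lia.
Qed.

Lemma gdeg_dl_add (j : letter D) : gdeg (dl j) + gdeg j = 0.
Proof. by rewrite gdeg_dl addNr. Qed.

Lemma dlam_deg n a (x : {malg K[nword D]}) : (1 <= n)%N ->
  ext_hom n a x -> vhom (a + (2 - n%:Z)) (dlam n x).
Proof.
move=> _ [_ hx]; rewrite addrC; apply: xgr_proj1.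
apply: (gr_act (psi := idD) (gq := @gdeg D) (c := 0)).
- exact: gdeg_dl_add.
- by move=> i; have := @xgr_mono K D _ (@gdeg D) [:: i]; rewrite big_seq1 xgen_delta.
- exact: tsum_deg.
by move=> w /hx <-; apply: eq_bigr => i _; rewrite subr0.
Qed.

Definition dlinf : linf K D := Linf dlam_deg dlam_square.

(** Each vector of V removes one dual letter, so n of them leave [k - n] in a result of weight 1.
    Since [l = n + 1 - k] is at least 1, this is at most 0, and no dual letter remains. *)
Lemma dlam_plus : linf_sub dlinf (plusV K V).
Proof.
move=> n vs n1 hvs; rewrite /= -[dlam_fun n _]/(dlam n _) dlam_wprod.
rewrite /tsum xiter_sum (lin_sumf (lin_xproj1 (@lin_id _ _))) big_nat_cond.
apply: memv_suml => k /andP[kn _]; apply/plusVP => i ne.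
have k1 : (1 <= k)%N by lia.
have l1 : (1 <= n.+1 - k)%N by lia.
have gx := gr_xiter_const (vs := vs) (@ndual_dl V) (t_dual k1 l1)
  (fun v hv => xgr_gen ((plusVP v).1 (hvs v hv))).
have := xgr_proj1 gx ne; rewrite sub0r mulNrn natz size_tuple /ndual.
by case: is_dual; lia.
Qed.

Lemma dlam_minus : linf_sub dlinf (minusV K V).
Proof.
move=> n vs n1 hvs; rewrite /= -[dlam_fun n _]/(dlam n _) dlam_wprod.
rewrite /tsum xiter_sum (lin_sumf (lin_xproj1 (@lin_id _ _))) big_nat_cond.
apply: memv_suml => k /andP[kn _]; apply/minusVP => i ne.
have k1 : (1 <= k)%N by lia.
have l1 : (1 <= n.+1 - k)%N by lia.
have gx := gr_xiter_const (vs := vs) (@nprim_dl V) (t_prim k1 l1)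
  (fun v hv => xgr_gen ((minusVP v).1 (hvs v hv))).
have := xgr_proj1 gx ne; rewrite sub0r mulNrn natz size_tuple /nprim.
by case: is_dual; lia.
Qed.

Lemma vhom_vpar (U : gvect) a (v : vec K U) : vhom a v -> vpar (odd `|a - 1|%N) v.
Proof. by move=> hv i /hv <-. Qed.

(** Both sides are scalars obtained by bracketing [tsum t n.+1] with n + 2 vectors; they differ by
    an exchange of the last two, which is [gen_swap]. *)
Lemma dlam_invariant n (vs : n.-tuple (vec K D)) a b vn v0 :
  vhom a vn -> vhom b v0 ->
  dform_biscalar K V (dlinf n.+1 (wprod (rcons vs vn))) v0 =
    sgnb K (odd `|a - 1|%N && odd `|b - 1|%N)
      * dform_biscalar K V (dlinf n.+1 (wprod (rcons vs v0))) vn.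
Proof.
move=> /vhom_vpar hn /vhom_vpar h0.
have E v v' : dform (dlam n.+1 (wprod (rcons vs v))) v' =
    eps (xbracket (xbracket (xiter (tsum t n.+1) vs) (xgen v)) (xgen v')).
  rewrite dlam_wprod dform_eps -wt1P ?xiter_rcons //.
  by rewrite -xiter_rcons; apply: wt_tsum_iter; rewrite size_rcons size_tuple.
apply: etrans (E _ _) _; apply: etrans _ (esym (congr1 (fun z => _ * z) (E _ _))).
by rewrite (gen_swap _ hn h0) epsZ.
Qed.

Definition double_triple : manin_triple K D :=
  @ManinTriple K D dlinf (plusV K V) (minusV K V) (dform_biscalar K V)
    (@plusV_graded K V) (@minusV_graded K V) dlam_plus dlam_minus
    (plus_minus_full K V) (plus_minus_cap K V)
    (@dform_deg K V) (@dform_sym K V) (@dform_nondeg K V)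
    (@dform_plus K V) (@dform_minus K V) dlam_invariant.

End Double.

(** A letter has total degree [gdeg - 1]. For a word of [t k l], of degree 3 - (k + l) and length k
    + l, this gives an odd number. *)
Lemma wpar_wdeg (U : gvect) (w : seq (letter U)) :
  wpar w = odd `|wdeg w - (size w)%:Z|%N.
Proof.
rewrite /wdeg; elim: w => [|i w IH]; first by rewrite big_nil.
rewrite wpar_cons IH big_cons /par /=; lia.
Qed.

(** * The Manin triple of a bialgebra *)

Section FromBialgebra.
Variables (K : numFieldType) (V : gvect) (X : linf_bialgebra K V).
Local Notation D := (dbl V).
Local Notation xwt := (xgr (fun _ : letter D => 1 : int)).

Definition bi_elt k l : xext K D := toX (bi_t X k l).

Lemma xgr_toX (G : zmodType) (g : letter D -> G) a (x : {malg K[nword D]}) :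
  gr g a x -> xgr g a (toX x).
Proof. by move=> gx; apply: (eq_ind_r (gr g a) gx (toXK x)). Qed.

Section Gradings.
Variables (k l : nat).
Hypotheses (k1 : (1 <= k)%N) (l1 : (1 <= l)%N).

Lemma bi_elt_dual : xgr (@ndual V) k%:Z (bi_elt k l).
Proof.
apply: xgr_toX => w /(bi_t_bideg k1 l1) [<- _]; exact: sum_ndual.
Qed.

Lemma bi_elt_prim : xgr (@nprim V) l%:Z (bi_elt k l).
Proof.
apply: xgr_toX => w /(bi_t_bideg k1 l1) [_ <-]; exact: sum_nprim.
Qed.

Lemma bi_elt_size (w : nword D) : w \in msupp (bi_t X k l) -> size w = (k + l)%N.
Proof. by move=> /(bi_t_bideg k1 l1) [<- <-]; rewrite count_predC. Qed.

Lemma bi_elt_wt : xwt (k + l)%:Z (bi_elt k l).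
Proof. by apply: xgr_toX => w /bi_elt_size <-; apply: sum_const1. Qed.

Lemma bi_elt_deg : xgr (@gdeg D) (3 - (k + l)%:Z) (bi_elt k l).
Proof. apply: xgr_toX => w /(bi_t_deg k1 l1) e.
by apply: (addIr ((k + l)%:Z - 2)); apply: etrans e _; lia. Qed.

Lemma bi_elt_par : xhpar true (bi_elt k l).
Proof.
apply: xgr_toX => w wt; rewrite -wparE wpar_wdeg (bi_elt_size wt).
have := bi_t_deg k1 l1 wt => e.
by suff : odd `|wdeg w - (k + l)%:Z|%N; [|lia].
Qed.

End Gradings.

Lemma bi_elt_square a b : tsquare bi_elt a b = 0.
Proof.
apply: ofX_inj; apply: etrans _ (esym (lin0 (@lin_ofX K D))).
rewrite -(bi_square X a b) /tsquare (lin_sumf (@lin_ofX K D)).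
apply: eq_bigr => k _; apply: etrans (lin_sumf (@lin_ofX K D) _ _ _) _.
apply: eq_bigr => l _; apply: etrans (ofX_bracket _ _) _.
by apply: congr2; apply: toXK.
Qed.

Lemma bi_elt_iter k l vs : ofX (xiter (bi_elt k l) vs) = iter_bracket (bi_t X k l) vs.
Proof.
by apply: etrans (ofX_iter _ _) _; apply: (congr1 (fun x => iter_bracket x vs)); apply: toXK.
Qed.

Lemma double_bracketE n vs : double_bracket X n vs = xproj1 (xiter (tsum bi_elt n) vs).
Proof.
rewrite xproj1E /double_bracket; apply: congr1; rewrite /tsum xiter_sum.
apply: etrans _ (esym (lin_sumf (@lin_ofX K D) _ _ _)).
by apply: eq_bigr => k _; rewrite bi_elt_iter.
Qed.

Definition bialgebra_triple : manin_triple K D :=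
  double_triple bi_elt_par bi_elt_wt bi_elt_dual bi_elt_prim bi_elt_deg bi_elt_square.

Lemma bialgebra_triple_iso : double_iso X bialgebra_triple \1%VF.
Proof.
split.
- split=> [a v hv||]; first by rewrite id_lfunE.
    by apply/eqP; rewrite -subv0; apply/subvP => u; rewrite memv_ker id_lfunE memv0.
  exact: lim1g.
- by move=> u; rewrite id_lfunE; apply: mem_plusV.
- by move=> u; rewrite id_lfunE; apply: mem_minusV.
- by move=> u v; rewrite !id_lfunE.
move=> n vs n1; rewrite id_lfunE double_bracketE.
rewrite (_ : map _ _ = vs); first exact: dlam_wprod.
by rewrite -[RHS]map_id; apply: eq_map => v; rewrite id_lfunE.
Qed.

End FromBialgebra.

(** * Homogeneous bases and dual bases *)

Section Homogeneous.
Variables (K : numFieldType).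

Definition comp (W : gvect) (a : int) (v : vec K W) : vec K W :=
  \row_i (if gdeg i == a then v 0 i else 0).

Lemma vhom_comp (W : gvect) a (v : vec K W) : vhom a (comp a v).
Proof. by move=> i; rewrite mxE; case: (gdeg i =P a) => // _; rewrite eqxx. Qed.

Lemma lin_comp_hom (W : gvect) a : linear (@comp W a).
Proof.
by move=> c u v; apply/rowP => i; rewrite !mxE; case: ifP; rewrite ?mulr0 ?addr0.
Qed.

Lemma comp_vhom (W : gvect) a b (v : vec K W) : vhom a v -> comp b v = if a == b then v else 0.
Proof.
move=> hv; apply/rowP => i; rewrite mxE.
have [v0|/hv <-] := eqVneq (v 0 i) 0.
  by rewrite v0 if_same; case: ifP; rewrite ?mxE.
by case: ifP; rewrite ?mxE.
Qed.

Definition degrees (W : gvect) : seq int := undup [seq gdeg i | i <- enum 'I_(gdim W)].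

Lemma sum_comp (W : gvect) (v : vec K W) : v = \sum_(a <- degrees W) comp a v.
Proof.
apply/rowP => i; rewrite summxE.
have di : gdeg i \in degrees W by rewrite mem_undup map_f ?mem_enum.
rewrite (bigD1_seq (gdeg i)) ?undup_uniq //= mxE eqxx big1 ?addr0 // => a ai.
by rewrite mxE eq_sym (negbTE ai).
Qed.

Variable W : gvect.

Definition vdeg (v : vec K W) : int := if [pick i | v 0 i != 0] is Some i then gdeg i else 0.

Lemma vhom_vdeg a v : vhom a v -> vhom (vdeg v) v.
Proof.
move=> hv i vi; rewrite /vdeg; case: pickP => [j vj|/(_ i)]; last by rewrite vi.
by rewrite (hv _ vi) (hv _ vj).
Qed.

(** A free homogeneous family that does not span [U] misses some vector, hence one of its
    homogeneous components, which lies in [U] because [U] is graded; adjoin it. The induction bounds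
    the missing dimension by [m]. *)
Lemma homogeneous_basis (U : {vspace vec K W}) : graded_sub U ->
  exists X : seq (vec K W), basis_of U X /\ {in X, forall x, vhom (vdeg x) x}.
Proof.
move=> gU.
suff H m (X : seq (vec K W)) : (\dim U - size X <= m)%N -> free X ->
    {subset X <= U} -> {in X, forall x, vhom (vdeg x) x} ->
    exists X : seq (vec K W), basis_of U X /\ {in X, forall x, vhom (vdeg x) x}.
  by apply: (H (\dim U) [::]); rewrite ?subn0 ?nil_free.
elim: m X => [|m IH] X dX fX sX hX.
  exists X; split=> //; rewrite basisEfree fX /=; apply/andP; split; last by lia.
  by apply/span_subvP.
have [sU|nU] := boolP (U <= <<X>>)%VS.
  exists X; split=> //; rewrite basisEdim sU; apply/andP; split=> //.
  by rewrite -(eqnP fX) dimvS //; apply/span_subvP.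
have [v vU vX] := subvPn nU.
have [a aX] : exists a, comp a v \notin <<X>>%VS.
  have [/allP h|/allPn[a _ h]] := boolP (all (fun a => comp a v \in <<X>>%VS) (degrees W)).
    case/negP: vX; rewrite [v]sum_comp big_seq; apply: memv_suml => a /h; exact.
  by exists a.
apply: (IH (comp a v :: X)).
- have fX' : free (comp a v :: X) by rewrite free_cons aX.
  rewrite /= subnS; move: dX; case: (_ - _)%N => //.
- by rewrite free_cons aX.
- by move=> x; rewrite inE => /orP[/eqP ->|/sX //]; apply: gU.
- move=> x; rewrite inE => /orP[/eqP ->|/hX //].
  exact: vhom_vdeg (@vhom_comp W a v).
Qed.

Lemma graded_iso_exists (U : {vspace vec K W}) : graded_sub U ->
  exists (V : gvect) (f : 'Hom(vec K V, vec K W)), graded_iso_onto f U.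
Proof.
move=> gU; have [X [bX hX]] := homogeneous_basis gU.
pose n := size X; pose t := in_tuple X.
(* The letters of [V] are the basis vectors with their own degrees, which makes [F] preserve
   degrees. *)
pose V := @GVect n (fun i => vdeg (tnth t i)).
pose F (v : vec K V) : vec K W := \sum_(i < n) v 0 i *: tnth t i.
have lF : linear F.
  by apply: lin_sum => i c u v; rewrite !mxE scalerDl scalerA.
pose Fl := HB.pack_for {linear vec K V -> vec K W} F
  (GRing.isLinear.Build K (vec K V) (vec K W) _ F lF).
exists V, (linfun Fl).
have FE v : linfun Fl v = F v by rewrite lfunE.
have Fd i : F (delta_mx 0 i) = tnth t i.
  rewrite /F (bigD1 i) //= mxE !eqxx scale1r big1 ?addr0 // => j ji.
  by rewrite mxE eqxx (negbTE ji) scale0r.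
split.
- move=> a v hv j; rewrite FE /F summxE => ne.
  apply: contraNeq ne => ja; apply/eqP/big1 => i _; rewrite mxE.
  have [->|/hv ia] := eqVneq (v 0 i) 0; first by rewrite mul0r.
  have [->|/(hX _ (mem_tnth i t)) ij] := eqVneq (tnth t i 0 j) 0; first by rewrite mulr0.
  by case/eqP: ja; rewrite ij.
- apply/eqP; rewrite -subv0; apply/subvP => v; rewrite memv_ker FE memv0 => /eqP v0.
  have /freeP fX : free t by rewrite (basis_free bX).
  apply/eqP/rowP => i; rewrite mxE; apply: (fX (fun i => v 0 i)).
  by rewrite -[RHS]v0; apply: eq_bigr => j _; rewrite (tnth_nth 0).
apply/eqP; rewrite eqEsubv; apply/andP; split.
  apply/subvP => _ /memv_imgP[v _ ->]; rewrite FE; apply: memv_suml => i _.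
  by apply: memvZ; apply: (basis_mem bX); apply: (mem_tnth i t).
rewrite -(span_basis bX); apply/span_subvP => x /(tnthP t)[i ->].
by rewrite -Fd -FE memv_img ?memvf.
Qed.

End Homogeneous.

Section DualBasis.
Variables (K : numFieldType) (W : gvect) (M : manin_triple K W).
Variables (V : gvect) (f : 'Hom(vec K V, vec K W)).
Hypothesis hf : graded_iso_onto f (mt_plus M).
Local Notation D := (dbl V).
Local Notation B := (mt_form M).
Local Notation ee := (fun a : letter V => delta_mx 0 a : vec K V).

Lemma lin_Bl y : linear (fun x => B x y : K^o).
Proof. by move=> c u v; rewrite linearDl linearZl_LR. Qed.

Lemma lin_Br x : linear (fun y => B x y : K^o).
Proof. by move=> c u v; rewrite linearDr linearZr_LR. Qed.

Lemma f_plus v : f v \in mt_plus M.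
Proof. by case: hf => _ _ <-; rewrite memv_img ?memvf. Qed.

Lemma plus_f p : p \in mt_plus M -> exists v, p = f v.
Proof. by case: hf => _ _ <- /memv_imgP[v _ ->]; exists v. Qed.

Lemma split_pm w : exists p m, [/\ p \in mt_plus M, m \in mt_minus M & w = p + m].
Proof.
have : w \in (mt_plus M + mt_minus M)%VS by rewrite mt_sum memvf.
by case/memv_addP => p pp [m mm ->]; exists p, m.
Qed.

(** The positive half is isotropic, so nondegeneracy has to be witnessed on the negative half. *)
Lemma B_plus p : p \in mt_plus M -> (forall m, m \in mt_minus M -> B p m = 0) -> p = 0.
Proof.
move=> pp H; apply: (@mt_form_nondeg _ _ M) => w.
have [p' [m [pp' mm ->]]] := split_pm w.
by rewrite (linD (lin_Br p)) (mt_plus_iso pp pp') H // addr0.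
Qed.

Lemma B_minus m : m \in mt_minus M -> (forall a, B m (f (ee a)) = 0) -> m = 0.
Proof.
move=> mm H; apply: (@mt_form_nondeg _ _ M) => w.
have [p [m' [/plus_f[v ->] mm' ->]]] := split_pm w.
rewrite (linD (lin_Br m)) (mt_minus_iso mm mm') addr0.
rewrite [v]row_sum_delta linear_sum; apply: etrans (lin_sumf (lin_Br m) _ _ _) _.
by apply: big1 => a _; rewrite linearZ (linZ (lin_Br m)) /= H scaler0.
Qed.

Lemma dim_rV n : \dim {: 'rV[K]_n} = n.
Proof. by rewrite dimvf /dim /= mul1n. Qed.

Lemma dim_plus : \dim (mt_plus M) = gdim V.
Proof.
case: hf => _ k0 <-; have := limg_ker_dim f fullv.
by rewrite capfv k0 dimv0 add0n dim_rV.
Qed.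

Lemma dim_le_inj n (U : {vspace vec K W}) (F : vec K W -> 'rV[K]_n) : linear F ->
  (forall u, u \in U -> F u = 0 -> u = 0) ->
  exists h : 'Hom(vec K W, 'rV[K]_n), (forall u, h u = F u) /\ \dim (h @: U) = \dim U.
Proof.
move=> lF H.
pose Fl := HB.pack_for {linear vec K W -> 'rV[K]_n} F
  (GRing.isLinear.Build K (vec K W) 'rV[K]_n _ F lF).
exists (linfun Fl); split=> [u|]; first by rewrite lfunE.
apply/esym; rewrite -(limg_ker_dim (linfun Fl) U).
suff -> : (U :&: lker (linfun Fl) = 0)%VS by rewrite dimv0 add0n.
apply/eqP; rewrite -subv0; apply/subvP => u; rewrite memv_cap memv_ker lfunE memv0.
by move=> /andP[uU /eqP u0]; apply/eqP/H.
Qed.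

Lemma lin_row n (F : 'I_n -> vec K W -> K^o) : (forall i, linear (F i)) ->
  linear (fun u => \row_i F i u : 'rV[K]_n).
Proof. by move=> lF c u v; apply/rowP => i; rewrite !mxE lF. Qed.

Lemma dim_minus : (gdim V <= \dim (mt_minus M))%N.
Proof.
rewrite -dim_plus; set n := \dim (mt_minus M).
have H p : p \in mt_plus M -> \row_i B p (tnth (vbasis (mt_minus M)) i) = 0 -> p = 0.
  move=> pp /rowP H; apply: B_plus => // m mm.
  rewrite (coord_vbasis mm); apply: etrans (lin_sumf (lin_Br p) _ _ _) _.
  apply: big1 => i _; rewrite (linZ (lin_Br p)).
  by have := H i; rewrite !mxE (tnth_nth 0) => ->; rewrite scaler0.
have [h [_ <-]] := dim_le_inj (lin_row (fun i => lin_Bl (tnth (vbasis (mt_minus M)) i))) H.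
by rewrite -[X in (_ <= X)%N](dim_rV n) dimvS ?subvf.
Qed.

(** The form embeds each half into the dual of the other, so the dimensions agree and the embedding
    of the negative half is onto. *)
Lemma minus_dual (c : 'I_(gdim V) -> K) :
  exists m, m \in mt_minus M /\ forall a, B m (f (ee a)) = c a.
Proof.
have H m : m \in mt_minus M -> \row_a B m (f (ee a)) = 0 -> m = 0.
  by move=> mm /rowP H; apply: B_minus => // a; have := H a; rewrite !mxE.
have [h [hE hd]] := dim_le_inj (lin_row (fun a => lin_Bl (f (ee a)))) H.
have hfull : (h @: mt_minus M = fullv)%VS.
  by apply/eqP; rewrite eqEdim subvf /= hd dim_rV dim_minus.
have : (\row_a c a) \in (h @: mt_minus M)%VS by rewrite hfull memvf.
move=> /memv_imgP[m mm]; rewrite hE => /rowP e; exists m; split=> // a.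
by have := e a; rewrite !mxE.
Qed.

Lemma B_comp a b m w : vhom b w -> B (comp a m) w = if a + b == 0 then B m w else 0.
Proof.
move=> hw; have h0 c : c + b != 0 -> B (comp c m) w = 0.
  by move=> cb; apply: (mt_form_deg M (@vhom_comp K W c m) hw cb).
have [ab|/h0 //] := eqVneq (a + b) 0.
rewrite [m in RHS]sum_comp.
apply/esym; apply: etrans (lin_sumf (lin_Bl w) _ _ _) _.
have [ad|ad] := boolP (a \in degrees W).
  rewrite (bigD1_seq a) ?undup_uniq //= big1 ?addr0 // => c ca.
  by apply: h0; rewrite -ab (inj_eq (addIr b)).
rewrite big_seq big1 => [|c cd].
  suff -> : comp a m = 0 by rewrite (lin0 (lin_Bl w)).
  apply/rowP => i; rewrite !mxE; case: eqP => // e.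
  by case/negP: ad; rewrite -e mem_undup map_f ?mem_enum.
by apply: h0; rewrite -ab (inj_eq (addIr b)); apply: contraNneq ad => <-.
Qed.

(** A dual vector need not be homogeneous at first. The form has degree 0, so keeping only its
    component of degree [- gdeg a] preserves the pairings with letters of the degree of [a] and
    kills the others, which were zero already. *)
Lemma dual_basis : exists mm : letter V -> vec K W, forall a,
  [/\ mm a \in mt_minus M, (forall b, B (mm a) (f (ee b)) = (a == b)%:R)
    & vhom (- gdeg a) (mm a)].
Proof.
apply: (@fin_all_exists _ (fun=> vec K W) (fun a m => [/\ m \in mt_minus M,
  (forall b, B m (f (ee b)) = (a == b)%:R) & vhom (- gdeg a) m])) => a.
have [m [mm hm]] := minus_dual (fun b => (a == b)%:R).
have cm : comp (- gdeg a) m \in mt_minus M by apply: mt_minus_graded.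
have hb b : B (comp (- gdeg a) m) (f (ee b)) = (a == b)%:R.
  have hfb : vhom (gdeg b) (f (ee b)).
    case: hf => hv _ _; apply: hv => i; rewrite mxE eqxx /=.
    by have [->|_] := eqVneq i b; rewrite ?eqxx.
  rewrite (B_comp _ _ hfb) addrC subr_eq0.
  case: (eqVneq a b) => [<-|ab]; first by rewrite eqxx hm eqxx.
  by rewrite hm (negbTE ab) if_same.
exists (comp (- gdeg a) m); split=> //; exact: vhom_comp.
Qed.

End DualBasis.

(** * The isomorphism from V (+) V^* onto a Manin triple *)

Section Phi.
Variables (K : numFieldType) (W : gvect) (M : manin_triple K W).
Variables (V : gvect) (f : 'Hom(vec K V, vec K W)).
Hypothesis hf : graded_iso_onto f (mt_plus M).
Local Notation D := (dbl V).
Local Notation B := (mt_form M).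
Local Notation ee := (fun a : letter V => delta_mx 0 a : vec K V).

Lemma inV_delta (a : letter V) : inV (ee a) = dvec K (lshift _ a).
Proof.
apply/rowP => i; rewrite inVE /dvec mxE eqxx /=.
case: (dletterP i) => b; rewrite ?(split_lshift, split_rshift) ?mxE ?eqxx /=.
  by rewrite (inj_eq (@lshift_inj _ _)).
by rewrite eq_sym eq_lrshift.
Qed.

Lemma inVdual_delta (a : letter V) : inVdual (ee a) = dvec K (rshift _ a).
Proof.
apply/rowP => i; rewrite inVdualE /dvec mxE eqxx /=.
case: (dletterP i) => b; rewrite ?(split_lshift, split_rshift) ?mxE ?eqxx /=.
  by rewrite eq_lrshift.
by rewrite (inj_eq (@rshift_inj _ _)).
Qed.

Lemma lin_inV : linear (@inV K V).
Proof. by move=> c u v; rewrite /inV scale_row_mx add_row_mx scaler0 addr0. Qed.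
Lemma dbl_ext (E : lmodType K) (g h : vec K D -> E) : linear g -> linear h ->
  (forall a, g (inV (ee a)) = h (inV (ee a))) ->
  (forall a, g (inVdual (ee a)) = h (inVdual (ee a))) -> g =1 h.
Proof.
move=> lg lh H1 H2 u; rewrite [u]row_sum_delta (lin_sumf lg) (lin_sumf lh).
apply: eq_bigr => i _; rewrite (linZ lg) (linZ lh); congr (_ *: _).
by case: (dletterP i) => a; rewrite -/(dvec K _) -?inV_delta -?inVdual_delta.
Qed.

Record phi_spec (phi : 'Hom(vec K D, vec K W)) : Prop := PhiSpec {
  phi_f : forall v, phi (inV v) = f v;
  phi_deg : forall a v, vhom a v -> vhom a (phi v);
  phi_form : forall u v, B (phi u) (phi v) = dform u v;
  phi_ker : lker phi = 0%VS;
  phi_img : limg phi = fullv;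
  phi_plus : forall u, phi u \in mt_plus M <-> exists v, u = inV v;
  phi_minus : forall u, phi u \in mt_minus M <-> exists v, u = inVdual v }.

Lemma vhom_ee (U : gvect) (i : letter U) : vhom (gdeg i) (delta_mx 0 i : vec K U).
Proof. by move=> j; rewrite mxE eqxx /=; have [->|_] := eqVneq j i; rewrite ?eqxx. Qed.

Lemma phi_exists : exists phi, phi_spec phi.
Proof.
have [mm hmm] := dual_basis hf.
(* The map is [f] on V and sends the dual letters to the dual basis of the negative half. *)
pose F (u : vec K D) : vec K W := f (lsubmx u) + \sum_a rsubmx u 0 a *: mm a.
have lF : linear F.
  apply: lin_add => [|].
    by move=> c u v; rewrite !linearP.
  by apply: lin_sum => a c u v; rewrite linearP !mxE scalerDl scalerA.
pose Fl := HB.pack_for {linear vec K D -> vec K W} F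
  (GRing.isLinear.Build K (vec K D) (vec K W) _ F lF).
pose phi := linfun Fl; have pE u : phi u = F u by rewrite lfunE.
clearbody phi.
have pB x y : phi (x - y) = phi x - phi y by apply: linearB.
have pV v : phi (inV v) = f v.
  rewrite pE /F /inV row_mxKl row_mxKr big1 ?addr0 // => a _.
  by rewrite mxE scale0r.
have pR r : phi (inVdual r) = \sum_b r 0 b *: mm b.
  by rewrite pE /F /inVdual row_mxKl row_mxKr linear0 add0r.
have pD a : phi (inVdual (ee a)) = mm a.
  rewrite pR (bigD1 a) //= big1; first by rewrite mxE !eqxx scale1r addr0.
  by move=> b ba; rewrite mxE eqxx (negbTE ba) scale0r.
have pdual v : phi (inVdual v) \in mt_minus M.
  rewrite pE /F /inVdual row_mxKl row_mxKr linear0 add0r; apply: memv_suml => a _.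
  by apply: memvZ; case: (hmm a).
have pform u v : B (phi u) (phi v) = dform u v.
  move: v; apply: (dbl_ext (g := fun v => B (phi u) (phi v) : K^o) (h := fun v => dform u v : K^o)) => [|||].
  - by apply: lin_comp (lin_Br M (phi u)) _; move=> c x y; rewrite linearP.
  - exact: lin_dformr.
  - move=> b; move: u; apply: (dbl_ext (g := fun u => B (phi u) (phi _) : K^o) (h := fun u => dform u _ : K^o)) => [|||].
    + by apply: lin_comp (lin_Bl M (phi _)) _; move=> c x y; rewrite linearP.
    + exact: lin_dforml.
    + move=> a; rewrite !pV (mt_plus_iso (f_plus hf _) (f_plus hf _)).
      by rewrite !inV_delta dform_dvec /dpair !split_lshift.
    + move=> a; rewrite pV pD; case: (hmm a) => _ -> _.
      by rewrite inV_delta inVdual_delta dform_dvec /dpair split_lshift split_rshift.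
  - move=> b; move: u; apply: (dbl_ext (g := fun u => B (phi u) (phi _) : K^o) (h := fun u => dform u _ : K^o)) => [|||].
    + by apply: lin_comp (lin_Bl M (phi _)) _; move=> c x y; rewrite linearP.
    + exact: lin_dforml.
    + move=> a; rewrite pV pD inV_delta inVdual_delta dform_dvec /dpair split_lshift split_rshift.
      case: hf => hv _ _; case: (hmm b) => _ hB hd.
      (* Graded symmetry produces the sign that [dpair] carries when the letter of V stands
         first. *)
      rewrite (mt_form_sym M (hv _ _ (@vhom_ee V a)) hd) hB odd_abszN.
      by case: (eqVneq a b) => [->|ab]; rewrite ?andbb ?eqxx ?mulr0.
    + move=> a; rewrite !pD; case: (hmm a) (hmm b) => ma _ _ [mb _ _].
      by rewrite (mt_minus_iso ma mb) !inVdual_delta dform_dvec /dpair !split_rshift.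
(* An isometry from a nondegenerate form is injective. *)
have pinj u : phi u = 0 -> u = 0.
  move=> u0; apply: dform_nondeg => v; rewrite -pform u0; exact: (lin0 (lin_Bl M _)).
exists phi; split=> //.
- move=> a v hv j; rewrite pE /F mxE summxE => ne.
  apply: contraNeq ne => ja; apply/eqP; rewrite [X in X + _](_ : _ = 0) ?add0r; last first.
    apply/eqP; apply: contraNT ja => /= fj; apply/eqP.
    have hl : vhom a (lsubmx v) by move=> i; rewrite mxE => /hv; rewrite gdegl.
    by case: hf => hv' _ _; apply: hv' hl _ fj.
  apply: big1 => b _; rewrite mxE.
  have [->|rb] := eqVneq (rsubmx v 0 b) 0; first by rewrite mul0r.
  have [->|/= mb] := eqVneq (mm b 0 j) 0; first by rewrite mulr0.
  case/eqP: ja; case: (hmm b) => _ _ /(_ _ mb) ->.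
  by move: rb; rewrite mxE => /hv <-; rewrite gdegr.
- by apply/eqP; rewrite -subv0; apply/subvP => u; rewrite memv_ker memv0 => /eqP/pinj ->.
- apply/eqP; rewrite eqEsubv subvf; apply/subvP => w _.
  have [p [m [/(plus_f hf)[v ->] mmi ->]]] := split_pm M w.
  rewrite -pV memvD ?memv_img ?memvf //.
  (* The coordinates of [m] in the dual basis are its pairings with the images of the letters of V;
     [B_minus] then identifies the two vectors. *)
  suff -> : m = phi (inVdual (\row_a B m (f (ee a)))) by rewrite memv_img ?memvf.
  apply/eqP; rewrite -subr_eq0; apply/eqP; apply: (B_minus hf) => [|a].
    by rewrite memvB ?pdual.
  rewrite linearBl; apply/eqP; rewrite subr_eq0 eq_sym; apply/eqP.
  have -> : B (phi (inVdual (\row_b B m (f (ee b))))) (f (ee a)) = B m (f (ee a)).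
    rewrite pR; apply: etrans (lin_sumf (lin_Bl M _) _ _ _) _.
    rewrite (bigD1 a) //= big1 => [|b ba]; rewrite (linZ (lin_Bl M _)).
      by case: (hmm a) => _ -> _; rewrite mxE eqxx addr0; apply: mulr1.
    by case: (hmm b) => _ -> _; rewrite (negbTE ba); apply: mulr0.
  by [].
- move=> u; split=> [pu|[v ->]]; last by rewrite pV f_plus.
  exists (lsubmx u); suff r0 : inVdual (rsubmx u) = 0 by rewrite [LHS]inV_add r0 addr0.
  apply: pinj; apply/eqP; rewrite -memv0 -(mt_direct M) memv_cap pdual andbT.
  have -> : inVdual (rsubmx u) = u - inV (lsubmx u) by rewrite {2}[u]inV_add addrC addKr.
  by rewrite pB; apply: memvB => //; rewrite pV f_plus.
move=> u; split=> [pu|[v ->]] //.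
exists (rsubmx u); suff r0 : inV (lsubmx u) = 0 by rewrite [LHS]inV_add r0 add0r.
apply: pinj; apply/eqP; rewrite -memv0 -(mt_direct M) memv_cap pV f_plus //=.
rewrite -pV; have -> : inV (lsubmx u) = u - inVdual (rsubmx u) by rewrite {2}[u]inV_add addrK.
by rewrite pB; apply: memvB.
Qed.

Section PhiSpec.
Variable phi : 'Hom(vec K D, vec K W).
Hypothesis hphi : phi_spec phi.

Definition psi : 'Hom(vec K W, vec K D) := (phi^-1)%VF.

Lemma psiK : cancel phi psi.
Proof. by apply: lker0_lfunK; rewrite phi_ker. Qed.

Lemma phiK : cancel psi phi.
Proof. by move=> w; apply: limg_lfunVK; rewrite phi_img // memvf. Qed.

Lemma lin_psi : linear psi.
Proof. by move=> c u v; rewrite linearP. Qed.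

Lemma lin_phi : linear phi.
Proof. by move=> c u v; rewrite linearP. Qed.

Lemma comp_phi a u : comp a (phi u) = phi (comp a u).
Proof.
rewrite {1}[u]sum_comp linear_sum (lin_sumf (@lin_comp_hom K W a)).
have e b : comp a (phi (comp b u)) = if b == a then phi (comp b u) else 0.
  exact/comp_vhom/(phi_deg hphi)/vhom_comp.
have [ad|ad] := boolP (a \in degrees D).
  rewrite (bigD1_seq a) ?undup_uniq //= e eqxx big1 ?addr0 // => b ba.
  by rewrite e (negbTE ba).
rewrite big_seq big1 => [|b bd]; last first.
  by rewrite e; case: eqP => // ba; case/negP: ad; rewrite -ba.
suff -> : comp a u = 0 by rewrite linear0.
apply/rowP => i; rewrite !mxE; case: eqP => // e'.
by case/negP: ad; rewrite -e' mem_undup map_f ?mem_enum.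
Qed.

(** [phi] commutes with taking homogeneous components, hence so does its inverse. *)
Lemma psi_deg a w : vhom a w -> vhom a (psi w).
Proof.
move=> hw i ui; apply: contraNeq ui => ia.
have : comp (gdeg i) (psi w) = 0.
  by apply: (can_inj psiK); rewrite -comp_phi phiK (comp_vhom _ hw) eq_sym (negbTE ia) linear0.
by move=> /rowP/(_ i); rewrite !mxE eqxx => ->.
Qed.

Lemma psi_par j : vpar (par j) (psi (delta_mx 0 j)).
Proof. by move=> i /(psi_deg (@vhom_ee W j)) e; rewrite /par e. Qed.

End PhiSpec.
End Phi.

(** * The bialgebra of a Manin triple *)

Section WordProducts.
Variables (K : numFieldType) (U W : gvect) (ph : letter U -> vec K W).
Hypothesis ph_deg : forall i, vhom (gdeg i) (ph i).

Lemma hpar_gen (p : bool) (v : vec K W) : vpar p v -> hpar p (gen v).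
Proof. exact: gr_gen. Qed.

Lemma ph_par i : vpar (par i) (ph i).
Proof. by move=> j /(@ph_deg i) e; rewrite /par e. Qed.

Lemma swaps_wprod : swaps (fun w => wprod (map ph w)).
Proof.
move=> a i j b; elim: a => [|k a IH]; last first.
  rewrite [LHS]/= IH; apply: wedgeZr.
rewrite [LHS]/= wedgeA (wedgeC (hpar_gen (@ph_par j)) (hpar_gen (@ph_par i))).
rewrite wedgeZl andbC; apply: congr1; apply/esym; exact: wedgeA.
Qed.

Lemma wprod_size w : gr (fun=> 1 : int) (size w)%:Z (wprod (map ph w)).
Proof.
elim: w => [|i w IH].
  by have := @gr_mono K W _ (fun=> 1 : int) [::]; rewrite big_nil.
by rewrite [size _]/= intS; apply: gr_wedge IH; apply: gr_gen.
Qed.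

Lemma wprod_deg w : gr (@gdeg W) (wdeg w) (wprod (map ph w)).
Proof.
elim: w => [|i w IH].
  have := @gr_mono K W _ (@gdeg W) [::]; rewrite big_nil => h v /h ->.
  by rewrite /wdeg big_nil.
have -> : wdeg (i :: w) = gdeg i + wdeg w by rewrite /wdeg big_cons.
by apply: gr_wedge IH; apply: gr_gen; apply: ph_deg.
Qed.

Lemma wprod_ext_hom w : ext_hom (size w) (wdeg w) (wprod (map ph w)).
Proof.
split=> v vw; last exact: (wprod_deg vw).
by have := wprod_size vw; rewrite sum_const1 => -[].
Qed.

End WordProducts.

Lemma wprod_delta (K : numFieldType) (W : gvect) (w : seq (letter W)) :
  wprod (map (fun i => delta_mx 0 i : vec K W) w) = mono w.
Proof.
elim: w => [|i w IH] //; rewrite [LHS]/= IH gen_delta; exact: wedge_mono.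
Qed.

Lemma multilinear_eq (K : numFieldType) (U : gvect) (E : lmodType K)
    (F G : seq (vec K U) -> E) n :
  (forall a b, linear (fun v => F (a ++ v :: b))) ->
  (forall a b, linear (fun v => G (a ++ v :: b))) ->
  (forall w, size w = n -> F (map (fun i => delta_mx 0 i) w) = G (map (fun i => delta_mx 0 i) w)) ->
  forall vs, size vs = n -> F vs = G vs.
Proof.
move=> lF lG FG vs svs.
suff H w : (size w + size vs)%N = n ->
    F (map (fun i => delta_mx 0 i) w ++ vs) = G (map (fun i => delta_mx 0 i) w ++ vs).
  exact: (H [::]).
elim: vs {svs} w => [|v vs IH] w sw.
  by rewrite !cats0; apply: FG; rewrite -sw addn0.
rewrite [v]row_sum_delta (lin_sumf (lF _ _)) (lin_sumf (lG _ _)).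
apply: eq_bigr => i _; rewrite (linZ (lF _ _)) (linZ (lG _ _)).
by congr (_ *: _); rewrite -cat_rcons -map_rcons IH // size_rcons addSnnS.
Qed.

Lemma lin_wprod (K : numFieldType) (W : gvect) (a b : seq (vec K W)) :
  linear (fun v => wprod (a ++ v :: b)).
Proof.
elim: a => [|u a IH] /=; first exact/lin_wedgel/lin_gen/lin_id.
exact: lin_wedger IH.
Qed.

Lemma lin_xiter_arg (K : numFieldType) (V : gvect) (T : xext K (dbl V)) a b :
  linear (fun v => xiter T (a ++ v :: b)).
Proof.
move=> c u v; rewrite !xiter_cat /=.
exact: (lin_xiter b (lin_xbracketr (xiter T a) (lin_xgen (@lin_id _ _)))).
Qed.

Section Represent.
Variables (K : numFieldType) (W : gvect) (M : manin_triple K W).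
Variables (V : gvect) (f : 'Hom(vec K V, vec K W)) (phi : 'Hom(vec K (dbl V), vec K W)).
Hypothesis hphi : phi_spec M f phi.
Local Notation D := (dbl V).
Local Notation B := (mt_form M).
Local Notation ext := (xext K D).
Local Notation xbracket := (@xbracket K V).
Local Notation xgen := (@xgen K D).
Local Notation xwt := (xgr (fun _ : letter D => 1 : int)).
Local Notation ph := (fun i : letter D => phi (dvec K i)).
Local Notation psi := (psi phi).

Lemma phi_dvec_deg i : vhom (gdeg i) (ph i).
Proof. exact: (phi_deg hphi (@vhom_ee K D i)). Qed.

(** The bracket of all letters but the last, paired with the last one; reversing gives access to
    that letter. It is represented only in lengths k + l with [k], [l] at least 1, so never below
    2. *)
Definition triple_form (w : seq (letter D)) : K^o :=
  if rev w is j :: r then B (M (size r) (wprod (map ph (rev r)))) (ph j) else 0.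

Lemma triple_form_rcons u j : triple_form (rcons u j) = B (M (size u) (wprod (map ph u))) (ph j).
Proof. by rewrite /triple_form rev_rcons size_rev revK. Qed.

(** An exchange that involves the last letter is the invariance of the form; any other takes place
    inside the exterior product fed to the bracket. *)
Lemma swaps_triple_form : swaps triple_form.
Proof.
move=> a i j; case/lastP => [|b l].
  have e x y : a ++ [:: x; y] = rcons (rcons a x) y by rewrite -cats1 cat_rcons.
  rewrite !e !triple_form_rcons !map_rcons !size_rcons -(size_map ph) andbC.
  by apply: (mt_invariant M (in_tuple (map ph a)) (@phi_dvec_deg j) (@phi_dvec_deg i)).
rewrite -!rcons_cons -!rcons_cat !triple_form_rcons !size_cat /=.
have := swaps_wprod phi_dvec_deg a i j b => h.
apply: etrans (congr1 (fun x => B (M _ x) (ph l)) h) _.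
by rewrite linearZ; apply: (linZ (lin_Bl M (ph l))).
Qed.

(** For n + 1 letters the n-bracket has degree 2 - n and the form has degree 0, so the degrees of
    the letters must sum to n - 2. *)
Lemma triple_form_wdeg w : triple_form w != 0 -> w != [::] /\ wdeg w = (size w)%:Z - 3 \/ (size w <= 1)%N.
Proof.
case/lastP: w => [|u j]; first by rewrite eqxx.
rewrite triple_form_rcons => ne; case: u ne => [|i u'] ne; first by right.
left; split; first by case: u' ne.
move: ne; set u := i :: u' => ne.
have hM : vhom (wdeg u + (2 - (size u)%:Z)) (M (size u) (wprod (map ph u))).
  by apply: lam_deg => //; apply: wprod_ext_hom; apply: phi_dvec_deg.
have := mt_form_deg M hM (@phi_dvec_deg j).
have [e _|ne' /(_ isT) e] := eqVneq (wdeg u + (2 - (size u)%:Z) + gdeg j) 0; last first.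
  by rewrite e eqxx in ne.
have -> : wdeg (rcons u j) = wdeg u + gdeg j.
  by rewrite /wdeg -cats1 big_cat big_seq1.
rewrite size_rcons; move: e; move: (wdeg u) (gdeg j) => x y; lia.
Qed.

Lemma triple_form_all (A : {vspace vec K W}) (P : pred (letter D)) w :
  linf_sub M A -> isotropic B A -> (forall i, P i -> ph i \in A) ->
  (1 < size w)%N -> all P w -> triple_form w = 0.
Proof.
move=> sA iA PA; case/lastP: w => [|u j] //; rewrite size_rcons ltnS all_rcons => su /andP[Pj Pu].
rewrite triple_form_rcons; apply: iA; last exact: PA.
rewrite -(size_map ph); apply: (sA _ (in_tuple (map ph u))); first by rewrite size_map.
by move=> v /mapP[i iu ->]; apply/PA/(allP Pu).
Qed.

(** [t k l] has k dual letters, so it is evaluated on words with k letters from V; restricting to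
    these words cuts the bidegree (k, l) out of the form. *)
Definition triple_form_part (k : nat) (w : seq (letter D)) : K^o :=
  if count (predC (@is_dual V)) w == k then triple_form w else 0.

Lemma swaps_triple_form_part k : swaps (triple_form_part k).
Proof.
move=> a i j b; rewrite /triple_form_part.
have -> : count (predC (@is_dual V)) (a ++ j :: i :: b)
    = count (predC (@is_dual V)) (a ++ i :: j :: b).
  by rewrite !count_cat /=; congr (_ + _)%N; rewrite addnCA.
by case: ifP => _; [exact: swaps_triple_form|rewrite scaler0].
Qed.

Definition triple_elt (k l : nat) : ext := represent (k + l) (triple_form_part k).

Section Gradings.
Variables (k l : nat).
Hypotheses (k1 : (1 <= k)%N) (l1 : (1 <= l)%N).

Lemma triple_form_part_neq0 w : size w = (k + l)%N -> triple_form_part k w != 0 ->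
  count (predC (@is_dual V)) w = k /\ wdeg w = (k + l)%:Z - 3.
Proof.
rewrite /triple_form_part => sw; case: (count _ w =P k) => [e|_]; last by rewrite eqxx.
by case/triple_form_wdeg => [[_]|]; rewrite sw; [|lia].
Qed.

Lemma triple_elt_wt : xwt (k + l)%:Z (triple_elt k l).
Proof. exact: wt_represent. Qed.

Lemma triple_elt_dual : xgr (@ndual V) k%:Z (triple_elt k l).
Proof.
have := @gr_represent K V _ (@ndual V) 1 l%:Z (k + l) (triple_form_part k) (@ndual_dl V).
rewrite (_ : 1 *+ (k + l) - l%:Z = k%:Z :> int); last by rewrite natz; lia.
apply=> w sw /(triple_form_part_neq0 sw)[cw _].
rewrite sum_ndual; have := count_predC (@is_dual V) w; rewrite cw sw; lia.
Qed.

Lemma triple_elt_prim : xgr (@nprim V) l%:Z (triple_elt k l).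
Proof.
have := @gr_represent K V _ (@nprim V) 1 k%:Z (k + l) (triple_form_part k) (@nprim_dl V).
rewrite (_ : 1 *+ (k + l) - k%:Z = l%:Z :> int); last by rewrite natz; lia.
apply=> w sw /(triple_form_part_neq0 sw)[cw _].
by rewrite sum_nprim cw.
Qed.

Lemma triple_elt_deg : xgr (@gdeg D) (3 - (k + l)%:Z) (triple_elt k l).
Proof.
have := @gr_represent K V _ (@gdeg D) 0 ((k + l)%:Z - 3) (k + l) (triple_form_part k) (@gdeg_dl_add V).
by rewrite mul0rn sub0r opprB; apply=> w sw /(triple_form_part_neq0 sw)[_ <-].
Qed.

Lemma triple_elt_par : xhpar true (triple_elt k l).
Proof.
have := @gr_represent K V _ (@par D) false true (k + l) (triple_form_part k).
rewrite mul0rn; apply=> [j|w sw /(triple_form_part_neq0 sw)[_ e]]; first by rewrite par_dl; case: (par j).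
rewrite -wparE wpar_wdeg e sw.
by rewrite (_ : (k + l)%:Z - 3 - (k + l)%:Z = - 3%:Z) //; lia.
Qed.

End Gradings.
(** Exactly one summand matches the number of letters of [w] in V, unless that number is 0 or n + 1.
    There the sum has no term, and the form is zero as well. *)
Lemma triple_elt_eval n w : (1 <= n)%N -> size w = n.+1 ->
  eps (xiter (tsum triple_elt n) (map (@dvec K V) w)) = triple_form w.
Proof.
move=> n1 sw; rewrite /tsum xiter_sum eps_sum.
rewrite (eq_big_nat _ _ (F2 := fun k => triple_form_part k w)) => [|k kn]; last first.
  rewrite /triple_elt (_ : k + (n.+1 - k) = size w)%N; last by rewrite sw; lia.
  exact/represent_iter/swaps_triple_form_part.
pose c := count (predC (@is_dual V)) w.
have cs : (c <= n.+1)%N by rewrite -sw count_size.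
have [c1|c1] := boolP (1 <= c < n.+1)%N.
  rewrite (bigD1_seq c) ?mem_index_iota ?iota_uniq //= /triple_form_part eqxx big1 ?addr0 // => k kc.
  by rewrite -/c eq_sym (negbTE kc).
(* All letters lie in one half, which is closed under the brackets and isotropic. *)
have -> : triple_form w = 0.
  have [c0|c0] := eqVneq c 0%N.
    apply: (@triple_form_all (mt_minus M) (@is_dual V)).
    - exact: mt_minus_sub.
    - exact: mt_minus_iso.
    - move=> i di; apply/(phi_minus hphi); case: (dletterP i) di => a.
        by rewrite is_duall.
      by exists (delta_mx 0 a); rewrite inVdual_delta.
    - by rewrite sw.
    by have := c0; rewrite /c => /eqP; rewrite -leqn0 leqNgt -has_count -all_predC; 
      apply: sub_all => i /=; rewrite negbK.
  apply: (@triple_form_all (mt_plus M) (predC (@is_dual V))).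
  - exact: mt_plus_sub.
  - exact: mt_plus_iso.
  - move=> i di; apply/(phi_plus hphi); case: (dletterP i) di => a /=.
      by exists (delta_mx 0 a); rewrite inV_delta.
    by rewrite is_dualr.
  - by rewrite sw.
  by rewrite all_count -/c sw eqn_leq cs; lia.
rewrite big_nat_cond big1 // => k /andP[kn _]; rewrite /triple_form_part -/c.
by case: eqP => // ck; rewrite ck kn in c1.
Qed.

Lemma lin_target n a b :
  linear (fun v => xgen (psi (M n (wprod (map phi (a ++ v :: b)))))).
Proof.
apply: lin_xgen; apply: (lin_comp (lin_psi phi)); move=> c u v.
rewrite -linearP; apply: congr1; rewrite !map_cat /=.
apply: etrans _ (lin_wprod (map phi a) (map phi b) c (phi u) (phi v)).
by rewrite (lin_phi phi).
Qed.

Lemma triple_elt_iter n vs : (1 <= n)%N -> size vs = n ->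
  xiter (tsum triple_elt n) vs = xgen (psi (M n (wprod (map phi vs)))).
Proof.
move=> n1; apply: (multilinear_eq (F := xiter (tsum triple_elt n))
  (G := fun vs => xgen (psi (M n (wprod (map phi vs)))))) => [a b|a b|w sw].
- exact: lin_xiter_arg.
- exact: lin_target.
set X := xgen _.
have wT : xwt n.+1%:Z (tsum triple_elt n) by apply: tsum_wt => k l _ _; apply: triple_elt_wt.
have w1 : xwt 1 (xiter (tsum triple_elt n) (map (@dvec K V) w)).
  have := wt_xiter (vs := map (@dvec K V) w) wT.
  by rewrite size_map sw (_ : n.+1%:Z - n%:Z = 1) //; lia.
(* Both sides have weight 1, so one further letter tests them; on the left this evaluates
   [triple_form] on n + 1 letters. *)
apply/eqP; rewrite -subr_eq0; apply/eqP; apply: (@eps_nondeg K V 1).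
  by apply: xgrD w1 _; rewrite -scaleN1r; apply/xgrZ/wt_xgen.
case=> [|j [|? ?]] // _; rewrite /= xgen_dvec.
rewrite -scaleN1r xbracketDl xbracketZl epsD epsZ mulN1r.
apply/eqP; rewrite subr_eq0; apply/eqP.
rewrite -xgen_dvec -xiter_rcons -map_rcons triple_elt_eval ?size_rcons ?sw // triple_form_rcons.
rewrite -dform_eps -(phi_form hphi) (phiK hphi) sw -map_comp //.
Qed.

Lemma triple_elt_square a b : tsquare triple_elt a b = 0.
Proof.
have H := @square_of_coder K V triple_elt triple_elt_par (fun k l _ _ => @triple_elt_wt k l) triple_elt_dual triple_elt_prim W psi (fun n x => M n x) (lin_psi phi) (psi_par hphi).
apply: H.
- move=> n u n1 su; rewrite triple_elt_iter ?size_map //.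
  rewrite -map_comp (eq_map (g := fun i => delta_mx 0 i)) => [|i]; last exact: (phiK hphi).
  by rewrite wprod_delta.
- exact: lam_square.
- by move=> v; exists (phi v); rewrite (psiK hphi).
Qed.

End Represent.

(** * Returning from the exterior algebra of the double to that of V *)

Section Lower.
Variables (K : numFieldType) (V : gvect).
Local Notation D := (dbl V).
Local Notation extV := {malg K[nword V]}.

Definition low_letter (i : letter D) : letter V := match split i with inl a => a | inr a => a end.

Lemma low_letter_lshift a : low_letter (lshift _ a) = a.
Proof. by rewrite /low_letter split_lshift. Qed.

Lemma lshift_low_letter i : ~~ is_dual i -> lshift _ (low_letter i) = i.
Proof. by case: (dletterP i) => a; rewrite ?is_dualr // low_letter_lshift. Qed.

Lemma gdeg_low_letter i : ~~ is_dual i -> gdeg (low_letter i) = gdeg i.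
Proof. by move=> di; rewrite -{2}(lshift_low_letter di) gdegl. Qed.

(** The projection that kills V^*, a left inverse of [ext_map inV]; it allows [tau] to be defined as
    a map into the exterior algebra of V. *)
Definition lower_word (w : seq (letter D)) : extV :=
  if has (@is_dual V) w then 0 else mono (map low_letter w).

Lemma swaps_lower : swaps lower_word.
Proof.
move=> a i j b; rewrite /lower_word.
have -> : has (@is_dual V) (a ++ j :: i :: b) = has (@is_dual V) (a ++ i :: j :: b).
  by rewrite !has_cat /=; congr (_ || _); apply: orbCA.
case: ifP => [_|h]; first by apply/esym; exact: scaler0.
rewrite !map_cat; move: h => /negbT; rewrite has_cat /= !negb_or => /and4P[_ di dj _].
apply: etrans (mono_swapE _ _ _ _ _) _.
by rewrite !parE !gdeg_low_letter.
Qed.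

Definition lower (y : xext K D) : extV := xlift lower_word y.

Lemma lin_lower : linear lower.
Proof. exact: lin_xlift (@lin_id _ _). Qed.

Lemma lower_mono w : lower (xmono K w) = lower_word w.
Proof. exact/xlift_mono/swaps_lower. Qed.

Lemma gr_lower (G : zmodType) (g : letter D -> G) (g' : letter V -> G) a y :
  (forall i, ~~ is_dual i -> g' (low_letter i) = g i) -> xgr g a y -> gr g' a (lower y).
Proof.
move=> gg gy; rewrite /lower /xlift /ext_lin big_seq; apply: gr_sum => w /gy <-.
apply: grZ; rewrite /lower_word; case: ifP => [_|/negbT]; first exact: gr0.
rewrite -all_predC => /allP nd; rewrite big_seq.
rewrite (eq_bigr (fun i => g' (low_letter i))) => [|i /nd /gg //].
by rewrite -big_seq -(big_map low_letter predT g'); apply: gr_mono.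
Qed.

Lemma inV_vhom (i : letter V) : @vhom K D (gdeg i) (inV (delta_mx 0 i)).
Proof. by rewrite inV_delta -gdegl; apply: vhom_ee. Qed.

Lemma inV_par (i : letter V) : vpar (par i) (inV (delta_mx 0 i : vec K V)).
Proof. by move=> j /(@inV_vhom i) e; rewrite /par e. Qed.

Lemma ext_map_mono w : ext_map (@inV K V) (mono w) = @mono K D (map (lshift (gdim V)) w).
Proof.
apply: etrans (ext_lin_mono (swaps_wprod inV_vhom) w) _.
rewrite -wprod_delta -map_comp; congr wprod; apply: eq_map => i.
exact: inV_delta.
Qed.

Lemma lin_ext_map : linear (ext_map (@inV K V)).
Proof. exact: lin_ext. Qed.

Lemma ext_mapK (x : extV) : lower (toX (ext_map (@inV K V) x)) = x.
Proof.
apply: (eq_linear_ext (f := fun x => lower (toX (ext_map (@inV K V) x))) (g := id)) => [||w] //.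
  exact: (lin_comp lin_lower (lin_comp (@lin_toX _ _) lin_ext_map)).
rewrite ext_map_mono toX_mono lower_mono /lower_word.
rewrite (_ : has _ _ = false) ?map_id_in //; last first.
  by rewrite has_map; apply/negbTE/hasPn => i _ /=; rewrite is_duall.
by rewrite -map_comp map_id_in // => i _ /=; rewrite low_letter_lshift.
Qed.

Lemma lowerK y : xgr (@ndual V) 0 y -> ext_map (@inV K V) (lower y) = ofX y.
Proof.
move=> gy; apply: (xgr_eq_linear (f := fun y => ext_map (@inV K V) (lower y)) (h := @ofX K D) gy).
- exact: lin_comp lin_ext_map lin_lower.
- exact: lin_ofX.
move=> w; rewrite sum_ndual => -[c0].
have nd : ~~ has (@is_dual V) w by rewrite has_count c0.
rewrite lower_mono /lower_word (negbTE nd) ext_map_mono ofX_mono -map_comp.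
rewrite map_id_in // => i iw /=; apply: lshift_low_letter.
by apply: (hasPn nd).
Qed.

End Lower.

Section Bialgebra.
Variables (K : numFieldType) (W : gvect) (M : manin_triple K W).
Variables (V : gvect) (f : 'Hom(vec K V, vec K W)) (phi : 'Hom(vec K (dbl V), vec K W)).
Hypothesis hphi : phi_spec M f phi.
Local Notation D := (dbl V).
Local Notation triple_elt := (triple_elt M phi).

Definition tau_fun k l (x : {malg K[nword V]}) : {malg K[nword V]} :=
  lower (act (@inV K V) (triple_elt k l) x).

Lemma lin_tau k l : linear (tau_fun k l).
Proof. exact: lin_comp (@lin_lower K V) (lin_act _ _). Qed.

HB.instance Definition _ k l := GRing.isLinear.Build K {malg K[nword V]} {malg K[nword V]} _
  (tau_fun k l) (lin_tau k l).

Definition tau k l : {linear {malg K[nword V]} -> {malg K[nword V]}} := tau_fun k l.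

Lemma tau_deg k l a (x : {malg K[nword V]}) : (1 <= k)%N -> (1 <= l)%N ->
  ext_hom k a x -> ext_hom l (a + (3 - (k + l)%:Z)) (tau k l x).
Proof.
move=> k1 l1 [hk ha].
have gd (i : letter V) : xgr (@gdeg D) (gdeg i) (xgen (inV (delta_mx 0 i : vec K V))).
  by apply: xgr_gen; apply: inV_vhom.
have gy : xgr (@gdeg D) (3 - (k + l)%:Z + a) (act (@inV K V) (triple_elt k l) x).
  apply: (gr_act (@gdeg_dl_add V) gd) => [|w /ha <-]; first exact: (triple_elt_deg hphi).
  by apply: eq_bigr => i _; rewrite subr0.
have gw : xgr (fun=> 1 : int) ((k + l)%:Z + - k%:Z) (act (@inV K V) (triple_elt k l) x).
  apply: (gr_act (gq := fun=> 1 : int) (c := 2)) => // [i||w /hk <-].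
  - exact: wt_xgen.
  - exact: triple_elt_wt.
  by rewrite (eq_bigr (fun=> - 1)) // sumrN sum_const1.
split=> w ww.
  have := gr_lower (g' := fun=> 1 : int) _ gw ww; rewrite sum_const1 => /(_ (fun _ _ => erefl)).
  by rewrite PoszD addrC addKr => -[].
have := gr_lower (g' := @gdeg V) (@gdeg_low_letter V) gy ww.
by rewrite addrC.
Qed.

Lemma triple_elt_msupp k l (w : nword D) : (1 <= k)%N -> (1 <= l)%N -> w \in msupp (ofX (triple_elt k l)) ->
  count (@is_dual V) w = k /\ count (predC (@is_dual V)) w = l.
Proof.
move=> k1 l1 wt; split.
  by have := triple_elt_dual hphi k1 l1 wt; rewrite sum_ndual => -[].
by have := triple_elt_prim hphi k1 l1 wt; rewrite sum_nprim => -[].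
Qed.

Lemma triple_elt_msupp_deg k l (w : nword D) : (1 <= k)%N -> (1 <= l)%N -> w \in msupp (ofX (triple_elt k l)) ->
  wdeg w + ((k + l)%:Z - 2) = 1.
Proof.
move=> k1 l1 wt; rewrite /wdeg (triple_elt_deg hphi k1 l1 wt); lia.
Qed.

(** The k vectors of V use up all k dual letters of [t k l], so [lower] loses nothing here. *)
Lemma tauE k l (vs : k.-tuple (vec K V)) : (1 <= k)%N -> (1 <= l)%N ->
  ext_map (@inV K V) (tau k l (wprod vs)) = iter_bracket (ofX (triple_elt k l)) (map (@inV K V) vs).
Proof.
move=> k1 l1; rewrite -ofX_iter /= /tau_fun.
rewrite (act_wprod (@lin_inV K V) (@inV_par K V)) lowerK //.
have gx := gr_xiter_const (vs := map (@inV K V) vs) (b := 0) (@ndual_dl V) (triple_elt_dual hphi k1 l1).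
have := gx _; rewrite sub0r mulNrn natz size_map size_tuple subrr; apply.
move=> _ /mapP[v _ ->]; apply: xgr_gen; apply/plusVP/mem_plusV; by exists v.
Qed.

Lemma triple_elt_bi_square a b :
  \sum_(1 <= k < a.+1) \sum_(1 <= l < b.+1)
       bracket (ofX (triple_elt k l)) (ofX (triple_elt (a.+1 - k) (b.+1 - l))) = 0.
Proof.
apply: etrans _ (lin0 (@lin_ofX K D)); rewrite -(triple_elt_square hphi a b) /tsquare.
rewrite (lin_sumf (@lin_ofX K D)); apply: eq_bigr => k _.
apply: etrans _ (esym (lin_sumf (@lin_ofX K D) _ _ _)); apply: eq_bigr => l _.
by rewrite ofX_bracket.
Qed.

Definition triple_bialgebra : linf_bialgebra K V :=
  @LinfBialgebra K V tau (fun k l => ofX (triple_elt k l)) tau_deg triple_elt_msupp triple_elt_msupp_deg tauE triple_elt_bi_square.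

Lemma bi_elt_triple k l : bi_elt triple_bialgebra k l = triple_elt k l.
Proof. exact: ofXK. Qed.

Lemma tsum_triple n : tsum (bi_elt triple_bialgebra) n = tsum triple_elt n.
Proof. by apply: eq_bigr => k _; rewrite bi_elt_triple. Qed.

Lemma triple_bialgebra_iso : double_iso triple_bialgebra M phi.
Proof.
split.
- by split; [exact: phi_deg hphi|exact: phi_ker hphi|exact: phi_img hphi].
- exact: phi_plus hphi.
- exact: phi_minus hphi.
- exact: phi_form hphi.
move=> n vs n1; rewrite double_bracketE tsum_triple (triple_elt_iter hphi) ?size_tuple //.
by rewrite xproj1_gen (phiK hphi).
Qed.

End Bialgebra.

(** * Uniqueness *)

Section Uniqueness.
Variables (K : numFieldType) (W : gvect) (M : manin_triple K W).
Variables (V : gvect) (f : 'Hom(vec K V, vec K W)).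
Hypothesis hf : graded_iso_onto f (mt_plus M).
Local Notation D := (dbl V).
Local Notation B := (mt_form M).

(** On V both maps are [f]. On V^* they land in the negative half with prescribed pairings against
    the image of [f], and such vectors are unique by [B_minus]. *)
Lemma double_iso_unique (X X' : linf_bialgebra K V) (phi phi' : 'Hom(vec K D, vec K W)) :
  (forall v, phi (inV v) = f v) -> (forall v, phi' (inV v) = f v) ->
  double_iso X M phi -> double_iso X' M phi' -> phi' = phi.
Proof.
move=> pf pf' [_ _ pm pB _] [_ _ pm' pB' _].
apply/lfunP; apply: dbl_ext => [||a|a].
- by move=> c u v; rewrite linearP.
- by move=> c u v; rewrite linearP.
- by rewrite pf pf'.
apply/eqP; rewrite -subr_eq0; apply/eqP; apply: (B_minus hf) => [|b].
  by apply: memvB; [apply/pm'|apply/pm]; eexists.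
rewrite linearBl; apply/eqP; rewrite subr_eq0; apply/eqP.
by rewrite -{1}pf' -pf pB pB'.
Qed.

(** T_{n+1} is tested on n + 1 vectors. After the first n, its value is the n-bracket of the double,
    which the injective [phi] transports from [M]. *)
Lemma tsum_unique (X X' : linf_bialgebra K V) (phi : 'Hom(vec K D, vec K W)) :
  double_iso X M phi -> double_iso X' M phi ->
  forall n, (1 <= n)%N -> tsum (bi_elt X') n = tsum (bi_elt X) n.
Proof.
move=> [[_ k0 _] _ _ _ pE] [_ _ _ _ pE'] n n1.
have wX Y : xgr (fun=> 1 : int) n.+1%:Z (tsum (@bi_elt K V Y) n).
  by apply: tsum_wt => k l k1 l1; apply: bi_elt_wt.
apply/eqP; rewrite -subr_eq0; apply/eqP; apply: (@eps_nondeg K V n.+1).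
  by apply: xgrD; [|rewrite -scaleN1r; apply: xgrZ].
case/lastP=> [|u j] //; rewrite size_rcons => -[su].
have e : xiter (tsum (bi_elt X') n) (map (@dvec K V) u) = xiter (tsum (bi_elt X) n) (map (@dvec K V) u).
  have w1 Y : xgr (fun=> 1 : int) 1 (xiter (tsum (@bi_elt K V Y) n) (map (@dvec K V) u)).
    have := wt_xiter (vs := map (@dvec K V) u) (wX Y).
    by rewrite size_map su (_ : n.+1%:Z - n%:Z = 1) //; lia.
  rewrite (wt1P (w1 X)) (wt1P (w1 X')); apply: congr1.
  rewrite -!double_bracketE; apply: (can_inj (lker0_lfunK (introT eqP k0))).
  have su' : size (map (@dvec K V) u) == n by rewrite size_map su.
  by have := pE n (Tuple su') n1; rewrite (pE' n (Tuple su') n1).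
rewrite map_rcons !xiter_rcons -scaleN1r xiterD xiterZ e scaleN1r subrr.
by rewrite xbracket0l eps0.
Qed.

(** Words with k letters in V isolate [t k l] inside the sum over all pairs with the same [k + l];
    other words annihilate [t k l]. *)
Lemma bi_elt_unique (X X' : linf_bialgebra K V) :
  (forall n, (1 <= n)%N -> tsum (bi_elt X') n = tsum (bi_elt X) n) ->
  forall k l, (1 <= k)%N -> (1 <= l)%N -> bi_elt X' k l = bi_elt X k l.
Proof.
move=> H k l k1 l1; pose n := (k + l).-1.
apply/eqP; rewrite -subr_eq0; apply/eqP; apply: (@eps_nondeg K V (k + l)).
  by apply: xgrD; [|rewrite -scaleN1r; apply: xgrZ]; apply: bi_elt_wt.
move=> w sw; rewrite -scaleN1r xiterD xiterZ epsD epsZ mulN1r.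
apply/eqP; rewrite subr_eq0; apply/eqP.
have cw := count_predC (@is_dual V) w.
have [wk|wk] := eqVneq (count (predC (@is_dual V)) w) k; last first.
  have z Y : eps (xiter (@bi_elt K V Y k l) (map (@dvec K V) w)) = 0.
    by apply: (eps_iter_gr (@ndual_dl V) (@bi_elt_dual K V Y k l k1 l1)); rewrite sum_ndual; lia.
  by rewrite !z.
have sel Y : eps (xiter (tsum (@bi_elt K V Y) n) (map (@dvec K V) w))
    = eps (xiter (bi_elt Y k l) (map (@dvec K V) w)).
  have kn : (1 <= k < n.+1)%N by rewrite /n; lia.
  rewrite /tsum xiter_sum eps_sum (bigD1_seq k) ?mem_index_iota ?iota_uniq //=.
  rewrite (_ : n.+1 - k = l)%N; last by rewrite /n; lia.
  rewrite big_seq_cond big1 ?addr0 // => j /andP[]; rewrite mem_index_iota => jn jk.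
  apply: (eps_iter_gr (@ndual_dl V) (@bi_elt_dual K V Y j (n.+1 - j) _ _)); [lia|lia|].
  by rewrite sum_ndual; lia.
by rewrite -!sel H // /n; lia.
Qed.

(** [bi_tauE] expresses [tau] through [t] after [ext_map inV], which is injective. *)
Lemma bialgebra_unique (X X' : linf_bialgebra K V) :
  (forall k l, (1 <= k)%N -> (1 <= l)%N -> bi_elt X' k l = bi_elt X k l) -> bialgebra_eq X' X.
Proof.
move=> H k l x k1 l1 hx.
rewrite [x]malg_mono !linear_sum big_seq [RHS]big_seq; apply: eq_bigr => w /hx sw.
rewrite !linearZ; apply: congr1; rewrite -wprod_delta.
set vs := map _ w; have svs : size vs == k by rewrite size_map sw.
apply: (can_inj (f := ext_map (@inV K V)) (g := fun y => lower (toX y)) (@ext_mapK K V)).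
rewrite -[vs]/(tval (Tuple svs)).
apply: etrans (bi_tauE X' (Tuple svs) k1 l1) _.
apply: etrans _ (esym (bi_tauE X (Tuple svs) k1 l1)).
apply: etrans (esym (bi_elt_iter _ _ _ _)) _; apply: etrans _ (bi_elt_iter _ _ _ _).
by rewrite H.
Qed.

End Uniqueness.

Theorem theorem33 (R : realType) (K : numFieldType)
  (hK : K = (R : numFieldType) \/ K = (R[i]%C : numFieldType)) :
  (forall (V : gvect) (X : linf_bialgebra K V),
     exists M : manin_triple K (dbl V), double_iso X M \1%VF)
  /\
  (forall (W : gvect) (M : manin_triple K W),
     (exists (V : gvect) (f : 'Hom(vec K V, vec K W)),
        graded_iso_onto f (mt_plus M))
     /\
     (forall (V : gvect) (f : 'Hom(vec K V, vec K W)),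
        graded_iso_onto f (mt_plus M) ->
        exists (X : linf_bialgebra K V)
               (phi : 'Hom(vec K (dbl V), vec K W)),
          [/\ forall v : vec K V, phi (inV v) = f v,
              double_iso X M phi
            & forall (X' : linf_bialgebra K V)
                     (phi' : 'Hom(vec K (dbl V), vec K W)),
                (forall v : vec K V, phi' (inV v) = f v) ->
                double_iso X' M phi' ->
                bialgebra_eq X' X /\ phi' = phi])).
Proof.
split=> [V X|W M]; first by exists (bialgebra_triple X); apply: bialgebra_triple_iso.
split=> [|V f hf]; first exact: graded_iso_exists (@mt_plus_graded _ _ M).
have [phi hphi] := phi_exists hf.
have iso := triple_bialgebra_iso hphi.
exists (triple_bialgebra hphi), phi; split=> [||X' phi' hf' iso'] //.
  exact: phi_f hphi.
have e := double_iso_unique hf (phi_f hphi) hf' iso iso'; split=> //.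
by rewrite e in iso'; apply/bialgebra_unique/bi_elt_unique/(tsum_unique iso iso').
Qed.
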